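(* Let $m,n\ge 1$, let $\varphi:[0,\infty)\to(0,\infty)$ be an admissible weight, and let $f:\mathbb{C}^m\to P^n(\mathbb{C})$ be a holomorphic mapping. Let $S_1,\ldots,S_q$ be hypersurfaces in $P^n(\mathbb{C})$ defined by nonzero homogeneous polynomials $Q_j\in\mathbb{C}[x_0,\ldots,x_n]$ of degree $d_j$, $j=1,\ldots,q$; put $$l_{\mathcal{S}}=\operatorname{lcm}(d_1,\ldots,d_q),\qquad n_{\mathcal{S}}=\binom{n+l_{\mathcal{S}}}{n}-1,$$ and assume that $q\ge n n_{\mathcal{S}}+2n+1$ and that $S_1,\ldots,S_q$ are located in general position in $P^n(\mathbb{C})$. Let $l_1,\ldots,l_q\in\mathbb{N}\cup\{\infty\}$ satisfy $$\sum_{j=1}^q\frac{1}{l_j}<\frac{q-n-(n-1)(n_{\mathcal{S}}+1)}{n_{\mathcal{S}}(n_{\mathcal{S}}+2)}.$$ Let $\hat f=(f_0,\ldots,f_n)$ be a reduced representation of $f$ on $\mathbb{C}^m$, and for each $z\in\mathbb{C}^m$ let $i=i(z)\in\{0,\ldots,n\}$ be an index with $f_i(z)\ne 0$. Suppose that for all $j\in\{1,\ldots,q\}$ with $l_j\ge 2$, $$\sup_{1\le|\alpha|\le l_j-1,\ z\in f^{-1}(S_j)}\varphi^{|\alpha|}(\|z\|)\left|\frac{\partial^{\alpha}(Q_j(\hat f_i))}{\partial z^{\alpha}}(z)\right|<\infty .$$ Then $f\in\mathcal{Y}_{\varphi}(\mathbb{C}^m,P^n(\mathbb{C}))$.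
   Context: Admissible weight: a positive function $\varphi:[0,\infty)\to(0,\infty)$ such that, with $\gamma_r:=\sup_{r\le a<b}\left|\frac{\varphi(a)-\varphi(b)}{a-b}\right|$, there is a constant $C\in(0,1]$ with $\gamma_r\le C$ for all $r\in(0,\infty)$, and $\lim_{r\to\infty}\gamma_r=0$. Weighted Yosida mappings: $P^n(\mathbb{C})$ carries the Fubini–Study metric $ds^2=\frac{\langle dx,dx\rangle\langle x,x\rangle-|\langle x,dx\rangle|^2}{\langle x,x\rangle^2}$ in homogeneous coordinates, and $E_{P^n(\mathbb{C})}(p,\xi)=(ds^2(\xi,\bar\xi))^{1/2}$ is the length of a tangent vector $\xi$ at $p$. A holomorphic mapping $f:\mathbb{C}^m\to P^n(\mathbb{C})$ belongs to $\mathcal{Y}_{\varphi}(\mathbb{C}^m,P^n(\mathbb{C}))$ if $$\limsup_{\|z\|\to\infty,\ \|\xi\|=1}\varphi(\|z\|)\,E_{P^n(\mathbb{C})}(f(z),df(z)(\xi))<\infty,$$ where $df(z)$ is the differential of $f$ at $z$, $\|\cdot\|$ is the Euclidean norm, and $\xi$ ranges over unit vectors of $\mathbb{C}^m$. Reduced representation: a holomorphic map $\hat f=(f_0,\ldots,f_n):\mathbb{C}^m\to\mathbb{C}^{n+1}$ with no common zeros of $f_0,\ldots,f_n$ and $f(z)=[f_0(z):\cdots:f_n(z)]$ for all $z$. For an index $i$ with $f_i\not\equiv 0$, $\hat f_i:=\left(\frac{f_0}{f_i},\ldots,\frac{f_n}{f_i}\right)$, which is holomorphic near every point where $f_i\ne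 0$. $f^{-1}(S_j)=\{z\in\mathbb{C}^m: Q_j(\hat f(z))=0\}$. $\alpha=(\alpha_1,\ldots,\alpha_m)$ is a multi-index, $|\alpha|=\alpha_1+\cdots+\alpha_m$. If $l_j=\infty$, then $\alpha$ ranges over all multi-indices with $|\alpha|\ge 1$ and $1/l_j=0$. General position: $S_1,\ldots,S_q$ ($q\ge n+1$) are located in general position in $P^n(\mathbb{C})$ if for any $1\le j_0<\cdots<j_n\le q$ the system $Q_{j_0}(x)=\cdots=Q_{j_n}(x)=0$ has only the trivial solution $x=0$ in $\mathbb{C}^{n+1}$. *)

(* Defs.v *)
(* The complex numbers are R[i] for an arbitrary R : realType. *)
From HB Require Import structures.
From mathcomp Require Export all_boot all_order all_algebra.
From mathcomp Require Export complex.
From mathcomp Require Export all_classical all_reals all_analysis.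
From mathcomp Require Import ring.
(* The notations of mpoly clash with those of MathComp-Analysis. *)
From mathcomp Require Export -(notations) mpoly.
Export numFieldNormedType.Exports.
Set Implicit Arguments.
Unset Strict Implicit.
Unset Printing Implicit Defensive.
Import Order.TTheory GRing.Theory Num.Theory.
Local Open Scope classical_set_scope.
Local Open Scope ring_scope.

Definition cabs (R : realType) (c : R[i]) : R := complex.Re `|c|.

(* The library norm on row vectors is the sup norm; this is the Euclidean one. *)
Definition enorm (R : realType) (k : nat) (x : 'rV[R[i]]_k) : R :=
  Num.sqrt (complex.Re (dotmx x x)).

(* Only the values of a weight on [0, +oo[ are ever used. *)
Definition gamma (R : realType) (phi : R -> R) (r : R) : \bar R :=
  ereal_sup [set y | exists a b : R,
    [/\ r <= a, a < b & y = (`|(phi a - phi b) / (a - b)|)%:E]].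

Definition admissible (R : realType) (phi : R -> R) : Prop :=
  [/\ forall x : R, 0 <= x -> 0 < phi x,
      exists C : R, [/\ 0 < C, C <= 1 &
        forall r : R, 0 < r -> (gamma phi r <= C%:E)%E]
    & gamma phi r @[r --> +oo] --> 0%E].

(* C^k, exposed as a normed space so that its topology is found. *)
Local Notation cvec R k := ('rV[R[i]]_k : normedModType R[i]).

(* Points are the lines through the origin: x is a vector of homogeneous
   coordinates of p when val p = <[x]>%VS. *)
Definition Pn (R : realType) (n : nat) : Type :=
  {L : {vspace 'rV[R[i]]_n.+1} | \dim L == 1%N}.

Definition has_hcoord (R : realType) (n : nat) (p : Pn R n)
    (x : 'rV[R[i]]_n.+1) : Prop := val p = <[x]>%VS.

Definition in_chart (R : realType) (n : nat) (k : 'I_n.+1) (p : Pn R n) : bool :=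
  vpick (val p) 0 k != 0.

(* The k-th affine chart, with values in the slice {x | x_k = 1} of C^(n+1). *)
Definition chart (R : realType) (n : nat) (k : 'I_n.+1) (p : Pn R n)
    : 'rV[R[i]]_n.+1 :=
  (vpick (val p) 0 k)^-1 *: vpick (val p).

Lemma hcoord_pick (R : realType) (n : nat) (p : Pn R n) x :
  has_hcoord p x -> exists2 c, c != 0 & vpick (val p) = c *: x.
Proof.
rewrite /has_hcoord => px; have := memv_pick (val p).
rewrite {2}px => /vlineP[c vE]; exists c => //.
apply/eqP => c0; have /eqP := valP p.
by move: vE; rewrite c0 scale0r => /eqP; rewrite vpick0 => /eqP ->; rewrite dimv0.
Qed.

Lemma in_chartE (R : realType) (n : nat) (k : 'I_n.+1) (p : Pn R n) x :
  has_hcoord p x -> in_chart k p = (x 0 k != 0).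
Proof.
by move=> /hcoord_pick[c c0 vE]; rewrite /in_chart vE mxE mulf_eq0 negb_or c0.
Qed.

Lemma chartE (R : realType) (n : nat) (k : 'I_n.+1) (p : Pn R n) x :
  has_hcoord p x -> chart k p = (x 0 k)^-1 *: x.
Proof.
move=> /hcoord_pick[c c0 vE].
by rewrite /chart vE mxE invfM scalerA mulrAC mulVf // mul1r.
Qed.

(* Over the field R[i], [differentiable] is complex Frechet differentiability. *)
Definition entire (R : realType) (m k : nat) (F : 'rV[R[i]]_m -> 'rV[R[i]]_k)
    : Prop := forall z, differentiable F z.

(* Continuity and holomorphy read in the standard atlas of P^n(C). *)
Definition holomorphic (R : realType) (m n : nat) (f : 'rV[R[i]]_m -> Pn R n)
    : Prop :=
  forall k : 'I_n.+1,
    open ([set z | in_chart k (f z)] : set (cvec R m)) /\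
    forall z : cvec R m, in_chart k (f z) -> differentiable (fun w => chart k (f w)) z.

Definition reduced_representation (R : realType) (m n : nat)
    (f : 'rV[R[i]]_m -> Pn R n) (F : 'rV[R[i]]_m -> 'rV[R[i]]_n.+1) : Prop :=
  [/\ entire F, forall z, F z != 0 & forall z, has_hcoord (f z) (F z)].

(* Length of the tangent vector dx at the point with homogeneous coordinates x. *)
Definition fs_length (R : realType) (n : nat) (x dx : 'rV[R[i]]_n.+1) : R :=
  Num.sqrt (complex.Re
    ((dotmx dx dx * dotmx x x - `|dotmx x dx| ^+ 2) / dotmx x x ^+ 2)).

(* Two lifts x and c x of one curve have velocities dx and c dx + b x. *)
Lemma fs_length_lift (R : realType) (n : nat) (x dx : 'rV[R[i]]_n.+1) (c b : R[i]) :
  x != 0 -> c != 0 -> fs_length (c *: x) (c *: dx + b *: x) = fs_length x dx.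
Proof.
move=> x0 c0; rewrite /fs_length !normCK.
have dC (u v : 'rV[R[i]]_n.+1) : (dotmx u v)^* = dotmx v u.
  rewrite !dotmxE !mxE rmorph_sum; apply: eq_bigr => k _.
  by rewrite !mxE rmorphM /= conjCK mulrC.
have dDl (u v w : 'rV[R[i]]_n.+1) : dotmx (u + v) w = dotmx u w + dotmx v w.
  by rewrite !dotmxE mulmxDl mxE.
have dZl t (u v : 'rV[R[i]]_n.+1) : dotmx (t *: u) v = t * dotmx u v.
  by rewrite !dotmxE -scalemxAl mxE.
have dDr (u v w : 'rV[R[i]]_n.+1) : dotmx w (u + v) = dotmx w u + dotmx w v.
  by rewrite -dC dDl rmorphD /= !dC.
have dZr t (u v : 'rV[R[i]]_n.+1) : dotmx v (t *: u) = t^* * dotmx v u.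
  by rewrite -dC dZl rmorphM /= dC.
rewrite !dC !(dDl, dZl, dDr, dZr).
have a0 : dotmx x x != 0 by rewrite gt_eqF // dotmx_is_dotmx.
have cc0 : c^* != 0 by rewrite conjC_eq0.
by congr (Num.sqrt (complex.Re _)); field; rewrite a0 c0 cc0.
Qed.

Definition a_chart (R : realType) (n : nat) (p : Pn R n) : 'I_n.+1 :=
  odflt ord0 [pick k | in_chart k p].

(* E (f z, df(z)(xi)), with the differential taken in a chart around f z;
   by fs_length_lift the choice of the chart does not matter. *)
Definition fs_speed (R : realType) (m n : nat) (f : cvec R m -> Pn R n)
    (z xi : cvec R m) : R :=
  let k := a_chart (f z) in
  fs_length (chart k (f z)) ('d (fun w => chart k (f w)) z xi).

(* The filter of the pairs (z, xi) with |z| --> +oo and |xi| = 1. *)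
Definition infty_unit (R : realType) (m : nat)
    : set (set ('rV[R[i]]_m * 'rV[R[i]]_m)) :=
  filter_from [set: R] (fun r => [set p | r < enorm p.1 /\ enorm p.2 = 1]).

Definition yosida (R : realType) (m n : nat) (phi : R -> R)
    (f : 'rV[R[i]]_m -> Pn R n) : Prop :=
  holomorphic f /\
  (limf_esup (fun p : cvec R m * cvec R m =>
      (phi (enorm p.1) * fs_speed f p.1 p.2)%:E) (@infty_unit R m) < +oo)%E.

Definition peval (R : realType) (n : nat) (Q : mpoly n.+1 R[i])
    (x : 'rV[R[i]]_n.+1) : R[i] := meval (fun k => x 0 k) Q.

(* [ishomog1 d mdeg] is what the notation d.-homog of mpoly stands for. *)
Definition hypersurface_eq (R : realType) (n : nat) (d : nat)
    (Q : mpoly n.+1 R[i]) : Prop :=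
  [/\ (0 < d)%N, Q != 0 & Q \is ishomog1 d mdeg].

Definition general_position (R : realType) (n q : nat)
    (Q : 'I_q -> mpoly n.+1 R[i]) : Prop :=
  forall j : 'I_n.+1 -> 'I_q, (forall a b : 'I_n.+1, (a < b)%N -> (j a < j b)%N) ->
  forall x : 'rV[R[i]]_n.+1, (forall a, peval (Q (j a)) x = 0) -> x = 0.

Definition lS (q : nat) (d : 'I_q -> nat) : nat := \big[lcmn/1%N]_(j < q) d j.

Definition nS (n q : nat) (d : 'I_q -> nat) : nat := ('C(n + lS d, n) - 1)%N.

(* An element l of N u {oo} is an [option nat], with [None] for oo. *)

Definition le_mult (k : nat) (l : option nat) : bool :=
  if l is Some l' then (k <= l')%N else true.

Definition inv_mult (R : realType) (l : option nat) : R :=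
  if l is Some l' then l'%:R^-1 else 0.

(* R[i]^o is R[i] as a normed space over itself. *)
Definition partial (R : realType) (m : nat) (k : 'I_m) (g : 'rV[R[i]]_m -> R[i]^o)
    : 'rV[R[i]]_m -> R[i]^o := fun z => 'D_(delta_mx 0 k) g z.

Definition mpartial (R : realType) (m : nat) (alpha : multinom m)
    (g : 'rV[R[i]]_m -> R[i]^o) : 'rV[R[i]]_m -> R[i]^o :=
  foldr (fun k h => iter (alpha k) (partial k) h) g (enum 'I_m).

(* F / F_k; it is meaningful (and holomorphic) where F_k does not vanish. *)
Definition dehomog (R : realType) (m n : nat) (F : 'rV[R[i]]_m -> 'rV[R[i]]_n.+1)
    (k : 'I_n.+1) (z : 'rV[R[i]]_m) : 'rV[R[i]]_n.+1 :=
  \row_t (F z 0 t / F z 0 k).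

(* Main.v *)
(* Rescaling [f] by [phi] along the coordinate directions gives a family of
   entire curves, and it is enough that near 0 all homogeneous coordinates of
   such a curve are at most twice a fixed one of them, on a disc whose radius
   does not depend on the curve. If not, Hofer's selection of points and an
   ultralimit produce a nonconstant entire curve [g] in P^n which meets every
   [S_j] not containing it with multiplicity at least [l_j]: by Hurwitz, and
   because the bounds on the derivatives tend to 0 under rescaling. The case
   [l_j = oo] is covered by a large finite multiplicity.

   No such [g] exists. Let [L = lcm d_j], let [W] be the Wronskian of a basis,
   of size [r], of the degree-[L] monomials in [g], and put
   [G_j = Q_j(g)^(L/d_j)]. If a bounded holomorphic [G] has only zeros of order
   at least [l], then [|G^(p)(0)| = O(|G(0)|^(1 - p/l - eps))]; hence
   [W^A = O(G_j^(B_j))] with [B_j] close to [A (1 - (r-1)/l_j)]. By general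
   position at most [n] of the [G_j] are small at a given point, so
   [W^(A n) = O(\prod_j G_j^(B_j))]. The assumption on the [1/l_j] makes
   [\sum_j B_j > n A r], so that [W^(A n)] times a monomial in [g] of the right
   positive degree, divided by [\prod_j G_j^(B_j)], does not depend on the lift
   of [g] and is bounded on C. It is constant by Liouville, and therefore so is
   [g]. *)

Require Import Defs.
From mathcomp Require Import all_boot all_order all_algebra.
From mathcomp Require Import complex.
From mathcomp Require Import all_classical all_reals all_analysis.
From mathcomp Require Import perm ring lra zify.
Import Order.TTheory GRing.Theory Num.Theory.
Local Open Scope classical_set_scope.
Local Open Scope ring_scope.
Set Implicit Arguments.
Unset Strict Implicit.
Unset Printing Implicit Defensive.

(* [lra] collects all hypotheses, which makes it slow in large contexts. *)
Ltac slim_lra := first [ solve [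
  repeat match goal with x := _ |- _ => clearbody x end;
  repeat match goal with H : ?P |- _ =>
    lazymatch type of P with Prop =>
      lazymatch P with
      | is_true (Order.le _ _) => fail
      | is_true (Order.lt _ _) => fail
      | is_true (andb _ _) => fail
      | @eq (Real.sort _) _ _ => fail
      | _ => clear H
      end
    end
  end; lra ] | lra ].

(** * Complex derivatives *)

(** Contact orders are usually exploited through counting functions; here every estimate is
    pointwise, and two choices make this possible. First, the limit curve has no global lift at
    hand. It is a family of normalised lifts on discs of radius 1/2, and what is carried from disc
    to disc is always an expression with a degree of homogeneity in the lift; the bounds on the
    Wronskian are proved at the centres and moved by homogeneity. Second, the exponent 1 - p/l comes
    from a distance. A zero b of order l of G satisfies |G(0)| = O(|b|^l), so no zero is nearer than
    a multiple of |G(0)|^(1/l). Cauchy's estimate at that radius costs |G(0)|^(-p/l), and eps pays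
    for comparing G with G(0) there: once the zeros are divided out, Harnack's inequality applies to
    the cofactor. Raising to an integer power A turns the exponents into natural numbers. Coordinate
    slices suffice because the differential is linear. A single ultrafilter replaces every
    extraction of a subsequence. *)

Section Modulus.
Variable R : realType.
Implicit Types x y z : R[i].

Lemma cabs_normc z : cabs z = ComplexField.Normc.normc z.
Proof. by case: z. Qed.

Lemma normr_cabs z : `|z| = (cabs z)%:C%C.
Proof. by rewrite /cabs; case: z. Qed.

Lemma cabs_ge0 z : 0 <= cabs z.
Proof. by rewrite -ler0c -normr_cabs normr_ge0. Qed.

Lemma cabsM x y : cabs (x * y) = cabs x * cabs y.
Proof. by rewrite !cabs_normc ComplexField.Normc.normcM. Qed.

Lemma cabsD x y : cabs (x + y) <= cabs x + cabs y.
Proof. by rewrite -lecR rmorphD /= -!normr_cabs ler_normD. Qed.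

Lemma cabsN x : cabs (- x) = cabs x.
Proof. by rewrite /cabs normrN. Qed.

Lemma cabsB x y : cabs (x - y) = cabs (y - x).
Proof. by rewrite -cabsN opprB. Qed.

Lemma cabs0 : cabs (0 : R[i]) = 0.
Proof. by rewrite /cabs normr0. Qed.

Lemma cabs1 : cabs (1 : R[i]) = 1.
Proof. by rewrite /cabs normr1. Qed.

Lemma cabsV x : cabs x^-1 = (cabs x)^-1.
Proof. by rewrite !cabs_normc ComplexField.Normc.normcV. Qed.

Lemma cabs_eq0 x : (cabs x == 0) = (x == 0).
Proof.
apply/eqP/eqP => [|->]; last exact: cabs0.
by rewrite cabs_normc => /ComplexField.Normc.eq0_normc.
Qed.

Lemma cabs_gt0 x : (0 < cabs x) = (x != 0).
Proof. by rewrite lt0r cabs_eq0 cabs_ge0 andbT. Qed.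

Lemma cabsX x k : cabs (x ^+ k) = cabs x ^+ k.
Proof. by elim: k => [|k IH]; rewrite ?expr0 ?cabs1 // !exprS cabsM IH. Qed.

Lemma cabsR (a : R) : cabs a%:C%C = `|a|.
Proof. by rewrite cabs_normc /= expr0n /= addr0 sqrtr_sqr. Qed.

Lemma cabs_nat k : cabs (k%:R : R[i]) = k%:R.
Proof. by rewrite -(rmorph_nat (real_complex R)) cabsR normr_nat. Qed.

Lemma cabs_sum (I : Type) (s : seq I) (P : pred I) (f : I -> R[i]) :
  cabs (\sum_(i <- s | P i) f i) <= \sum_(i <- s | P i) cabs (f i).
Proof.
elim/big_ind2: _ => [|x a y b xa yb|//]; first by rewrite cabs0.
exact: le_trans (cabsD _ _) (lerD xa yb).
Qed.

Lemma cabs_prod (I : Type) (s : seq I) (P : pred I) (f : I -> R[i]) :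
  cabs (\prod_(i <- s | P i) f i) = \prod_(i <- s | P i) cabs (f i).
Proof. exact: (big_morph _ cabsM cabs1). Qed.

Lemma le_cabsB x y : cabs x - cabs y <= cabs (x - y).
Proof. by rewrite lerBlDr -{1}(subrK y x) cabsD. Qed.

Lemma cabs_tri x y z : cabs (x - z) <= cabs (x - y) + cabs (y - z).
Proof. by rewrite -(subrKA y) cabsD. Qed.

Lemma Re_le_cabs z : `|complex.Re z| <= cabs z.
Proof.
case: z => a b; rewrite cabs_normc /= -sqrtr_sqr ler_sqrt ?addr_ge0 ?sqr_ge0 //.
by rewrite lerDl sqr_ge0.
Qed.

Lemma Im_le_cabs z : `|complex.Im z| <= cabs z.
Proof.
case: z => a b; rewrite cabs_normc /= -sqrtr_sqr ler_sqrt ?addr_ge0 ?sqr_ge0 //.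
by rewrite lerDr sqr_ge0.
Qed.

Lemma cabs_le_ReIm z : cabs z <= `|complex.Re z| + `|complex.Im z|.
Proof.
rewrite {1}[z]complexE; apply: le_trans (cabsD _ _) _.
rewrite cabsM !cabsR (_ : cabs 'i%C = 1) ?mul1r //.
by rewrite cabs_normc /= expr0n expr1n /= add0r sqrtr1.
Qed.

Lemma cabsi : cabs ('i%C : R[i]) = 1.
Proof. by rewrite cabs_normc /= expr0n expr1n /= add0r sqrtr1. Qed.

Lemma eps_eq0 (x : R) : (forall e, 0 < e -> `|x| <= e) -> x = 0.
Proof.
move=> h; apply/eqP; rewrite -normr_le0 leNgt; apply/negP => x0.
have := h (`|x| / 2); rewrite divr_gt0 // => /(_ isT); slim_lra.
Qed.

Lemma ceps_eq0 x : (forall e, 0 < e -> cabs x <= e) -> x = 0.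
Proof.
move=> h; apply/eqP; rewrite -cabs_eq0; apply/eqP/eps_eq0 => e e0.
by rewrite ger0_norm ?cabs_ge0 ?h.
Qed.

End Modulus.

Section Derivative.
Variable R : realType.
Local Notation C := R[i].
Implicit Types (f g : C -> C) (z w L M : C).

(** The error is measured by the real-valued [cabs], so that all later estimates are inequalities in
    [R]; stated without a quotient, the condition is harmless at w = 0. *)
Definition cder f z L := forall e : R, 0 < e -> exists2 d : R, 0 < d &
  forall w, cabs w < d -> cabs (f (z + w) - f z - L * w) <= e * cabs w.

Definition cdiff f z := exists L, cder f z L.

Lemma cder_lip f z L : cder f z L -> exists2 d : R, 0 < d &
  forall w, cabs w < d -> cabs (f (z + w) - f z) <= (cabs L + 1) * cabs w.
Proof.
move=> /(_ 1 ltr01)[d d0 h]; exists d => // w wd.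
rewrite (_ : _ - _ = (f (z + w) - f z - L * w) + L * w); last by ring.
apply: le_trans (cabsD _ _) _; rewrite cabsM.
by have := h _ wd; slim_lra.
Qed.

Lemma cdiff_cont f z : cdiff f z -> forall e : R, 0 < e -> exists2 d : R, 0 < d &
  forall w, cabs (w - z) < d -> cabs (f w - f z) <= e.
Proof.
move=> [L /cder_lip[d d0 h]] e e0.
have L1 : 0 < cabs L + 1 by rewrite ltr_wpDl ?cabs_ge0.
exists (Num.min d (e / (cabs L + 1))); first by rewrite lt_min d0 divr_gt0.
move=> w; rewrite lt_min => /andP[wd we].
have := h _ wd; rewrite [z + _]addrC subrK => h1; apply: le_trans h1 _.
by move: we; rewrite ltr_pdivlMr // mulrC => /ltW.
Qed.

Lemma cder_uniq f z L M : cder f z L -> cder f z M -> L = M.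
Proof.
move=> hL hM; apply/subr0_eq/ceps_eq0 => e e0.
have [d d0 h] := hL (e / 2) (divr_gt0 e0 (ltr0Sn _ _)).
have [d' d'0 h'] := hM (e / 2) (divr_gt0 e0 (ltr0Sn _ _)).
pose t := Num.min d d' / 2; have t0 : 0 < t by rewrite divr_gt0 // lt_min d0.
pose w : C := t%:C%C; have wE : cabs w = t by rewrite cabsR gtr0_norm.
have td : t < d /\ t < d'.
  have m1 : Num.min d d' <= d by rewrite ge_min lexx.
  have m2 : Num.min d d' <= d' by rewrite ge_min lexx orbT.
  by move: t0; rewrite /t; slim_lra.
have := h w; rewrite wE => /(_ td.1) h1; have := h' w; rewrite wE => /(_ td.2) h2.
have : cabs ((L - M) * w) <= e * t.
  rewrite (_ : _ * w = (f (z + w) - f z - M * w) - (f (z + w) - f z - L * w));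
    last by ring.
  by apply: le_trans (cabsD _ _) _; rewrite cabsN; slim_lra.
by rewrite cabsM wE ler_pM2r.
Qed.

Lemma cder_local f g z L (d : R) : 0 < d ->
  (forall w, cabs (w - z) < d -> f w = g w) -> cder f z L -> cder g z L.
Proof.
move=> d0 fg h e e0; have [d' d'0 h'] := h _ e0.
exists (Num.min d d'); rewrite ?lt_min ?d0 // => w; rewrite lt_min => /andP[wd wd'].
by rewrite -!fg ?h' // ?subrr ?cabs0 // addrC addKr.
Qed.

Lemma cder_cst c z : cder (fun=> c) z 0.
Proof.
by move=> e e0; exists 1 => // w _; rewrite subrr mul0r subr0 cabs0 mulr_ge0 ?cabs_ge0 ?ltW.
Qed.

Lemma cder_id z : cder id z 1.
Proof.
move=> e e0; exists 1 => // w _.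
by rewrite mul1r [z + w]addrC addrK subrr cabs0 mulr_ge0 ?cabs_ge0 ?ltW.
Qed.

Lemma cderD f g z L M : cder f z L -> cder g z M ->
  cder (fun w => f w + g w) z (L + M).
Proof.
move=> hf hg e e0.
have [d d0 h] := hf (e / 2) (divr_gt0 e0 (ltr0Sn _ _)).
have [d' d'0 h'] := hg (e / 2) (divr_gt0 e0 (ltr0Sn _ _)).
exists (Num.min d d'); rewrite ?lt_min ?d0 // => w; rewrite lt_min => /andP[wd wd'].
rewrite (_ : _ - _ - _ = (f (z + w) - f z - L * w) + (g (z + w) - g z - M * w));
  last by ring.
by apply: le_trans (cabsD _ _) _; have := h _ wd; have := h' _ wd'; slim_lra.
Qed.

Lemma cderM f g z L M : cder f z L -> cder g z M ->
  cder (fun w => f w * g w) z (L * g z + f z * M).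
Proof.
move=> hf hg e e0; have [d1 d10 h1] := cder_lip hf.
have [d4 d40 h4] := cder_lip hg.
pose A := cabs L + 1; pose K := cabs (g z) + cabs (f z) + 1.
have A0 : 0 < A by rewrite ltr_wpDl ?cabs_ge0.
pose B := cabs M + 1.
have B0 : 0 < B by rewrite ltr_wpDl ?cabs_ge0.
have K0 : 0 < K by rewrite ltr_wpDl // addr_ge0 ?cabs_ge0.
pose e1 := e / (K * 2); have e10 : 0 < e1 by rewrite divr_gt0 // mulr_gt0.
have [d2 d20 h2] := hf _ e10; have [d3 d30 h3] := hg _ e10.
(* The last bound is for the cross term (f1 - f z)(g1 - g z), which is at most A B |w|^2 and must
   stay below e/2 |w|. *)
pose d := Num.min (Num.min d1 d2) (Num.min (Num.min d3 d4) (e / (A * B * 2))).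
have d0 : 0 < d by rewrite !lt_min d10 d20 d30 d40 divr_gt0 ?mulr_gt0.
exists d => // w; rewrite !lt_min => /andP[/andP[w1 w2] /andP[/andP[w3 w4] w5]].
set f1 := f (z + w); set g1 := g (z + w).
rewrite (_ : _ - _ - _ = (f1 - f z - L * w) * g z + f z * (g1 - g z - M * w)
   + (f1 - f z) * (g1 - g z)); last by ring.
apply: le_trans (cabsD _ _) _; apply: le_trans (lerD (cabsD _ _) (lexx _)) _.
rewrite !cabsM; have := h1 _ w1; have := h2 _ w2; have := h3 _ w3; have := h4 _ w4.
rewrite -/f1 -/g1 -/A -/B => {}h4 {}h3 {}h2 {}h1.
have c1 := ler_wpM2r (cabs_ge0 (g z)) h2; have c2 := ler_wpM2l (cabs_ge0 (f z)) h3.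
have c3 := ler_pM (cabs_ge0 _) (cabs_ge0 _) h1 h4.
have c4 : A * cabs w * (B * cabs w) <= e / 2 * cabs w.
  rewrite mulrA ler_wpM2r ?cabs_ge0 // (_ : _ * B = A * B * cabs w); last by ring.
  rewrite ler_pdivlMr // -mulrA [_ * 2]mulrC mulrA.
  by move: w5; rewrite ltr_pdivlMr ?mulr_gt0 // => /ltW; slim_lra.
have eK : e1 * K = e / 2 by rewrite /e1; field; rewrite gt_eqF.
have c5 : e1 * cabs w * cabs (g z) + cabs (f z) * (e1 * cabs w) <= e1 * K * cabs w.
  rewrite /K; have : 0 <= e1 * cabs w by rewrite mulr_ge0 ?cabs_ge0 ?ltW.
  nra.
by rewrite eK in c5; slim_lra.
Qed.

Lemma cderZ c f z L : cder f z L -> cder (fun w => c * f w) z (c * L).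
Proof. by move=> h; have := cderM (cder_cst c z) h; rewrite mul0r add0r. Qed.

Lemma cderN f z L : cder f z L -> cder (fun w => - f w) z (- L).
Proof.
move=> /(cderZ (-1)); rewrite mulN1r; apply: (@cder_local _ _ _ _ 1) => // w _.
by rewrite mulN1r.
Qed.

Lemma cderB f g z L M : cder f z L -> cder g z M ->
  cder (fun w => f w - g w) z (L - M).
Proof. by move=> hf /cderN; apply: cderD. Qed.

Lemma cder_comp f g z L M : cder g z M -> cder f (g z) L ->
  cder (fun w => f (g w)) z (L * M).
Proof.
move=> hg hf e e0; have [d1 d10 h1] := cder_lip hg.
pose A := cabs M + 1; have A0 : 0 < A by rewrite ltr_wpDl ?cabs_ge0.
pose B := cabs L + 1; have B0 : 0 < B by rewrite ltr_wpDl ?cabs_ge0.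
have [d2 d20 h2] := hf (e / (A * 2)) (divr_gt0 e0 (mulr_gt0 A0 (ltr0Sn _ _))).
have [d3 d30 h3] := hg (e / (B * 2)) (divr_gt0 e0 (mulr_gt0 B0 (ltr0Sn _ _))).
exists (Num.min d1 (Num.min d3 (d2 / A))); first by rewrite !lt_min d10 d30 divr_gt0.
move=> w; rewrite !lt_min => /andP[w1 /andP[w3 w2]].
have k1 := h1 _ w1; have k3 := h3 _ w3.
set u := g (z + w) - g z in k1 k3.
have gE : g (z + w) = g z + u by rewrite /u [RHS]addrC subrK.
have ud : cabs u < d2.
  by apply: le_lt_trans k1 _; move: w2; rewrite ltr_pdivlMr // mulrC.
have := h2 _ ud; rewrite -gE => k2.
rewrite (_ : _ - _ - _ = (f (g (z + w)) - f (g z) - L * u) + L * (u - M * w));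
  last by ring.
apply: le_trans (cabsD _ _) _; rewrite cabsM.
have c1 : e / (A * 2) * cabs u <= e / 2 * cabs w.
  apply: le_trans (ler_wpM2l _ k1) _; first by rewrite ltW // divr_gt0 // mulr_gt0.
  by rewrite -/A le_eqVlt; apply/orP; left; apply/eqP; field; rewrite gt_eqF.
have c2 : cabs L * cabs (u - M * w) <= e / 2 * cabs w.
  apply: le_trans (ler_wpM2l (cabs_ge0 _) k3) _.
  have eB : e / (B * 2) * B = e / 2 by field; rewrite gt_eqF.
  rewrite mulrA ler_wpM2r ?cabs_ge0 // -eB [leRHS]mulrC.
  by rewrite ler_wpM2r ?divr_ge0 ?mulr_ge0 ?(ltW e0) ?(ltW B0) // lerDl.
by slim_lra.
Qed.

Lemma cder_inv z : z != 0 -> cder (fun w => w^-1) z (- z ^- 2).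
Proof.
move=> z0 e e0; have az : 0 < cabs z by rewrite cabs_gt0.
exists (Num.min (cabs z / 2) (e * cabs z ^+ 3 / 2)).
  by rewrite lt_min !divr_gt0 // mulr_gt0 // exprn_gt0.
move=> w; rewrite lt_min => /andP[w1 w2].
have zw : cabs z / 2 < cabs (z + w).
  have := le_cabsB z (- w); rewrite cabsN opprK; slim_lra.
have zw0 : z + w != 0 by rewrite -cabs_gt0 (le_lt_trans _ zw) // divr_ge0 // ltW.
rewrite (_ : _ - _ - _ = w * (w / (z ^+ 2 * (z + w)))); last first.
  by field; rewrite z0 zw0.
rewrite cabsM mulrC ler_wpM2r ?cabs_ge0 // cabsM cabsV cabsM cabsX.
rewrite ler_pdivrMr ?mulr_gt0 ?exprn_gt0 //; last by rewrite cabs_gt0.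
apply: le_trans (ltW w2) _; rewrite -subr_ge0.
rewrite (_ : _ - _ = e * cabs z ^+ 2 * (cabs (z + w) - cabs z / 2)); last by field.
by rewrite !mulr_ge0 ?exprn_ge0 ?ltW // subr_gt0.
Qed.

Lemma cderV f z L : f z != 0 -> cder f z L ->
  cder (fun w => (f w)^-1) z (- f z ^- 2 * L).
Proof. by move=> fz h; apply: cder_comp h _; exact: cder_inv. Qed.

Lemma cder_div f g z L M : g z != 0 -> cder f z L -> cder g z M ->
  cder (fun w => f w / g w) z (L / g z - f z * M / g z ^+ 2).
Proof.
move=> gz hf hg; have := cderM hf (cderV gz hg).
by congr cder; ring.
Qed.

Lemma cdiffD f g z : cdiff f z -> cdiff g z -> cdiff (fun w => f w + g w) z.
Proof. by move=> [L hf] [M hg]; eexists; exact: cderD hf hg. Qed.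
Lemma cdiffB f g z : cdiff f z -> cdiff g z -> cdiff (fun w => f w - g w) z.
Proof. by move=> [L hf] [M hg]; eexists; exact: cderB hf hg. Qed.
Lemma cdiffM f g z : cdiff f z -> cdiff g z -> cdiff (fun w => f w * g w) z.
Proof. by move=> [L hf] [M hg]; eexists; exact: cderM hf hg. Qed.
Lemma cdiff_cst c z : cdiff (fun=> c) z.
Proof. by exists 0; exact: cder_cst. Qed.
Lemma cdiff_id z : cdiff id z.
Proof. by exists 1; exact: cder_id. Qed.
Lemma cdiff_div f g z : g z != 0 -> cdiff f z -> cdiff g z ->
  cdiff (fun w => f w / g w) z.
Proof. by move=> gz [L hf] [M hg]; eexists; exact: cder_div gz hf hg. Qed.
Lemma cdiff_comp f g z : cdiff g z -> cdiff f (g z) -> cdiff (fun w => f (g w)) z.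
Proof. by move=> [M hg] [L hf]; eexists; exact: cder_comp hg hf. Qed.
Lemma cdiffX f z k : cdiff f z -> cdiff (fun w => f w ^+ k) z.
Proof.
move=> hf; elim: k => [|k IH]; first exact: cdiff_cst.
by under eq_fun do rewrite exprS; exact: cdiffM.
Qed.
Lemma cdiff_sum (I : Type) (s : seq I) (P : pred I) (F : I -> C -> C) z :
  (forall i, cdiff (F i) z) -> cdiff (fun w => \sum_(i <- s | P i) F i w) z.
Proof.
move=> h; elim: s => [|i s IH].
  by under eq_fun do rewrite big_nil; exact: cdiff_cst.
under eq_fun do rewrite big_cons.
by case: (P i) => //; exact: cdiffD.
Qed.
Lemma cdiff_prod (I : Type) (s : seq I) (P : pred I) (F : I -> C -> C) z :
  (forall i, cdiff (F i) z) -> cdiff (fun w => \prod_(i <- s | P i) F i w) z.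
Proof.
move=> h; elim: s => [|i s IH].
  by under eq_fun do rewrite big_nil; exact: cdiff_cst.
under eq_fun do rewrite big_cons.
by case: (P i) => //; exact: cdiffM.
Qed.
Lemma cdiff_local f g z (d : R) : 0 < d ->
  (forall w, cabs (w - z) < d -> f w = g w) -> cdiff f z -> cdiff g z.
Proof. by move=> d0 fg [L h]; exists L; exact: cder_local d0 fg h. Qed.

Definition hol f a (r : R) := forall z, cabs (z - a) < r -> cdiff f z.

Lemma hol_sub f a r b s : hol f a r -> cabs (b - a) + s <= r -> hol f b s.
Proof.
move=> h bs z zb; apply: h; apply: le_lt_trans (cabs_tri z b a) _; slim_lra.
Qed.

Lemma disc_sub (a b z : C) (r s : R) : cabs (b - a) + s <= r ->
  cabs (z - b) < s -> cabs (z - a) < r.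
Proof. by move=> bs zb; apply: le_lt_trans (cabs_tri z b a) _; slim_lra. Qed.

(** Total, with value 0 where [f] has no derivative. Hence functions that agree near z have the same
    iterated derivatives there, without any differentiability ([iter_D_local]). *)
Definition D f z : C := xget 0 [set L | cder f z L].

Lemma D_eq f z L : cder f z L -> D f z = L.
Proof.
move=> h; rewrite /D; case: xgetP => [M _ /= hM|/(_ L)//].
exact: cder_uniq hM h.
Qed.

Lemma cderP f z : cdiff f z -> cder f z (D f z).
Proof. by move=> [L h]; rewrite (D_eq h). Qed.

Lemma D_local f g z (d : R) : 0 < d ->
  (forall w, cabs (w - z) < d -> f w = g w) -> D f z = D g z.
Proof.
move=> d0 fg; congr xget; apply/seteqP; split => L /=.
  exact: cder_local d0 fg.
by apply: cder_local d0 _ => w wd; rewrite fg.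
Qed.

Lemma iter_D_local f g z (d : R) p : 0 < d ->
  (forall w, cabs (w - z) < d -> f w = g w) -> iter p D f z = iter p D g z.
Proof.
elim: p f g z d => [|p IH] f g z d d0 fg; first by rewrite /= fg // subrr cabs0.
rewrite !iterSr; apply: (IH _ _ _ _ d0) => w wd.
apply: (@D_local _ _ _ (d - cabs (w - z))); first by rewrite subr_gt0.
move=> v vw; apply: fg; apply: disc_sub vw; slim_lra.
Qed.

End Derivative.

(** * Goursat's theorem and Taylor expansions *)

Section Quartering.
Variable R : realType.

Lemma nested_point (u v : nat -> R) :
  (forall n, u n <= u n.+1) -> (forall n, v n.+1 <= v n) ->
  (forall n, u n <= v n) -> exists p, forall n, u n <= p <= v n.
Proof.
move=> uS vS uv.
have um : {homo u : m n / (m <= n)%N >-> m <= n} by apply: homo_leq => //; exact: le_trans.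
have vm : {homo v : m n / (m <= n)%N >-> n <= m}.
  by apply: homo_leq => // y x z xy yz; exact: le_trans yz xy.
have uvmn m n : u m <= v n.
  apply: le_trans (um _ _ (leq_maxl m n)) _; apply: le_trans (uv _) _.
  exact: vm (leq_maxr m n).
exists (sup (range u)) => n; apply/andP; split.
  apply: ub_le_sup; last by exists n.
  by exists (v 0) => _ [m _ <-].
apply: ge_sup; first by exists (u 0), 0.
by move=> _ [m _ <-].
Qed.

Lemma ltr_half_pow (d s : R) : 0 < d -> exists n, s / 2 ^+ n < d.
Proof.
move=> d0; exists (Num.bound (`|s| / d)).
have h : `|s| / d < (Num.bound (`|s| / d))%:R.
  by apply: archi_boundP; rewrite divr_ge0 // ltW.
rewrite ltr_pdivrMr ?exprn_gt0 //; apply: le_lt_trans (ler_norm s) _.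
move: h; rewrite ltr_pdivrMr // mulrC => /lt_le_trans; apply.
rewrite ler_pM2l // -natrX ler_nat; exact: ltnW (ltn_expl _ _).
Qed.

(** Bisection as an induction principle. A rectangle where [P] fails has a quarter where it fails;
    the nested quarters shrink to a point, near which the last hypothesis makes [P] true. The sides
    stay proportional to [A] and [B]; with [B] = 0 this is bisection of a segment, the form used in
    [ln_cabs_primitive]. *)
Lemma quartering (A B : R) (P : R -> R -> R -> Prop) (x y s : R) :
  0 < s -> 0 <= A -> 0 <= B ->
  (forall x y s, 0 < s -> P x y (s / 2) -> P (x + s / 2 * A) y (s / 2) ->
     P x (y + s / 2 * B) (s / 2) -> P (x + s / 2 * A) (y + s / 2 * B) (s / 2) ->
     P x y s) ->
  (forall p q, x <= p <= x + s * A -> y <= q <= y + s * B ->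
     exists2 d, 0 < d & forall x' y' s', 0 < s' < d ->
       x' <= p <= x' + s' * A -> y' <= q <= y' + s' * B ->
       x <= x' -> x' + s' * A <= x + s * A -> y <= y' -> y' + s' * B <= y + s * B ->
       P x' y' s') ->
  P x y s.
Proof.
move=> s0 A0 B0 join loc; apply: contrapT => nP.
pose Q (u : R * R) t := ~ P u.1 u.2 t.
have nx (u : R * R) t : exists v : R * R, 0 < t -> Q u t ->
    [/\ Q v (t / 2), u.1 <= v.1, v.1 + t / 2 * A <= u.1 + t * A,
      u.2 <= v.2 & v.2 + t / 2 * B <= u.2 + t * B].
  have [h|h] := pselect (0 < t /\ Q u t); last by exists u => t0 qu; case: h.
  case: h => t0 qu.
  have tA : 0 <= t / 2 * A by rewrite mulr_ge0 // divr_ge0 // ltW.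
  have tB : 0 <= t / 2 * B by rewrite mulr_ge0 // divr_ge0 // ltW.
  have tA' : t * A = t / 2 * A + t / 2 * A by field.
  have tB' : t * B = t / 2 * B + t / 2 * B by field.
  have [h1|h1] := pselect (P u.1 u.2 (t / 2)); last first.
    by exists u => _ _; split => //; slim_lra.
  have [h2|h2] := pselect (P (u.1 + t / 2 * A) u.2 (t / 2)); last first.
    by exists (u.1 + t / 2 * A, u.2) => _ _; split => //=; slim_lra.
  have [h3|h3] := pselect (P u.1 (u.2 + t / 2 * B) (t / 2)); last first.
    by exists (u.1, u.2 + t / 2 * B) => _ _; split => //=; slim_lra.
  exists (u.1 + t / 2 * A, u.2 + t / 2 * B) => _ _; split => //=; try slim_lra.
  by move=> h4; apply: qu; exact: join.
have /choice[f fP] : forall ut : (R * R) * R, exists v : R * R, 0 < ut.2 -> Q ut.1 ut.2 ->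
    [/\ Q v (ut.2 / 2), ut.1.1 <= v.1, v.1 + ut.2 / 2 * A <= ut.1.1 + ut.2 * A,
      ut.1.2 <= v.2 & v.2 + ut.2 / 2 * B <= ut.1.2 + ut.2 * B].
  by move=> [u t]; exact: nx.
pose w := fix w n : R * R := if n is n'.+1 then f (w n', s / 2 ^+ n') else (x, y).
have sn0 n : 0 < s / 2 ^+ n by rewrite divr_gt0 // exprn_gt0.
have sS n : s / 2 ^+ n / 2 = s / 2 ^+ n.+1.
  by rewrite exprS; field; rewrite expf_neq0.
have wQ n : Q (w n) (s / 2 ^+ n).
  elim: n => [|n IH]; first by rewrite /Q expr0 divr1.
  by have [+ _ _ _ _] := fP (w n, s / 2 ^+ n) (sn0 n) IH; rewrite /= sS.
have wS n := fP (w n, s / 2 ^+ n) (sn0 n) (wQ n).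
have [p pP] : exists p, forall n, (w n).1 <= p <= (w n).1 + s / 2 ^+ n * A.
  apply: nested_point => n.
  - by have [_ + _ _ _] := wS n.
  - by have [_ _ + _ _] := wS n; rewrite /= sS.
  - by rewrite lerDl mulr_ge0 // ltW.
have [q qP] : exists q, forall n, (w n).2 <= q <= (w n).2 + s / 2 ^+ n * B.
  apply: nested_point => n.
  - by have [_ _ _ + _] := wS n.
  - by have [_ _ _ _ +] := wS n; rewrite /= sS.
  - by rewrite lerDl mulr_ge0 // ltW.
have w1 n : x <= (w n).1.
  by elim: n => //= n IH; apply: le_trans IH _; have [_ + _ _ _] := wS n.
have w1' n : (w n).1 + s / 2 ^+ n * A <= x + s * A.
  elim: n => [|n]; first by rewrite expr0 divr1.
  by apply: le_trans; have [_ _ + _ _] := wS n; rewrite /= sS.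
have w2 n : y <= (w n).2.
  by elim: n => //= n IH; apply: le_trans IH _; have [_ _ _ + _] := wS n.
have w2' n : (w n).2 + s / 2 ^+ n * B <= y + s * B.
  elim: n => [|n]; first by rewrite expr0 divr1.
  by apply: le_trans; have [_ _ _ _ +] := wS n; rewrite /= sS.
have [||d d0 dP] := loc p q.
- by have := pP 0; rewrite expr0 divr1.
- by have := qP 0; rewrite expr0 divr1.
have [n nd] := ltr_half_pow s d0.
by apply: (wQ n); apply: dP => //; rewrite sn0.
Qed.

End Quartering.

(** * Integrals of complex-valued functions over a segment *)

Section Integral.
Variable R : realType.
Local Notation C := R[i].
Implicit Types (u v : R -> C) (a b c : R).
Local Notation mu := (@lebesgue_measure R).

Definition cintegral u a b : C :=
  Complex (\int[mu]_(x in `[a, b]) complex.Re (u x))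
          (\int[mu]_(x in `[a, b]) complex.Im (u x)).

(** Continuity is asked of [u] as a function on the whole line at the points of [a, b], not of its
    restriction: the integrands come from functions differentiable at every point of the segment. *)
Definition ccont u a b := forall t, a <= t <= b -> forall e, 0 < e ->
  exists2 d, 0 < d & forall s, `|s - t| < d -> cabs (u s - u t) <= e.

Lemma ccont_sub u a b a' b' : ccont u a b -> a <= a' -> b' <= b -> ccont u a' b'.
Proof. by move=> h aa bb t /andP[t1 t2]; apply: h; lra. Qed.

Lemma integrable_part (p : C -> R) u a b : (forall z, `|p z| <= cabs z) ->
  {morph p : x y / x - y} -> ccont u a b ->
  mu.-integrable `[a, b] (EFin \o (fun x => p (u x))).
Proof.
move=> pz pB h; apply: continuous_compact_integrable; first exact: segment_compact.
apply: continuous_in_subspaceT => t; rewrite inE /= in_itv /= => tab.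
apply/cvgrPdist_le => e e0; have [d d0 hd] := h t tab e e0.
near=> s; rewrite -pB; apply: le_trans (pz _) _; rewrite cabsB; apply: hd.
by near: s; exact: cvgr_distC_lt.
Unshelve. all: by end_near. Qed.

Lemma ReB : {morph @complex.Re R : x y / x - y}.
Proof. by move=> [? ?] [? ?]. Qed.
Lemma ImB : {morph @complex.Im R : x y / x - y}.
Proof. by move=> [? ?] [? ?]. Qed.

Let iRe u a b (h : ccont u a b) := integrable_part (@Re_le_cabs R) ReB h.
Let iIm u a b (h : ccont u a b) := integrable_part (@Im_le_cabs R) ImB h.

Lemma eq_cintegral u v a b : (forall t, a <= t <= b -> u t = v t) ->
  cintegral u a b = cintegral v a b.
Proof.
move=> uv; congr Complex; apply: eq_Rintegral => t.
  by rewrite inE /= in_itv /= => /uv ->.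
by rewrite inE /= in_itv /= => /uv ->.
Qed.

Lemma cintegralD u v a b : ccont u a b -> ccont v a b ->
  cintegral (fun t => u t + v t) a b = cintegral u a b + cintegral v a b.
Proof.
move=> hu hv; rewrite /cintegral /=.
rewrite [RHS]/GRing.add /=; congr Complex; rewrite -RintegralD //.
- by apply: eq_Rintegral => t _; case: (u t); case: (v t).
- exact: iRe.
- exact: iRe.
- by apply: eq_Rintegral => t _; case: (u t); case: (v t).
- exact: iIm.
- exact: iIm.
Qed.

Lemma ccontZ k u a b : ccont u a b -> ccont (fun t => k * u t) a b.
Proof.
move=> hu t tab e e0; have k0 : 0 < cabs k + 1 by rewrite ltr_wpDl ?cabs_ge0.
have [d d0 h] := hu t tab (e / (cabs k + 1)) (divr_gt0 e0 k0).
exists d => // s /h hs; rewrite -mulrBr cabsM.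
apply: le_trans (_ : (cabs k + 1) * (e / (cabs k + 1)) <= e).
  by apply: ler_pM => //; rewrite ?cabs_ge0 // lerDl.
by rewrite mulrC divfK // gt_eqF.
Qed.

Lemma cintegralZ k u a b : ccont u a b ->
  cintegral (fun t => k * u t) a b = k * cintegral u a b.
Proof.
case: k => k1 k2 hu; rewrite /cintegral /= [RHS]/GRing.mul /=.
have i1 := iRe hu; have i2 := iIm hu.
have j1 k : mu.-integrable `[a, b] (EFin \o (fun x => k * complex.Re (u x))).
  rewrite (_ : (fun x => _) = (fun x => complex.Re (k%:C%C * u x))).
    exact: iRe (ccontZ _ hu).
  by apply/funext => x; case: (u x) => ? ? /=; rewrite mul0r subr0.
have j2 k : mu.-integrable `[a, b] (EFin \o (fun x => k * complex.Im (u x))).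
  rewrite (_ : (fun x => _) = (fun x => complex.Im (k%:C%C * u x))).
    exact: iIm (ccontZ _ hu).
  by apply/funext => x; case: (u x) => ? ? /=; rewrite mul0r addr0.
congr Complex; rewrite -!RintegralZl //.
  by rewrite -RintegralB //; apply: eq_Rintegral => t _; case: (u t).
by rewrite -RintegralD //; apply: eq_Rintegral => t _; case: (u t).
Qed.

Lemma cintegralB u v a b : ccont u a b -> ccont v a b ->
  cintegral (fun t => u t - v t) a b = cintegral u a b - cintegral v a b.
Proof.
move=> hu hv; rewrite -mulN1r -cintegralZ // -cintegralD //; last exact: ccontZ.
by apply: eq_cintegral => t _; rewrite mulN1r.
Qed.

Lemma cintegral_cst k a b : a <= b -> cintegral (fun=> k) a b = (b - a)%:C%C * k.
Proof.
case: k => k1 k2 ab; rewrite /cintegral !Rintegral_cst //= lebesgue_measure_itv /=.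
rewrite [RHS]/GRing.mul /= !mul0r subr0 addr0; case: ifPn => [|/=].
  by rewrite lte_fin => _; rewrite /= ![_ * (b - a)]mulrC.
rewrite lte_fin -leNgt => ba; have -> : b = a by apply: le_anti; rewrite ab ba.
by rewrite subrr !mul0r !mulr0.
Qed.

Lemma cintegral_cat u a b c : a <= b <= c -> ccont u a c ->
  cintegral u a c = cintegral u a b + cintegral u b c.
Proof.
move=> /andP[ab bc] h; have i1 := iRe h; have i2 := iIm h.
rewrite /cintegral [RHS]/GRing.add /=.
have E f : mu.-integrable `[a, c] (EFin \o f) ->
    \int[mu]_(x in `[a, c]) f x =
    \int[mu]_(x in `[a, b]) f x + \int[mu]_(x in `[b, c]) f x.
  move=> hf; have := @Rintegral_itvB _ f (BLeft a) (BRight c) b hf.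
  rewrite !bnd_simp => /(_ ab bc) E; apply/eqP.
  rewrite -subr_eq0 opprD addrA E Rintegral_itv_obnd_cbnd ?subrr //.
  apply: integrableS hf => //; apply: subset_itv; rewrite bnd_simp //.
by congr Complex; exact: E.
Qed.

Lemma Im_cintegral_ge u a b (c : R) : a <= b -> ccont u a b ->
  (forall t, a <= t <= b -> c <= complex.Im (u t)) ->
  c * (b - a) <= complex.Im (cintegral u a b).
Proof.
move=> ab hu h; have := cintegral_cst (Complex 0 c) ab.
have hc : ccont (fun=> Complex 0 c) a b.
  by move=> t _ e e0; exists 1 => // s _; rewrite subrr cabs0 ltW.
move/(congr1 (@complex.Im R)) => /= E.
rewrite (_ : c * (b - a) = \int[mu]_(x in `[a, b]) complex.Im (Complex 0 c)); last first.
  by rewrite E mul0r addr0 mulrC.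
apply: le_Rintegral => //.
- exact: iIm hc.
- exact: iIm hu.
Qed.

(** Real and imaginary parts are bounded separately, whence the factor 2. Constants are not kept
    sharp in what follows; what matters is that they do not depend on the function. *)
Lemma cintegral_le u a b (M : R) : a <= b -> ccont u a b ->
  (forall t, a <= t <= b -> cabs (u t) <= M) ->
  cabs (cintegral u a b) <= 2 * M * (b - a).
Proof.
move=> ab hu h; apply: le_trans (cabs_le_ReIm _) _ => /=.
have cM : ccont (fun=> M%:C%C) a b.
  by move=> t _ e e0; exists 1 => // s _; rewrite subrr cabs0 ltW.
have E : \int[mu]_(x in `[a, b]) complex.Re (M%:C%C : C) = M * (b - a).
  have := cintegral_cst M%:C%C ab; move/(congr1 (@complex.Re R)) => /= ->.
  by rewrite mulr0 subr0 mulrC.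
have K (p : C -> R) : (forall z, `|p z| <= cabs z) -> {morph p : x y / x - y} ->
    `|\int[mu]_(x in `[a, b]) p (u x)| <= M * (b - a).
  move=> pz pB; have ip := integrable_part pz pB hu.
  apply: le_trans (le_normr_Rintegral _ ip) _ => //.
  rewrite -E; apply: le_Rintegral => //.
  - by have := integrable_abse ip; apply: eq_integrable => // t _.
  - exact: iRe cM.
  - move=> t /=; rewrite in_itv /= => /h; apply: le_trans; exact: pz.
apply: le_trans (lerD (K _ (@Re_le_cabs R) ReB) (K _ (@Im_le_cabs R) ImB)) _.
by rewrite -mulrA mulr_natl mulr2n.
Qed.

End Integral.

Ltac cplx := apply/eqP; rewrite eq_complex /=; apply/andP; split; apply/eqP; ring.

(** * Integrals along rectangles and Goursat's theorem *)

Section Rectangle.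
Variable R : realType.
Local Notation C := R[i].
Implicit Types (f g : C -> C) (z w p : C) (x y : R).

Definition hseg f y : R -> C := fun x => f (Complex x y).
Definition vseg f x : R -> C := fun y => f (Complex x y).

(** The integral of f(z) dz counterclockwise along the boundary; dz = i dy on the vertical sides. *)
Definition rect f x0 x1 y0 y1 : C :=
  cintegral (hseg f y0) x0 x1 + 'i%C * cintegral (vseg f x1) y0 y1
  - cintegral (hseg f y1) x0 x1 - 'i%C * cintegral (vseg f x0) y0 y1.

Definition bdry x0 x1 y0 y1 x y :=
  [/\ x0 <= x <= x1, y0 <= y <= y1 & [\/ x = x0, x = x1, y = y0 | y = y1]].

Definition edged f x0 x1 y0 y1 :=
  forall x y, bdry x0 x1 y0 y1 x y -> cdiff f (Complex x y).

Lemma ccont_hseg f y a b :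
  (forall x, a <= x <= b -> cdiff f (Complex x y)) -> ccont (hseg f y) a b.
Proof.
move=> h t tab e e0; have [d d0 hd] := cdiff_cont (h t tab) e0.
exists d => // s sd; apply: hd; rewrite (_ : _ - _ = (s - t)%:C%C) ?cabsR //.
by cplx.
Qed.

Lemma ccont_vseg f x a b :
  (forall y, a <= y <= b -> cdiff f (Complex x y)) -> ccont (vseg f x) a b.
Proof.
move=> h t tab e e0; have [d d0 hd] := cdiff_cont (h t tab) e0.
exists d => // s sd; apply: hd; rewrite (_ : _ - _ = 'i%C * (s - t)%:C%C).
  by rewrite cabsM cabsi mul1r cabsR.
by cplx.
Qed.

Section Edges.
Variables x0 x1 y0 y1 : R.
Hypotheses (x01 : x0 <= x1) (y01 : y0 <= y1).

Lemma bdry_edges x y :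
  [/\ x0 <= x <= x1 -> bdry x0 x1 y0 y1 x y0,
      x0 <= x <= x1 -> bdry x0 x1 y0 y1 x y1,
      y0 <= y <= y1 -> bdry x0 x1 y0 y1 x0 y &
      y0 <= y <= y1 -> bdry x0 x1 y0 y1 x1 y].
Proof.
by split=> h; split; rewrite ?lexx ?x01 ?y01 //;
  [constructor 3|constructor 4|constructor 1|constructor 2].
Qed.

Lemma edged_cont f : edged f x0 x1 y0 y1 ->
  [/\ ccont (hseg f y0) x0 x1, ccont (hseg f y1) x0 x1,
      ccont (vseg f x0) y0 y1 & ccont (vseg f x1) y0 y1].
Proof.
move=> h; split; [apply: ccont_hseg|apply: ccont_hseg|apply: ccont_vseg|apply: ccont_vseg].
- by move=> x hx; apply: h; have [/(_ hx)] := bdry_edges x y0.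
- by move=> x hx; apply: h; have [_ /(_ hx)] := bdry_edges x y0.
- by move=> y hy; apply: h; have [_ _ /(_ hy)] := bdry_edges x0 y.
- by move=> y hy; apply: h; have [_ _ _ /(_ hy)] := bdry_edges x0 y.
Qed.

Lemma eq_rect f g : (forall x y, bdry x0 x1 y0 y1 x y -> f (Complex x y) = g (Complex x y)) ->
  rect f x0 x1 y0 y1 = rect g x0 x1 y0 y1.
Proof.
move=> h; rewrite /rect; congr (_ + 'i%C * _ - _ - 'i%C * _); apply: eq_cintegral => t ht; apply: h.
- by have [/(_ ht)] := bdry_edges t y0.
- by have [_ _ _ /(_ ht)] := bdry_edges x0 t.
- by have [_ /(_ ht)] := bdry_edges t y0.
- by have [_ _ /(_ ht)] := bdry_edges x0 t.
Qed.

Lemma rectD f g : edged f x0 x1 y0 y1 -> edged g x0 x1 y0 y1 ->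
  rect (fun z => f z + g z) x0 x1 y0 y1 = rect f x0 x1 y0 y1 + rect g x0 x1 y0 y1.
Proof.
move=> /edged_cont[f1 f2 f3 f4] /edged_cont[g1 g2 g3 g4].
by rewrite /rect !cintegralD //; ring.
Qed.

Lemma rectZ k f : edged f x0 x1 y0 y1 ->
  rect (fun z => k * f z) x0 x1 y0 y1 = k * rect f x0 x1 y0 y1.
Proof. by move=> /edged_cont[f1 f2 f3 f4]; rewrite /rect !cintegralZ //; ring. Qed.

Lemma rect_le f M : edged f x0 x1 y0 y1 ->
  (forall x y, bdry x0 x1 y0 y1 x y -> cabs (f (Complex x y)) <= M) ->
  cabs (rect f x0 x1 y0 y1) <= 4 * M * ((x1 - x0) + (y1 - y0)).
Proof.
move=> /edged_cont[f1 f2 f3 f4] h.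
have h1 : cabs (cintegral (hseg f y0) x0 x1) <= 2 * M * (x1 - x0).
  by apply: cintegral_le => // t ht; apply: h; have [/(_ ht)] := bdry_edges t y0.
have h2 : cabs (cintegral (hseg f y1) x0 x1) <= 2 * M * (x1 - x0).
  by apply: cintegral_le => // t ht; apply: h; have [_ /(_ ht)] := bdry_edges t y0.
have h3 : cabs (cintegral (vseg f x0) y0 y1) <= 2 * M * (y1 - y0).
  by apply: cintegral_le => // t ht; apply: h; have [_ _ /(_ ht)] := bdry_edges x0 t.
have h4 : cabs (cintegral (vseg f x1) y0 y1) <= 2 * M * (y1 - y0).
  by apply: cintegral_le => // t ht; apply: h; have [_ _ _ /(_ ht)] := bdry_edges x0 t.
apply: le_trans (cabsD _ _) _; rewrite cabsN cabsM cabsi mul1r.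
apply: le_trans (lerD (cabsD _ _) h3) _; rewrite cabsN.
apply: le_trans (lerD (lerD (cabsD _ _) h2) (lexx _)) _; rewrite cabsM cabsi mul1r.
apply: le_trans (lerD (lerD (lerD h1 h4) (lexx _)) (lexx _)) _.
by rewrite le_eqVlt; apply/orP; left; apply/eqP; ring.
Qed.

(** Computed directly: on opposite sides the values of z differ by a constant, and the two resulting
    constants cancel. *)
Lemma rect_affine (a b : C) : rect (fun z => a + b * z) x0 x1 y0 y1 = 0.
Proof.
have ed1 (c : C) : edged (fun=> c) x0 x1 y0 y1 by move=> x y _; exact: cdiff_cst.
have edi : edged id x0 x1 y0 y1 by move=> x y _; exact: cdiff_id.
have edz : edged (fun z => b * z) x0 x1 y0 y1.
  by move=> x y _; apply: cdiffM; [exact: cdiff_cst|exact: cdiff_id].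
rewrite rectD // rectZ //.
have -> : rect (fun=> a) x0 x1 y0 y1 = 0.
  by rewrite /rect !cintegral_cst //; ring.
have [h1 h2 v1 v2] := edged_cont edi.
have -> : rect id x0 x1 y0 y1 = (cintegral (hseg id y0) x0 x1 - cintegral (hseg id y1) x0 x1)
   + 'i%C * (cintegral (vseg id x1) y0 y1 - cintegral (vseg id x0) y0 y1) :> C.
  by rewrite /rect; ring.
rewrite -!cintegralB // (_ : (fun t => _) = fun=> 'i%C * (y0 - y1)%:C%C :> C); last first.
  by apply/funext => t; rewrite /hseg; cplx.
rewrite (_ : (fun t => _ - vseg _ _ _) = fun=> (x1 - x0)%:C%C :> C); last first.
  by apply/funext => t; rewrite /vseg; cplx.
rewrite !cintegral_cst // !rmorphB /=; ring.
Qed.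

End Edges.

Lemma rect_catx f x0 x1 x2 y0 y1 : x0 <= x1 <= x2 ->
  ccont (hseg f y0) x0 x2 -> ccont (hseg f y1) x0 x2 ->
  rect f x0 x2 y0 y1 = rect f x0 x1 y0 y1 + rect f x1 x2 y0 y1.
Proof.
by move=> h h0 h1; rewrite /rect (cintegral_cat h h0) (cintegral_cat h h1); ring.
Qed.

Lemma rect_caty f x0 x1 y0 y1 y2 : y0 <= y1 <= y2 ->
  ccont (vseg f x0) y0 y2 -> ccont (vseg f x1) y0 y2 ->
  rect f x0 x1 y0 y2 = rect f x0 x1 y0 y1 + rect f x0 x1 y1 y2.
Proof.
by move=> h h0 h1; rewrite /rect (cintegral_cat h h0) (cintegral_cat h h1); ring.
Qed.

Lemma cabs_Complex_le x y : cabs (Complex x y) <= `|x| + `|y|.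
Proof. exact: cabs_le_ReIm. Qed.

(** The bound e s^2 is additive over the four quarters. Near a point of differentiability subtract
    the affine part, whose integral vanishes: the remainder is small compared with s, and its
    product with the perimeter is small compared with s^2. *)
Lemma goursat f x0 x1 y0 y1 : x0 <= x1 -> y0 <= y1 ->
  (forall x y, x0 <= x <= x1 -> y0 <= y <= y1 -> cdiff f (Complex x y)) ->
  rect f x0 x1 y0 y1 = 0.
Proof.
move=> x01 y01 hf; apply: ceps_eq0 => e e0.
pose A := x1 - x0; pose B := y1 - y0.
have A0 : 0 <= A by rewrite subr_ge0.
have B0 : 0 <= B by rewrite subr_ge0.
pose in_rect x y s := [/\ x0 <= x, x + s * A <= x1, y0 <= y & y + s * B <= y1].
pose P x y s := in_rect x y s ->
  cabs (rect f x (x + s * A) y (y + s * B)) <= e * s ^+ 2.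
suff : P x0 y0 1.
  rewrite /P !mul1r expr1n mulr1 /A /B ![_ + (_ - _)]addrC !subrK; apply.
  by split; rewrite // /A /B !mul1r addrC subrK.
apply: (quartering (A := A) (B := B)) => //.
- move=> x y s s0 h1 h2 h3 h4 [i1 i2 i3 i4].
  set a := s / 2 * A; set b := s / 2 * B.
  have sA : s * A = a + a by rewrite /a; field.
  have sB : s * B = b + b by rewrite /b; field.
  have a0 : 0 <= a by rewrite mulr_ge0 // divr_ge0 // ltW.
  have b0 : 0 <= b by rewrite mulr_ge0 // divr_ge0 // ltW.
  rewrite sA in i2; rewrite sB in i4.
  have ho y' : y <= y' <= y + (b + b) -> ccont (hseg f y') x (x + (a + a)).
    by move=> y'P; apply: ccont_hseg => x' x'P; apply: hf; slim_lra.
  have ve x' : x <= x' <= x + (a + a) -> ccont (vseg f x') y (y + (b + b)).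
    by move=> x'P; apply: ccont_vseg => y' y'P; apply: hf; slim_lra.
  have xa : x <= x + a <= x + (a + a) by slim_lra.
  have yb : y <= y + b <= y + (b + b) by slim_lra.
  have xe : x <= x <= x + (a + a) by slim_lra.
  have xe' : x <= x + (a + a) <= x + (a + a) by slim_lra.
  have ye : y <= y <= y + (b + b) by slim_lra.
  have ye' : y <= y + (b + b) <= y + (b + b) by slim_lra.
  rewrite sA sB (rect_catx xa (ho _ ye) (ho _ ye')).
  rewrite (rect_caty yb (ve _ xe) (ve _ xa)) (rect_caty yb (ve _ xa) (ve _ xe')).
  move: h1 h2 h3 h4; rewrite /P /in_rect -/a -/b; clearbody a b => h1 h2 h3 h4.
  have [j1 j2] : x + a <= x1 /\ y + b <= y1 by move: xa yb i2 i4; clear; split; slim_lra.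
  have [j3 j4] : x0 <= x + a /\ y0 <= y + b by move: a0 b0 i1 i3; clear; split; slim_lra.
  rewrite !addrA in i2 i4.
  have {}h1 := h1 (And4 i1 j1 i3 j2); have {}h2 := h2 (And4 j3 i2 i3 j2).
  have {}h3 := h3 (And4 i1 j1 j4 i4); have {}h4 := h4 (And4 j3 i2 j4 i4).
  rewrite -?addrA in h1 h2 h3 h4.
  apply: le_trans (cabsD _ _) _; apply: le_trans (lerD (cabsD _ _) (cabsD _ _)) _.
  apply: le_trans (lerD (lerD h1 h3) (lerD h2 h4)) _.
  by rewrite le_eqVlt; apply/orP; left; apply/eqP; field.
move=> p q hp hq; rewrite !mul1r /A /B ![_ + (_ - _)]addrC !subrK in hp hq.
have [L hL] := hf p q hp hq; pose K := A + B + 1.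
have K0 : 0 < K by rewrite ltr_wpDl // addr_ge0.
(* On the boundary |z - c| is at most s K, and half the perimeter is at most s K too; with the
   factor 4 of [rect_le] this error gives exactly e s^2. *)
have [d d0 hd] := hL (e / (4 * K ^+ 2)) (divr_gt0 e0 (mulr_gt0 (ltr0Sn _ _) (exprn_gt0 _ K0))).
exists (d / K); first by rewrite divr_gt0.
move=> x y s /andP[s0 sd] pP qP _ _ _ _ [i1 i2 i3 i4].
have sA : x <= x + s * A by rewrite lerDl mulr_ge0 // ltW.
have sB : y <= y + s * B by rewrite lerDl mulr_ge0 // ltW.
set c := Complex p q.
have edf : edged f x (x + s * A) y (y + s * B).
  by move=> x' y' [h1 h2 _]; apply: hf; slim_lra.
have eda : edged (fun z => (f c - L * c) + L * z) x (x + s * A) y (y + s * B).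
  move=> x' y' _; apply: cdiffD; first exact: cdiff_cst.
  by apply: cdiffM; [exact: cdiff_cst|exact: cdiff_id].
have edN : edged (fun z => -1 * ((f c - L * c) + L * z)) x (x + s * A) y (y + s * B).
  by move=> x' y' hxy; apply: cdiffM; [exact: cdiff_cst|exact: eda].
have E : rect f x (x + s * A) y (y + s * B) =
    rect (fun z => f z + -1 * ((f c - L * c) + L * z)) x (x + s * A) y (y + s * B).
  by rewrite rectD // rectZ // rect_affine // mulr0 addr0.
rewrite E; apply: le_trans (rect_le (M := e / (4 * K ^+ 2) * (s * K)) _ _ _ _) _ => //.
- by move=> x' y' hxy; apply: cdiffD; [exact: edf|exact: edN].
- move=> x' y' [h1 h2 _]; set z := Complex x' y'.
  have zc : cabs (z - c) <= s * K.
    apply: le_trans (cabs_le_ReIm _) _; rewrite /z /c /=.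
    have -> : s * K = s * A + s * B + s by rewrite /K; ring.
    have a1 : `|x' - p| <= s * A by rewrite ler_norml; slim_lra.
    have a2 : `|y' - q| <= s * B by rewrite ler_norml; slim_lra.
    by have := ltW s0; slim_lra.
  have zd : cabs (z - c) < d.
    by apply: le_lt_trans zc _; move: sd; rewrite ltr_pdivlMr.
  have := hd _ zd; rewrite [c + _]addrC subrK => h.
  rewrite (_ : _ + _ = f z - f c - L * (z - c)); last by ring.
  apply: le_trans h _; apply: ler_wpM2l zc.
  by rewrite divr_ge0 ?mulr_ge0 ?exprn_ge0 ?ltW.
- rewrite ![_ + _ - _]addrC !addKr -mulrDr.
  have : s * (A + B) <= s * K by rewrite ler_wpM2l ?ltW // /K ltrDl.
  move=> h; apply: le_trans (ler_wpM2l _ h) _.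
    by rewrite !mulr_ge0 ?invr_ge0 ?mulr_ge0 ?exprn_ge0 ?ltW.
  by rewrite le_eqVlt; apply/orP; left; apply/eqP; field; rewrite gt_eqF.
Qed.

(** Two vertical and two horizontal cuts remove four rectangles that avoid (p, q), where [goursat]
    applies. So the integral around a single singular point does not depend on the rectangle. *)
Lemma rect_shrink f x0 x1 y0 y1 (p q d : R) : 0 < d ->
  x0 <= p - d -> p + d <= x1 -> y0 <= q - d -> q + d <= y1 ->
  (forall x y, x0 <= x <= x1 -> y0 <= y <= y1 -> (x != p) || (y != q) ->
     cdiff f (Complex x y)) ->
  rect f x0 x1 y0 y1 = rect f (p - d) (p + d) (q - d) (q + d).
Proof.
move=> d0 h1 h2 h3 h4 hf.
have ho y : y0 <= y <= y1 -> y != q -> ccont (hseg f y) x0 x1.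
  by move=> hy yq; apply: ccont_hseg => x hx; apply: hf => //; rewrite yq orbT.
have ve x : x0 <= x <= x1 -> x != p -> ccont (vseg f x) y0 y1.
  by move=> hx xp; apply: ccont_vseg => y hy; apply: hf => //; rewrite xp.
have y0q : y0 != q by rewrite lt_eqF //; slim_lra.
have y1q : y1 != q by rewrite gt_eqF //; slim_lra.
have pd : p - d != p by rewrite lt_eqF //; slim_lra.
have pd' : p + d != p by rewrite gt_eqF //; slim_lra.
rewrite (@rect_catx _ _ (p - d)); [|slim_lra|by apply: ho => //; slim_lra|by apply: ho => //; slim_lra].
rewrite (@goursat _ x0); [|slim_lra|slim_lra|]; last first.
  by move=> x y hx hy; apply: hf; [slim_lra|slim_lra|rewrite lt_eqF //; slim_lra].
rewrite add0r (@rect_catx _ _ (p + d));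
  [|slim_lra|by apply: ccont_sub (ho _ _ y0q) _ _; slim_lra|by apply: ccont_sub (ho _ _ y1q) _ _; slim_lra].
rewrite (@goursat _ (p + d)); [|slim_lra|slim_lra|]; last first.
  by move=> x y hx hy; apply: hf; [slim_lra|slim_lra|rewrite gt_eqF //; slim_lra].
rewrite addr0 (@rect_caty _ _ _ _ (q - d)); [|slim_lra|by apply: ve => //; slim_lra|by apply: ve => //; slim_lra].
rewrite (@goursat _ _ _ y0); [|slim_lra|slim_lra|]; last first.
  by move=> x y hx hy; apply: hf; [slim_lra|slim_lra|]; rewrite (@lt_eqF _ _ y q) ?orbT //; slim_lra.
have v1 : ccont (vseg f (p - d)) (q - d) y1.
  by apply: (ccont_sub (ve (p - d) _ pd)); slim_lra.
have v2 : ccont (vseg f (p + d)) (q - d) y1.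
  by apply: (ccont_sub (ve (p + d) _ pd')); slim_lra.
rewrite add0r (@rect_caty _ _ _ _ (q + d)); [|slim_lra|exact: v1|exact: v2].
rewrite (@goursat _ _ _ (q + d)); [by rewrite addr0|slim_lra|slim_lra|].
by move=> x y hx hy; apply: hf; [slim_lra|slim_lra|]; rewrite (@gt_eqF _ _ y q) ?orbT //; slim_lra.
Qed.

End Rectangle.

(** * Cauchy's formula on a square and Taylor expansions *)

Section Taylor.
Variable R : realType.
Local Notation C := R[i].
Implicit Types (f g : C -> C) (z w : C) (p : nat) (x y : R).

Lemma cdiffV f z : f z != 0 -> cdiff f z -> cdiff (fun w => (f w)^-1) z.
Proof. by move=> fz [L h]; eexists; exact: cderV fz h. Qed.

Definition square f (L : R) := rect f (- L) L (- L) L.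

Lemma bdry_square_ge (L x y : R) : 0 < L -> bdry (- L) L (- L) L x y ->
  L <= cabs (Complex x y).
Proof.
move=> L0 [_ _ [] ->].
- by apply: le_trans (Re_le_cabs _); rewrite /= normrN ler_norm.
- by apply: le_trans (Re_le_cabs _); rewrite /= ler_norm.
- by apply: le_trans (Im_le_cabs _); rewrite /= normrN ler_norm.
- by apply: le_trans (Im_le_cabs _); rewrite /= ler_norm.
Qed.

Lemma in_square_lt (x y : R) : - 1 <= x <= 1 -> - 1 <= y <= 1 ->
  cabs (Complex x y) < 2.
Proof.
move=> hx hy; rewrite cabs_normc /=.
rewrite -[ltRHS]ger0_norm // -sqrtr_sqr ltr_sqrt; last by rewrite exprn_gt0.
nra.
Qed.

(* Enlarging the square leaves the integral unchanged by Goursat and makes it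
   arbitrarily small. *)
Lemma square_pow (p : nat) : (0 < p)%N -> square (fun z => z ^- p.+1) 1 = 0.
Proof.
move=> p0; apply: ceps_eq0 => e e0.
pose L := 1 + 32 / e; have L1 : 1 < L by rewrite ltrDl divr_gt0.
have L0 : 0 < L by slim_lra.
have df z : z != 0 -> cdiff (fun z : C => z ^- p.+1) z.
  move=> z0; apply: cdiffV; first by rewrite expf_neq0.
  by apply: cdiffX; exact: cdiff_id.
have nz x y : (x != 0) || (y != 0) -> (Complex x y : C) != 0.
  by move=> h; rewrite eq_complex /= negb_and.
have E (M : R) : 1 <= M -> square (fun z => z ^- p.+1) M =
    rect (fun z => z ^- p.+1) (0 - 1/2) (0 + 1/2) (0 - 1/2) (0 + 1/2).
  move=> M1; apply: rect_shrink; try slim_lra.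
  by move=> x y _ _ xy; apply: df; exact: nz.
rewrite E // -(E L (ltW L1)) /square.
have LL : - L <= L by slim_lra.
apply: le_trans (rect_le LL LL (M := L ^- 2) _ _) _.
- move=> x y hxy; apply: df; rewrite -cabs_gt0.
  exact: lt_le_trans L0 (bdry_square_ge L0 hxy).
- move=> x y hxy; have := bdry_square_ge L0 hxy => h.
  rewrite cabsV cabsX lef_pV2 ?posrE ?exprn_gt0 //; last exact: lt_le_trans L0 h.
  apply: le_trans (_ : L ^+ p.+1 <= _); first by rewrite ler_eXn2l.
  by rewrite lerXn2r ?nnegrE ?cabs_ge0 // ltW.
rewrite (_ : 4 * L ^- 2 * _ = 16 / L); last by field; rewrite gt_eqF.
rewrite ler_pdivrMr // /L mulrDr mulr1 mulrCA divff ?gt_eqF //; slim_lra.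
Qed.

(** The value 2 pi i is not computed. Each side contributes at least 1 to the imaginary part, since
    1/(1 + t^2) is at least 1/2 on [-1, 1]; an explicit lower bound is enough to divide by this
    integral. *)
Lemma square_inv_neq0 : 4 <= complex.Im (square (fun z : C => z^-1) 1).
Proof.
have edf : edged (fun z : C => z^-1) (- 1) 1 (- 1) 1.
  move=> x y hxy; apply: cdiffV; last exact: cdiff_id.
  by rewrite -cabs_gt0 (lt_le_trans ltr01 (bdry_square_ge ltr01 hxy)).
have le11 : - 1 <= 1 :> R by slim_lra.
have [h1 h2 v1 v2] := edged_cont le11 le11 edf.
rewrite /square /rect -(cintegralZ _ v2) -(cintegralZ _ v1).
have {}h2 := ccontZ (-1) h2; have {}v1 := ccontZ (-1) (ccontZ 'i%C v1).
have {}v2 := ccontZ 'i%C v2.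
rewrite -[- cintegral (hseg _ _) _ _]mulN1r -cintegralZ; last first.
  by have [] := edged_cont le11 le11 edf.
rewrite -[X in _ + X]mulN1r -[X in _ + X]cintegralZ; last first.
  by apply: ccontZ; have [] := edged_cont le11 le11 edf.
have half (t : R) : - 1 <= t <= 1 -> 2^-1 <= (1 + t ^+ 2)^-1.
  by move=> ht; rewrite lef_pV2 ?posrE //; nra.
have K (u : R -> C) : ccont u (-1) 1 -> (forall t, complex.Im (u t) = (1 + t ^+ 2)^-1) ->
    1 <= complex.Im (cintegral u (- 1) 1).
  move=> cu hu; have := @Im_cintegral_ge _ u _ _ 2^-1 le11 cu.
  rewrite opprK (_ : 2^-1 * (1 + 1) = 1); last by field.
  by apply=> t /half; rewrite hu.
have k1 : 1 <= complex.Im (cintegral (hseg (fun z : C => z^-1) (-1)) (-1) 1).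
  by apply: K => // t; rewrite /hseg /=; field; rewrite gt_eqF //; nra.
have k2 := K _ v2; have k3 := K _ h2; have k4 := K _ v1.
have {}k2 := k2 ltac:(by move=> t; rewrite /vseg /=; field; rewrite gt_eqF //; nra).
have {}k3 := k3 ltac:(by move=> t; rewrite /hseg /=; field; rewrite gt_eqF //; nra).
have {}k4 := k4 ltac:(by move=> t; rewrite /vseg /=; field; rewrite gt_eqF //; nra).
set a := cintegral _ _ _ in k1; set b := cintegral _ _ _ in k2.
set c := cintegral _ _ _ in k3; set d := cintegral _ _ _ in k4.
rewrite -/a -/b -/c -/d (_ : complex.Im _ =
  complex.Im a + complex.Im b + complex.Im c + complex.Im d) //.
slim_lra.
Qed.

Section UnitSquare.
Variables (f : C -> C) (M : R) (w : C).
Hypothesis f_diff : forall z, cabs z < 2 -> cdiff f z.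
Hypothesis f_le : forall z, 1 <= cabs z < 2 -> cabs (f z) <= M.
Hypothesis w_le : cabs w <= 1 / 2.

Let b_ge x y : bdry (- 1) 1 (- 1) 1 x y -> 1 <= cabs (Complex x y).
Proof. exact: bdry_square_ge ltr01. Qed.

Let b_lt x y : bdry (- 1) 1 (- 1) 1 x y -> cabs (Complex x y) < 2.
Proof. by move=> [h1 h2 _]; exact: in_square_lt. Qed.

Let b_dist x y : bdry (- 1) 1 (- 1) 1 x y -> 1 / 2 <= cabs (Complex x y - w).
Proof. by move=> /b_ge h; have := le_cabsB (Complex x y) w; have := w_le; lra. Qed.

Let nz z : 1 <= cabs z -> z != 0.
Proof. by move=> h; rewrite -cabs_gt0; exact: lt_le_trans ltr01 h. Qed.

Let nzw z : 1 / 2 <= cabs (z - w) -> z - w != 0.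
Proof. by move=> h; rewrite -cabs_gt0; apply: lt_le_trans h; lra. Qed.

Let cdX z p : 1 <= cabs z -> cdiff (fun z => z ^- p) z.
Proof.
by move=> h; apply: cdiffV; [rewrite expf_neq0 ?nz|apply: cdiffX; exact: cdiff_id].
Qed.

Let cdW z : z - w != 0 -> cdiff (fun z => (z - w)^-1) z.
Proof. by move=> h; apply: cdiffV => //; apply: cdiffB; [exact: cdiff_id|exact: cdiff_cst]. Qed.

Let A p := square (fun z => f z * z ^- p.+1) 1.
Let S p := square (fun z => f z * z ^- p / (z - w)) 1.

Let edA p : edged (fun z => f z * z ^- p.+1) (- 1) 1 (- 1) 1.
Proof. by move=> x y h; apply: cdiffM; [apply: f_diff; exact: b_lt|apply: cdX; exact: b_ge]. Qed.

Let edS p : edged (fun z => f z * z ^- p / (z - w)) (- 1) 1 (- 1) 1.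
Proof.
move=> x y h; apply: cdiffM; last by apply: cdW; apply/nzw/b_dist.
by apply: cdiffM; [apply: f_diff; exact: b_lt|apply: cdX; exact: b_ge].
Qed.

Let le11 : - 1 <= 1 :> R. Proof. lra. Qed.

(** The finite geometric expansion of 1/(z - w) in powers of w/z under the integral sign. Keeping
    the remainder avoids any question of convergence. *)
Lemma square_geom P : S 0 = \sum_(p < P) A p * w ^+ p + w ^+ P * S P.
Proof.
elim: P => [|P IH]; first by rewrite big_ord0 add0r expr0 mul1r.
rewrite {}IH big_ord_recr /= -addrA; congr (_ + _).
rewrite [A P * _]mulrC exprSr -mulrA -mulrDr; congr (_ * _).
rewrite /S /square -rectZ // -rectD //.
- apply: eq_rect => // x y h; have := nz (b_ge h); have := nzw (b_dist h).
  move: (Complex x y) => z zw z0; rewrite exprSr; field.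
  by rewrite z0 zw expf_neq0.
- by move=> x y h; apply: cdiffM; [exact: cdiff_cst|exact: edS].
Qed.

Lemma square_geom_le p : cabs (S p) <= 32 * M.
Proof.
have M0 : 0 <= M.
  by apply: le_trans (cabs_ge0 (f 1)) (f_le _); rewrite cabs1; lra.
apply: le_trans (rect_le le11 le11 (M := 2 * M) (@edS p) _) _; last by lra.
move=> x y h; have := b_ge h; have := b_lt h; have := b_dist h.
move: (Complex x y) => z zw z2 z1; rewrite !cabsM !cabsV cabsX.
have c1 : (cabs (z - w))^-1 <= 2.
  have zp : 0 < cabs (z - w) by apply: lt_le_trans zw; lra.
  by rewrite -[leRHS]invrK lef_pV2 ?posrE //; lra.
have c2 : (cabs z ^+ p)^-1 <= 1.
  by rewrite invf_le1 ?exprn_ege1 // exprn_gt0 // (lt_le_trans ltr01 z1).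
have c3 : cabs (f z) <= M by apply: f_le; rewrite z1.
rewrite [2 * M]mulrC; apply: ler_pM => //.
- by rewrite mulr_ge0 ?cabs_ge0 ?invr_ge0 ?exprn_ge0 ?cabs_ge0.
- by rewrite invr_ge0 cabs_ge0.
- rewrite -[M]mulr1; apply: ler_pM => //; rewrite ?cabs_ge0 //.
  by rewrite invr_ge0 exprn_ge0 ?cabs_ge0.
Qed.

Lemma square_coef_le p : cabs (A p) <= 16 * M.
Proof.
have M0 : 0 <= M.
  by apply: le_trans (cabs_ge0 (f 1)) (f_le _); rewrite cabs1; lra.
apply: le_trans (rect_le le11 le11 (M := M) (@edA p) _) _; last by lra.
move=> x y h; have := b_ge h; have := b_lt h.
move: (Complex x y) => z z2 z1; rewrite cabsM cabsV cabsX.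
have c2 : (cabs z ^+ p.+1)^-1 <= 1.
  by rewrite invf_le1 ?exprn_ege1 // exprn_gt0 // (lt_le_trans ltr01 z1).
have c3 : cabs (f z) <= M by apply: f_le; rewrite z1.
rewrite -[M]mulr1; apply: ler_pM => //; rewrite ?cabs_ge0 //.
by rewrite invr_ge0 exprn_ge0 ?cabs_ge0.
Qed.

(** The quotient is bounded near w because f is differentiable at w, and [rect_shrink] replaces the
    unit square by an arbitrarily small one around w. *)
Lemma square_quotient : square (fun z => (f z - f w) / (z - w)) 1 = 0.
Proof.
have w2 : cabs w < 2 by have := w_le; lra.
have [L /cder_lip[d d0 hd]] := f_diff w2.
set B := cabs L + 1 in hd; have B0 : 0 < B by rewrite ltr_wpDl ?cabs_ge0.
have dg z : cabs z < 2 -> z - w != 0 -> cdiff (fun z => (f z - f w) / (z - w)) z.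
  move=> z2 zw; apply: cdiffM; last exact: cdW.
  by apply: cdiffB; [exact: f_diff|exact: cdiff_cst].
apply: ceps_eq0 => e e0.
pose t := Num.min (1 / 4) (Num.min (d / 4) (e / (16 * B))).
have t0 : 0 < t by rewrite !lt_min !divr_gt0 // mulr_gt0.
have t1 : t <= 1 / 4 by rewrite ge_min lexx.
have t2 : t <= d / 4 by rewrite !ge_min lexx orbT.
have t3 : t <= e / (16 * B) by rewrite !ge_min lexx !orbT.
pose p := complex.Re w; pose q := complex.Im w.
have wE : w = Complex p q by rewrite /p /q; case: (w).
have := ler_norml p (1 / 2); rewrite (le_trans (Re_le_cabs w) w_le) => /esym/andP[p1 p2].
have := ler_norml q (1 / 2); rewrite (le_trans (Im_le_cabs w) w_le) => /esym/andP[q1 q2].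
have sub x y : Complex x y - w = Complex (x - p) (y - q) by rewrite wE.
rewrite /square (@rect_shrink _ _ _ _ _ _ p q t) //; try lra; last first.
  move=> x y hx hy xy; apply: dg; first exact: in_square_lt.
  by rewrite sub eq_complex /= !subr_eq0 negb_and.
have pt : p - t <= p + t by lra.
have qt : q - t <= q + t by lra.
have far x y : bdry (p - t) (p + t) (q - t) (q + t) x y -> t <= cabs (Complex x y - w).
  rewrite sub; move=> [_ _ [] ->].
  - by apply: le_trans (Re_le_cabs _); rewrite /= (_ : p - t - p = - t) ?normrN ?ler_norm //; ring.
  - by apply: le_trans (Re_le_cabs _); rewrite /= (_ : p + t - p = t) ?ler_norm //; ring.
  - by apply: le_trans (Im_le_cabs _); rewrite /= (_ : q - t - q = - t) ?normrN ?ler_norm //; ring.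
  - by apply: le_trans (Im_le_cabs _); rewrite /= (_ : q + t - q = t) ?ler_norm //; ring.
apply: le_trans (rect_le pt qt (M := B) _ _) _.
- move=> x y h; apply: dg; last by rewrite -cabs_gt0 (lt_le_trans t0 (far _ _ h)).
  by case: h => h1 h2 _; apply: in_square_lt; lra.
- move=> x y h; have zw := far _ _ h.
  have z0 : 0 < cabs (Complex x y - w) := lt_le_trans t0 zw.
  rewrite cabsM cabsV ler_pdivrMr //.
  have zd : cabs (Complex x y - w) < d.
    rewrite sub; apply: le_lt_trans (cabs_Complex_le _ _) _.
    case: h => h1 h2 _.
    have : `|x - p| <= t by rewrite ler_norml; lra.
    have : `|y - q| <= t by rewrite ler_norml; lra.
    by lra.
  by have := hd _ zd; rewrite [w + _]addrC subrK.
- rewrite (_ : 4 * B * _ = 16 * B * t); last by ring.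
  by move: t3; rewrite ler_pdivlMr ?mulr_gt0 // mulrC.
Qed.

Lemma square_cauchy : S 0 = f w * square (fun z => (z - w)^-1) 1.
Proof.
have edw : edged (fun z => (z - w)^-1) (- 1) 1 (- 1) 1.
  by move=> x y h; apply: cdW; apply/nzw/b_dist.
have edq : edged (fun z => (f z - f w) / (z - w)) (- 1) 1 (- 1) 1.
  move=> x y h; apply: cdiffM; last exact: edw.
  by apply: cdiffB; [apply: f_diff; exact: b_lt|exact: cdiff_cst].
have edf : edged (fun z => f w * (z - w)^-1) (- 1) 1 (- 1) 1.
  by move=> x y h; apply: cdiffM; [exact: cdiff_cst|exact: edw].
rewrite /square -(@rectZ _ _ _ _ _ le11 le11) //.
rewrite -[RHS]add0r -square_quotient -rectD //.
apply: eq_rect => // x y h; have := nzw (b_dist h).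
by move: (Complex x y) => z zw; rewrite expr0; field.
Qed.

End UnitSquare.

(** Expand with f = 1: the integrals of z^-(p+1) with p >= 1 vanish by [square_pow], and the
    remainder tends to 0. *)
Lemma square_kernel w : cabs w <= 1 / 2 ->
  square (fun z => (z - w)^-1) 1 = square (fun z : C => z^-1) 1.
Proof.
move=> hw; apply/subr0_eq/ceps_eq0 => e e0.
have d1 (z : C) : cabs z < 2 -> cdiff (fun=> 1) z by move=> _; exact: cdiff_cst.
have l1 (z : C) : 1 <= cabs z < 2 -> cabs (1 : C) <= 1 by rewrite cabs1.
have le11 : - 1 <= 1 :> R by slim_lra.
have [n en] := ltr_half_pow 32 e0.
have := square_geom d1 hw n.+1; rewrite big_ord_recl big1 => [|i _]; last first.
  rewrite (_ : square _ _ = 0) ?mul0r // -[RHS](@square_pow i.+1) //.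
  by apply: eq_rect => // x y _; rewrite mul1r.
rewrite addr0 expr0 mulr1 /square => E.
rewrite (@eq_rect _ _ _ _ _ le11 le11 _ (fun z => 1 * z ^- 0 / (z - w))); last first.
  by move=> x y _; rewrite expr0 divr1 mul1r.
rewrite E (@eq_rect _ _ _ _ _ le11 le11 (fun z => z^-1) (fun z => 1 * z ^- 1)); last first.
  by move=> x y _; rewrite expr1 mul1r.
rewrite [X in cabs X](_ : _ = w ^+ n.+1 *
   square (fun z => 1 * z ^- n.+1 / (z - w)) 1); last by rewrite /square; ring.
rewrite cabsM cabsX; have := square_geom_le d1 l1 hw n.+1; rewrite mulr1 => h.
apply: le_trans (ltW en).
rewrite mulrC; apply: ler_pM; rewrite ?exprn_ge0 ?cabs_ge0 //.
apply: le_trans (lerXn2r n.+1 (cabs_ge0 _) _ hw) _; first by rewrite nnegrE; slim_lra.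
rewrite mul1r exprVn lef_pV2 ?posrE ?exprn_gt0 // ler_eXn2l //; slim_lra.
Qed.

Lemma taylor_unit f M : (forall z, cabs z < 2 -> cdiff f z) ->
  (forall z, 1 <= cabs z < 2 -> cabs (f z) <= M) ->
  exists2 c : nat -> C, forall p, cabs (c p) <= 4 * M &
    forall P w, cabs w <= 1 / 2 ->
      cabs (f w - \sum_(p < P) c p * w ^+ p) <= 8 * M * cabs w ^+ P.
Proof.
move=> fd fM; pose k := square (fun z : C => z^-1) 1.
have k4 : 4 <= cabs k.
  by apply: le_trans square_inv_neq0 (le_trans (ler_norm _) (Im_le_cabs _)).
have k0 : 0 < cabs k by slim_lra.
have kn0 : k != 0 by rewrite -cabs_gt0.
exists (fun p => square (fun z => f z * z ^- p.+1) 1 / k) => [p|P w hw].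
  rewrite cabsM cabsV ler_pdivrMr //; have := square_coef_le fd fM p.
  have : 0 <= M by apply: le_trans (cabs_ge0 (f 1)) (fM _ _); rewrite cabs1; slim_lra.
  nra.
have := square_geom fd hw P; rewrite (square_cauchy fd hw) square_kernel // -/k => E.
have -> : f w - \sum_(p < P) square (fun z => f z * z ^- p.+1) 1 / k * w ^+ p =
    w ^+ P * square (fun z => f z * z ^- P / (z - w)) 1 / k.
  apply: (mulIf kn0); rewrite divfK // mulrBl E mulr_suml.
  rewrite [X in _ - X](eq_bigr (fun p : 'I_P => square (fun z => f z * z ^- p.+1) 1 * w ^+ p)).
    by rewrite addrC addKr.
  by move=> i _; rewrite mulrAC divfK.
rewrite !cabsM cabsX cabsV ler_pdivrMr //.
have := square_geom_le fd fM hw P; have wP : 0 <= cabs w ^+ P by rewrite exprn_ge0 ?cabs_ge0.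
have : 0 <= M by apply: le_trans (cabs_ge0 (f 1)) (fM _ _); rewrite cabs1; slim_lra.
move=> M0 h; apply: le_trans (ler_wpM2l wP h) _.
rewrite (_ : cabs w ^+ P * _ = 8 * M * cabs w ^+ P * 4); last by ring.
by apply: ler_wpM2l => //; rewrite !mulr_ge0.
Qed.

(** The bound [M] is assumed on the outer annulus alone, so that P = 0 gives a maximum principle up
    to a factor 8. [zeros_out_le] relies on this form: a quotient by linear factors is easy to bound
    only away from the zeros. *)
Lemma taylor f a (r M : R) : 0 < r -> hol f a r ->
  (forall z, r / 2 <= cabs (z - a) < r -> cabs (f z) <= M) ->
  exists2 c : nat -> C, forall p, cabs (c p) <= 4 * M * (2 / r) ^+ p &
    forall P w, cabs w <= r / 4 ->
      cabs (f (a + w) - \sum_(p < P) c p * w ^+ p) <= 8 * M * (2 * cabs w / r) ^+ P.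
Proof.
move=> r0 fd fM; pose k : C := (r / 2)%:C%C.
have k0 : 0 < r / 2 by rewrite divr_gt0.
have kn0 : k != 0 by rewrite -cabs_gt0 cabsR normr_gt0 gt_eqF.
have kE : cabs k = r / 2 by rewrite cabsR gtr0_norm.
have sub z : a + k * z - a = k * z by rewrite addrC addKr.
have [z z2|z /andP[z1 z2]|c c1 c2] := @taylor_unit (fun z => f (a + k * z)) M.
- apply: (@cdiff_comp _ f (fun z => a + k * z)).
    apply: cdiffD; first exact: cdiff_cst.
    by apply: cdiffM; [exact: cdiff_cst|exact: cdiff_id].
  by apply: fd; rewrite sub cabsM kE; nra.
- by apply: fM; rewrite sub cabsM kE; nra.
exists (fun p => c p / k ^+ p) => [p|P w hw].
  rewrite cabsM cabsV cabsX kE -exprVn invf_div ler_wpM2r //.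
  by rewrite exprn_ge0 // divr_ge0 // ltW.
have h := c2 P (w / k); rewrite cabsM cabsV kE mulrC [k * _]mulrC divfK // in h.
have {}h := h ltac:(by rewrite mulrC ler_pdivrMr //; slim_lra).
apply: le_trans (le_trans h _).
  rewrite le_eqVlt; apply/orP; left; apply/eqP; congr (cabs (_ - _)).
  by apply: eq_bigr => i _; rewrite exprMn exprVn; ring.
rewrite le_eqVlt; apply/orP; left; apply/eqP; congr (_ * _ ^+ _); field.
by rewrite gt_eqF.
Qed.

End Taylor.

(** * Ultralimits *)

Section UltraLimit.

Lemma exists_ultra : exists U : set_system nat, UltraFilter U /\ \oo `<=` U.
Proof. by have [U [uU sU]] := @ultraFilterLemma nat \oo _; exists U. Qed.

(** One fixed ultrafilter serves throughout. Along it every bounded sequence converges and one of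
    finitely many alternatives always prevails, so limits can be chosen at all points of the plane
    at once, without a diagonal argument. *)
Definition uf : set_system nat := sval (cid exists_ultra).

#[local] Instance uf_ultra : UltraFilter uf.
Proof. by rewrite /uf; case: cid => U []. Qed.

#[local] Instance uf_proper : ProperFilter uf.
Proof. exact: ultra_proper. Qed.

Implicit Types P Q : nat -> Prop.

Lemma uf_near P N : (forall k, (N <= k)%N -> P k) -> uf P.
Proof.
rewrite /uf; case: cid => U [_ sU] h /=; apply: sU.
by exists N => // k /= /h.
Qed.

Lemma uf_all P : (forall k, P k) -> uf P.
Proof. by move=> h; apply: (@uf_near _ 0). Qed.

Lemma ufW P Q : (forall k, P k -> Q k) -> uf P -> uf Q.
Proof. by move=> h; apply: filterS. Qed.

Lemma ufI P Q : uf P -> uf Q -> uf (fun k => P k /\ Q k).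
Proof. exact: filterI. Qed.

Lemma ufW2 P P' Q : (forall k, P k -> P' k -> Q k) -> uf P -> uf P' -> uf Q.
Proof. by move=> h p p'; apply: ufW (ufI p p') => k []; exact: h. Qed.

Lemma uf_ex P : uf P -> exists k, P k.
Proof. by move/filter_ex. Qed.

Lemma uf_not P : ~ uf P -> uf (fun k => ~ P k).
Proof. by move=> nP; have [//|] := in_ultra_setVsetC P uf_ultra. Qed.

Lemma uf_seq (I : Type) (s : seq I) (P : I -> nat -> Prop) (S : nat -> Prop) :
  uf (fun k => S k -> exists2 i, List.In i s & P i k) -> uf S ->
  exists2 i, List.In i s & uf (P i).
Proof.
move=> h hS; apply: contrapT => nh.
have : uf (fun k => forall i, List.In i s -> ~ P i k).
  elim: s nh {h} => [|i s IH] nh; first by apply: uf_all.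
  have h1 : uf (fun k => ~ P i k).
    by apply: uf_not => hi; apply: nh; exists i => //; left.
  have h2 := IH (fun h => nh (let: ex_intro2 j js hj := h in ex_intro2 _ _ j (or_intror js) hj)).
  by apply: ufW2 h1 h2 => k k1 k2 j [<-|/k2].
move=> h2; have [k [[h1 h3] h4]] := uf_ex (ufI (ufI h h2) hS).
by have [i /h3] := h1 h4.
Qed.

Lemma uf_fin (I : finType) (P : I -> nat -> Prop) :
  uf (fun k => exists i, P i k) -> exists i, uf (P i).
Proof.
move=> h; have [||i _ hi] := @uf_seq _ (enum I) P (fun=> True).
- apply: ufW h => k [i hi] _; exists i => //.
  by elim: (enum I) (mem_enum I i) => //= j s IH; rewrite inE => /orP[/eqP->|/IH]; [left|right].
- exact: (uf_all (fun=> Logic.I)).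
- by exists i.
Qed.

Variable R : realType.
Local Notation C := R[i].
Implicit Types (u v : nat -> C) (l m z : C).

Definition ucv u l := forall e : R, 0 < e -> uf (fun k => cabs (u k - l) <= e).

Lemma ucv_cst l : ucv (fun=> l) l.
Proof. by move=> e e0; apply: uf_all => k; rewrite subrr cabs0 ltW. Qed.

Lemma ucv_uniq u l m : ucv u l -> ucv u m -> l = m.
Proof.
move=> hl hm; apply/subr0_eq/ceps_eq0 => e e0.
have e2 : 0 < e / 2 by rewrite divr_gt0.
have [k [h1 h2]] := uf_ex (ufI (hl _ e2) (hm _ e2)).
by apply: le_trans (cabs_tri _ (u k) _) _; rewrite cabsB; slim_lra.
Qed.

Lemma ucv_close u v l : ucv u l -> (forall e : R, 0 < e -> uf (fun k => cabs (v k - u k) <= e)) ->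
  ucv v l.
Proof.
move=> hu huv e e0; have e2 : 0 < e / 2 by rewrite divr_gt0.
apply: ufW2 (hu _ e2) (huv _ e2) => k h1 h2.
by apply: le_trans (cabs_tri _ (u k) _) _; slim_lra.
Qed.

Lemma ucv_eq u v l : uf (fun k => u k = v k) -> ucv u l -> ucv v l.
Proof.
move=> h hu; apply: ucv_close hu _ => e e0.
by apply: ufW h => k ->; rewrite subrr cabs0 ltW.
Qed.

Lemma ucv_le u l (M : R) : ucv u l -> uf (fun k => cabs (u k) <= M) -> cabs l <= M.
Proof.
move=> hu hM; apply/ler_addgt0Pl => e e0.
have [k [h1 h2]] := uf_ex (ufI (hu _ e0) hM).
by have := le_cabsB l (u k); rewrite cabsB; slim_lra.
Qed.

Lemma ucv_bounded u l : ucv u l -> uf (fun k => cabs (u k) <= cabs l + 1).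
Proof.
by move=> /(_ 1 ltr01); apply: ufW => k; have := le_cabsB (u k) l; slim_lra.
Qed.

Lemma ucvD u v l m : ucv u l -> ucv v m -> ucv (fun k => u k + v k) (l + m).
Proof.
move=> hu hv e e0; have e2 : 0 < e / 2 by rewrite divr_gt0.
apply: ufW2 (hu _ e2) (hv _ e2) => k h1 h2.
by rewrite opprD addrACA; apply: le_trans (cabsD _ _) _; slim_lra.
Qed.

Lemma ucvM u v l m : ucv u l -> ucv v m -> ucv (fun k => u k * v k) (l * m).
Proof.
move=> hu hv e e0; have hb := ucv_bounded hv.
pose A := cabs l + cabs m + 1; have A0 : 0 < A by rewrite ltr_wpDl // addr_ge0 ?cabs_ge0.
have e2 : 0 < e / A by rewrite divr_gt0.
apply: ufW2 (ufI (hu _ e2) (hv _ e2)) hb => k [h1 h2] h3.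
rewrite (_ : _ - _ = (u k - l) * v k + l * (v k - m)); last by ring.
apply: le_trans (cabsD _ _) _; rewrite !cabsM.
apply: le_trans (_ : e / A * (cabs m + 1) + cabs l * (e / A) <= e).
  by apply: lerD; [apply: ler_pM|apply: ler_wpM2l]; rewrite ?cabs_ge0.
by rewrite le_eqVlt; apply/orP; left; apply/eqP; rewrite /A; field; rewrite gt_eqF.
Qed.

Lemma ucvZ c u l : ucv u l -> ucv (fun k => c * u k) (c * l).
Proof. exact/ucvM/ucv_cst. Qed.

Lemma ucvB u v l m : ucv u l -> ucv v m -> ucv (fun k => u k - v k) (l - m).
Proof.
move=> hu /(ucvZ (-1)) hv; rewrite -mulN1r; apply: ucv_eq (ucvD hu hv).
by apply: uf_all => k; rewrite mulN1r.
Qed.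

Lemma ucvX u l n : ucv u l -> ucv (fun k => u k ^+ n) (l ^+ n).
Proof.
move=> hu; elim: n => [|n IH]; first exact: ucv_cst.
rewrite exprS; apply: ucv_eq (ucvM hu IH).
by apply: uf_all => k; rewrite exprS.
Qed.

Lemma ucv_sum (I : Type) (s : seq I) (F : I -> nat -> C) (l : I -> C) :
  (forall i, ucv (F i) (l i)) -> ucv (fun k => \sum_(i <- s) F i k) (\sum_(i <- s) l i).
Proof.
move=> h; elim: s => [|i s IH].
  by rewrite big_nil; apply: ucv_eq (ucv_cst 0); apply: uf_all => k; rewrite big_nil.
rewrite big_cons; apply: ucv_eq (ucvD (h i) IH).
by apply: uf_all => k; rewrite big_cons.
Qed.

Lemma ucv_prod (I : Type) (s : seq I) (F : I -> nat -> C) (l : I -> C) :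
  (forall i, ucv (F i) (l i)) -> ucv (fun k => \prod_(i <- s) F i k) (\prod_(i <- s) l i).
Proof.
move=> h; elim: s => [|i s IH].
  by rewrite big_nil; apply: ucv_eq (ucv_cst 1); apply: uf_all => k; rewrite big_nil.
rewrite big_cons; apply: ucv_eq (ucvM (h i) IH).
by apply: uf_all => k; rewrite big_cons.
Qed.

(** The limit is the supremum of the reals that lie below [u] on a set of the ultrafilter. *)
Lemma ucv_real (u : nat -> R) (M : R) : uf (fun k => `|u k| <= M) ->
  exists l : R, forall e, 0 < e -> uf (fun k => `|u k - l| <= e).
Proof.
move=> hM; pose S := [set x : R | uf (fun k => x <= u k)].
have S0 : S (- M) by apply: ufW hM => k; rewrite ler_norml => /andP[].
have Sub : ubound S M.
  move=> x hx; have [k [h1 h2]] := uf_ex (ufI hx hM).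
  by apply: le_trans h1 (le_trans (ler_norm _) h2).
have hS : has_sup S by split; [exists (- M)|exists M].
exists (sup S) => e e0; have [x Sx xe] := sup_adherent e0 hS.
have h2 : uf (fun k => ~ (sup S + e <= u k)).
  apply: uf_not => /(ub_le_sup (ex_intro _ M Sub)); slim_lra.
apply: ufW2 Sx h2 => k h /negP; rewrite -ltNge => h3.
by rewrite ler_norml; slim_lra.
Qed.

Lemma ucv_ex u (M : R) : uf (fun k => cabs (u k) <= M) -> exists l, ucv u l.
Proof.
move=> hM.
have [a ha] := @ucv_real (fun k => complex.Re (u k)) M
  (ufW (fun k => le_trans (Re_le_cabs (u k))) hM).
have [b hb] := @ucv_real (fun k => complex.Im (u k)) M
  (ufW (fun k => le_trans (Im_le_cabs (u k))) hM).
exists (Complex a b) => e e0; have e2 : 0 < e / 2 by rewrite divr_gt0.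
apply: ufW2 (ha _ e2) (hb _ e2) => k h1 h2.
apply: le_trans (cabs_le_ReIm _) _.
by move: h1 h2; case: (u k) => ? ? /=; slim_lra.
Qed.

End UltraLimit.

(** * Cauchy estimates, zeros, limits of holomorphic functions *)

Section CauchyEstimates.
Variable R : realType.
Local Notation C := R[i].
Implicit Types (f g : C -> C) (a b z w : C) (r s M K d : R).

Definition bdd f a r M := forall z, cabs (z - a) < r -> cabs (f z) <= M.

Lemma bdd_ge0 f a r M : 0 < r -> bdd f a r M -> 0 <= M.
Proof.
by move=> r0 /(_ a); rewrite subrr cabs0 => /(_ r0); apply: le_trans; exact: cabs_ge0.
Qed.

Lemma bdd_sub f a r M b s : bdd f a r M -> cabs (b - a) + s <= r -> bdd f b s M.
Proof. by move=> h bs z zb; apply: h; exact: disc_sub bs zb. Qed.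

Lemma cabs_addK a w : cabs (a + w - a) = cabs w.
Proof. by rewrite addrC addKr. Qed.

Lemma sqr_small_cder f a (L : C) K d : 0 < d ->
  (forall w, cabs w < d -> cabs (f (a + w) - f a - L * w) <= K * cabs w ^+ 2) ->
  cder f a L.
Proof.
move=> d0 h e e0; pose A := `|K| + 1; have A0 : 0 < A by rewrite ltr_wpDl.
exists (Num.min d (e / A)); first by rewrite lt_min d0 divr_gt0.
move=> w; rewrite lt_min => /andP[wd we]; apply: le_trans (h _ wd) _.
have Kw : K * cabs w <= e.
  apply: le_trans (_ : A * cabs w <= e).
    rewrite ler_wpM2r ?cabs_ge0 // /A; have := ler_norm K; slim_lra.
  by move: we; rewrite ltr_pdivlMr // mulrC => /ltW.
by rewrite expr2 mulrA ler_wpM2r ?cabs_ge0.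
Qed.

Lemma taylor_D f a r M : 0 < r -> hol f a r -> bdd f a r M ->
  exists2 c : nat -> C, c 0 = f a /\ c 1 = D f a &
  (forall p, cabs (c p) <= 4 * M * (2 / r) ^+ p) /\
    forall P w, cabs w <= r / 4 ->
      cabs (f (a + w) - \sum_(p < P) c p * w ^+ p) <= 8 * M * (2 * cabs w / r) ^+ P.
Proof.
move=> r0 fh fM; have [|c c1 c2] := taylor (M := M) r0 fh.
  by move=> z /andP[_]; exact: fM.
have c0 : c 0 = f a.
  have := c2 1%N 0; rewrite cabs0 big_ord1 expr0 mulr1 addr0 => h.
  apply/esym/subr0_eq/eqP; rewrite -cabs_eq0 -normr_le0 ger0_norm ?cabs_ge0 //.
  have r4 : 0 <= r / 4 by rewrite divr_ge0 // ltW.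
  by apply: le_trans (h r4) _; rewrite mulr0 mul0r expr1 mulr0.
exists c; split=> //; apply/esym/D_eq.
apply: (@sqr_small_cder _ _ _ (32 * M / r ^+ 2) (r / 4)); first by rewrite divr_gt0.
move=> w wr; have := c2 2%N w (ltW wr).
rewrite big_ord_recr big_ord1 /= expr0 mulr1 expr1 c0 opprD addrA => h.
apply: le_trans h _; rewrite le_eqVlt; apply/orP; left; apply/eqP; field.
by rewrite gt_eqF.
Qed.

Lemma cauchy_D f a r M : 0 < r -> hol f a r -> bdd f a r M ->
  cabs (D f a) <= 8 * M / r.
Proof.
move=> r0 fh fM; have [c [_ <-] [c1 _]] := taylor_D r0 fh fM.
by apply: le_trans (c1 1%N) _; rewrite expr1; slim_lra.
Qed.

Lemma cauchy_lin f a r M w : 0 < r -> hol f a r -> bdd f a r M -> cabs w <= r / 4 ->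
  cabs (f (a + w) - f a - D f a * w) <= 32 * M / r ^+ 2 * cabs w ^+ 2.
Proof.
move=> r0 fh fM wr; have [c [c0 c1] [_ h]] := taylor_D r0 fh fM.
have := h 2%N w wr; rewrite big_ord_recr big_ord1 /= expr0 mulr1 expr1 c0 c1 opprD addrA.
move/le_trans; apply; rewrite le_eqVlt; apply/orP; left; apply/eqP; field.
by rewrite gt_eqF.
Qed.

Lemma cauchy_lip f a r M w : 0 < r -> hol f a r -> bdd f a r M -> cabs w <= r / 4 ->
  cabs (f (a + w) - f a) <= 16 * M / r * cabs w.
Proof.
move=> r0 fh fM wr; have [c [c0 c1] [_ h]] := taylor_D r0 fh fM.
have := h 1%N w wr; rewrite big_ord1 /= expr0 mulr1 c0 => /le_trans; apply.
rewrite le_eqVlt; apply/orP; left; apply/eqP; field.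
by rewrite gt_eqF.
Qed.

Lemma liouville f M : (forall z, cdiff f z) -> (forall z, cabs (f z) <= M) ->
  forall z w, f z = f w.
Proof.
move=> fd fM z w; apply/subr0_eq/ceps_eq0 => e e0.
have M0 : 0 <= M := le_trans (cabs_ge0 _) (fM 0).
pose t := cabs (z - w); have t0 : 0 <= t by exact: cabs_ge0.
(* The first term puts z within r/4 of w; the last makes the Lipschitz bound 16 M t / r at most
   e. *)
pose r := 4 * t + 1 + 16 * M * t / e.
have k0 : 0 <= 16 * M * t / e by apply: divr_ge0 (ltW e0); rewrite !mulr_ge0.
have r0 : 0 < r by rewrite /r; slim_lra.
rewrite -[z](subrK w) [_ - w + w]addrC.
apply: le_trans (@cauchy_lip _ w r M (z - w) r0 _ _ _) _.
- by move=> x _; exact: fd.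
- by move=> x _; exact: fM.
- by rewrite -/t /r; slim_lra.
have kE : e * (16 * M * t / e) = 16 * M * t by field; rewrite gt_eqF.
rewrite -/t mulrAC ler_pdivrMr // /r mulrDr kE lerDr; apply: mulr_ge0; slim_lra.
Qed.

(** Letting w tend to 0 kills the constant term; divide by w and repeat. *)
Lemma poly_germ (c : nat -> C) P K d : 0 < d ->
  (forall w, 0 < cabs w < d -> cabs (\sum_(p < P) c p * w ^+ p) <= K * cabs w ^+ P) ->
  forall p, (p < P)%N -> c p = 0.
Proof.
elim: P c K => [//|P IH] c K d0 h.
have nz w : 0 < cabs w -> w != 0 by rewrite cabs_gt0.
have E w : \sum_(p < P.+1) c p * w ^+ p = c 0 + w * \sum_(p < P) c p.+1 * w ^+ p.
  rewrite big_ord_recl expr0 mulr1 mulr_sumr; congr (_ + _).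
  by apply: eq_bigr => i _; rewrite exprS mulrCA.
have c0 : c 0 = 0.
  apply: ceps_eq0 => e e0.
  pose A := \sum_(p < P) cabs (c p.+1) + `|K| + 1.
  have S0 : 0 <= \sum_(p < P) cabs (c p.+1) by apply: sumr_ge0 => i _; exact: cabs_ge0.
  have K0 := normr_ge0 K; have A0 : 0 < A by rewrite /A; slim_lra.
  pose t := Num.min (d / 2) (Num.min 1 (e / A)).
  have t0 : 0 < t by rewrite !lt_min ltr01 !divr_gt0.
  have t1 : t <= 1 by rewrite !ge_min lexx orbT.
  have td : t < d by rewrite gt_min; apply/orP; left; slim_lra.
  have te : A * t <= e.
    have : t <= e / A by rewrite !ge_min lexx !orbT.
    by rewrite ler_pdivlMr // mulrC.
  pose w : C := t%:C%C; have wE : cabs w = t by rewrite cabsR gtr0_norm.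
  have := h w; rewrite wE t0 td => /(_ isT); rewrite E => h1.
  set s := \sum_(i < P) _ in h1.
  have hs : cabs s <= \sum_(p < P) cabs (c p.+1).
    apply: le_trans (cabs_sum _ _ _) _; apply: ler_sum => i _.
    by rewrite cabsM cabsX wE ler_piMr ?cabs_ge0 ?exprn_ile1 // ltW.
  have hK : K * t ^+ P.+1 <= `|K| * t.
    apply: le_trans (ler_wpM2r _ (ler_norm K)) _; first by rewrite exprn_ge0 // ltW.
    by rewrite ler_wpM2l // exprS ler_piMr ?exprn_ile1 // ltW.
  have := le_cabsB (c 0 + w * s) (w * s); rewrite addrK cabsM wE => h2.
  have h3 : t * cabs s <= t * \sum_(p < P) cabs (c p.+1) by rewrite ler_wpM2l // ltW.
  have := le_cabsB (c 0) (- (w * s)); rewrite opprK cabsN cabsM wE => h4.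
  by move: te; rewrite /A !mulrDl mul1r => te; slim_lra.
have h' : forall w, 0 < cabs w < d ->
    cabs (\sum_(p < P) c p.+1 * w ^+ p) <= K * cabs w ^+ P.
  move=> w wd; have := h w wd; rewrite E c0 add0r cabsM exprS mulrCA.
  by case/andP: wd => w0 _; rewrite ler_pM2l.
by case=> [//|p] pP; exact: (IH (fun p => c p.+1) K d0 h' p pP).
Qed.

(* For a holomorphic [f]: a zero of order at least [l]. *)
Definition flat f a l := exists2 d, 0 < d & exists K,
  forall w, 0 < cabs w < d -> cabs (f (a + w)) <= K * cabs w ^+ l.

Lemma taylor_coef_flat f a r M (c : nat -> C) l : 0 < r -> 0 <= M ->
  (forall P w, cabs w <= r / 4 ->
      cabs (f (a + w) - \sum_(p < P) c p * w ^+ p) <= 8 * M * (2 * cabs w / r) ^+ P) ->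
  flat f a l -> forall p, (p < l)%N -> c p = 0.
Proof.
move=> r0 M0 h [d d0 [K hK]].
apply: (@poly_germ c l (K + 8 * M * (2 / r) ^+ l) (Num.min d (r / 4))).
  by rewrite lt_min d0 divr_gt0.
move=> w; rewrite lt_min => /andP[w0 /andP[wd wr]].
have h1 := h l w (ltW wr).
have h2 := hK w; rewrite w0 wd in h2; have {}h2 := h2 isT.
set s := \sum_(p < l) _ in h1 *.
rewrite (_ : s = f (a + w) - (f (a + w) - s)); last by ring.
apply: le_trans (cabsD _ _) _; rewrite cabsN mulrDl.
apply: lerD => //; apply: le_trans h1 _.
by rewrite le_eqVlt; apply/orP; left; apply/eqP; rewrite -[RHS]mulrA -exprMn [2 / r * _]mulrAC.
Qed.

Lemma flat_le f a r M l : 0 < r -> hol f a r -> bdd f a r M -> flat f a l ->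
  forall w, cabs w <= r / 4 -> cabs (f (a + w)) <= 8 * M * (2 * cabs w / r) ^+ l.
Proof.
move=> r0 fh fM fl w wr; have [c _ [_ h]] := taylor_D r0 fh fM.
have c0 := taylor_coef_flat r0 (bdd_ge0 r0 fM) h fl.
have := h l w wr; rewrite big1 ?subr0 // => i _.
by rewrite c0 // mul0r.
Qed.

(** Points where |f| exceeds k would have an ultralimit in the closed disc of radius s, at which f
    is continuous. *)
Lemma bounded_disc f a r s : 0 < s -> s < r -> hol f a r -> exists M, bdd f a s M.
Proof.
move=> s0 sr fh; apply: contrapT => nM.
have /choice[u uP] : forall k : nat, exists z, cabs (z - a) < s /\ k%:R < cabs (f z).
  move=> k; apply: contrapT => nz; apply: nM; exists k%:R => z zs.
  by rewrite leNgt; apply/negP => h; apply: nz; exists z.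
have [l hl] : exists l, ucv (fun k => u k - a) l.
  by apply: (@ucv_ex _ _ s); apply: uf_all => k; have [/ltW] := uP k.
have ls : cabs l <= s by apply: ucv_le hl _; apply: uf_all => k; have [/ltW] := uP k.
have lr : cabs (a + l - a) < r by rewrite cabs_addK; slim_lra.
have [d d0 hd] := cdiff_cont (fh _ lr) ltr01.
have d2 : 0 < d / 2 by rewrite divr_gt0.
have [N hN] : exists N : nat, cabs (f (a + l)) + 1 < N%:R.
  by exists (Num.bound (cabs (f (a + l)) + 1)); apply: archi_boundP; rewrite addr_ge0 ?cabs_ge0.
have hbig : uf (fun k => N%:R <= k%:R :> R) by apply: (@uf_near _ N) => k; rewrite ler_nat.
have [k [h1 h2]] := uf_ex (ufI (hl _ d2) hbig).
have ud : cabs (u k - (a + l)) < d by rewrite opprD addrA; slim_lra.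
have [_ h3] := uP k; have := hd _ ud.
by have := le_cabsB (f (u k)) (f (a + l)); slim_lra.
Qed.

Lemma flat0 f a r l : 0 < r -> hol f a r -> flat f a l.+1 -> f a = 0.
Proof.
move=> r0 fh fl; have r2 : 0 < r / 2 by rewrite divr_gt0.
have [|M fM] := @bounded_disc f a r (r / 2) r2 _ fh; first by slim_lra.
have fh2 : hol f a (r / 2) by apply: hol_sub fh _; rewrite subrr cabs0; slim_lra.
have := flat_le r2 fh2 fM fl (w := 0); rewrite cabs0 addr0 mulr0 mul0r expr0n mulr0 => h.
by apply/eqP; rewrite -cabs_eq0 -normr_le0 ger0_norm ?cabs_ge0 // h // !divr_ge0 // ltW.
Qed.

Lemma flat1 f a : cdiff f a -> f a = 0 -> flat f a 1.
Proof.
move=> [L /cder_lip[d d0 h]] fa; exists d => //; exists (cabs L + 1) => w /andP[_ wd].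
by have := h _ wd; rewrite fa subr0 expr1.
Qed.

(** At [a] the quotient gets the value f'(a). Its derivative there is the second Taylor coefficient
    of f, because the third-order remainder of f divided by w is of second order. *)
Lemma hol_divide1 f a r : 0 < r -> hol f a r -> f a = 0 ->
  exists2 g, hol g a r & forall z, f z = (z - a) * g z.
Proof.
move=> r0 fh fa; pose g z := if z == a then D f a else f z / (z - a).
have gE z : f z = (z - a) * g z.
  rewrite /g; case: eqVneq => [->|za]; first by rewrite subrr mul0r.
  by rewrite mulrC divfK // subr_eq0.
exists g => // z zr; have [->{z zr}|za] := eqVneq z a; last first.
  have d0 : 0 < cabs (z - a) by rewrite cabs_gt0 subr_eq0.
  apply: (@cdiff_local _ (fun w => f w / (w - a)) _ _ _ d0) => [w wz|].
    rewrite /g; case: eqVneq wz => // ->; rewrite cabsB ltxx //.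
  apply: cdiff_div; rewrite ?subr_eq0 //; first exact: fh.
  by apply: cdiffB; [exact: cdiff_id|exact: cdiff_cst].
have r2 : 0 < r / 2 by rewrite divr_gt0.
have [|M fM] := @bounded_disc f a r (r / 2) r2 _ fh; first by slim_lra.
have fh2 : hol f a (r / 2) by apply: hol_sub fh _; rewrite subrr cabs0; slim_lra.
have [c [c0 c1] [_ h]] := taylor_D r2 fh2 fM.
exists (c 2); apply: (@sqr_small_cder _ _ _ (8 * M * (2 / (r / 2)) ^+ 3) (r / 2 / 4)).
  by rewrite divr_gt0.
move=> w wr; have [->|w0] := eqVneq w 0.
  by rewrite addr0 subrr mulr0 subr0 cabs0 expr0n mulr0.
have aw : cabs w > 0 by rewrite cabs_gt0.
have ga : g a = c 1 by rewrite /g eqxx c1.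
rewrite -(ler_pM2l aw) -cabsM !mulrBr ga.
have -> : w * g (a + w) = f (a + w) by rewrite gE [a + w]addrC addrK.
have := h 3%N w (ltW wr); rewrite !big_ord_recr big_ord0 /= add0r expr0 expr1 c0 fa mul0r add0r.
rewrite opprD addrA (mulrC w (c 1)) (_ : w * (c 2 * w) = c 2 * w ^+ 2); last by ring.
move/le_trans; apply; rewrite le_eqVlt; apply/orP; left; apply/eqP.
by field; rewrite gt_eqF.
Qed.

Lemma hol_divide f a r l : 0 < r -> hol f a r -> flat f a l ->
  exists2 g, hol g a r & forall z, f z = (z - a) ^+ l * g z.
Proof.
move=> r0; elim: l f => [|l IH] f fh fl.
  by exists f => // z; rewrite expr0 mul1r.
have [g gh gE] := hol_divide1 r0 fh (flat0 r0 fh fl).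
have [|h hh hE] := IH g gh.
  have [d d0 [K hK]] := fl; exists d => //; exists K => w wd.
  have := hK w wd; rewrite gE cabsM cabs_addK exprS mulrCA.
  by case/andP: wd => w0 _; rewrite ler_pM2l.
by exists h => // z; rewrite gE hE exprS mulrA.
Qed.

Lemma flat_small f a r : 0 < r -> hol f a r -> (forall l, flat f a l) ->
  forall M, bdd f a r M -> forall w, cabs w <= r / 4 -> f (a + w) = 0.
Proof.
move=> r0 fh fl M fM w wr; apply: ceps_eq0 => e e0.
have M0 := bdd_ge0 r0 fM.
have [n en] := ltr_half_pow (8 * M) e0.
apply: le_trans (flat_le r0 fh fM (fl n) wr) _; apply: le_trans (ltW en).
apply: ler_wpM2l; first by rewrite mulr_ge0.
rewrite -exprVn; apply: lerXn2r; rewrite ?nnegrE ?invr_ge0 //.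
  by rewrite divr_ge0 ?mulr_ge0 ?cabs_ge0 // ltW.
by rewrite ler_pdivrMr //; slim_lra.
Qed.

Lemma flat_eq0 f a d l : 0 < d -> (forall w, cabs w < d -> f (a + w) = 0) -> flat f a l.
Proof.
move=> d0 h; exists d => //; exists 0 => w /andP[_ /h ->].
by rewrite cabs0 mul0r.
Qed.

(* Walking from [b] to [z] in steps shorter than the radius of the Taylor discs. *)
Lemma hol_identity f a r b s : 0 < s -> cabs (b - a) < r -> hol f a r ->
  (forall z, cabs (z - b) < s -> f z = 0) -> forall z, cabs (z - a) < r -> f z = 0.
Proof.
move=> s0 br fh f0 z zr.
pose rho := Num.max (cabs (b - a)) (cabs (z - a)).
have rr : rho < r by rewrite gt_max br zr.
have b_rho : cabs (b - a) <= rho by rewrite le_max lexx.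
have z_rho : cabs (z - a) <= rho by rewrite le_max lexx orbT.
have rho0 : 0 <= rho := le_trans (cabs_ge0 _) b_rho.
pose d := (r - rho) / 2; have d0 : 0 < d by rewrite divr_gt0 // subr_gt0.
have rd0 : 0 < rho + d by slim_lra.
have rdr : rho + d < r by rewrite /d; slim_lra.
have [M fM] := bounded_disc rd0 rdr fh.
have step x s' : 0 < s' -> cabs (x - a) <= rho -> (forall w, cabs w < s' -> f (x + w) = 0) ->
    forall w, cabs w <= d / 4 -> f (x + w) = 0.
  move=> s'0 xr fx; apply: (@flat_small f x d d0 _ _ M).
  - by apply: hol_sub fh _; rewrite /d; slim_lra.
  - by move=> l; exact: flat_eq0 s'0 fx.
  - by apply: bdd_sub fM _; slim_lra.
pose N := Num.bound (cabs (z - b) * 8 / d).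
have zd0 : 0 <= cabs (z - b) * 8 / d by apply: divr_ge0 (ltW d0); rewrite mulr_ge0 ?cabs_ge0.
have hN : cabs (z - b) * 8 / d < N%:R by exact: archi_boundP.
have N0 : 0 < N%:R :> R := le_lt_trans zd0 hN.
have NC : N%:R != 0 :> C by rewrite -cabs_gt0 cabs_nat.
pose x k : C := b + k%:R / N%:R * (z - b).
have xin k : (k <= N)%N -> cabs (x k - a) <= rho.
  move=> kN; pose t : R := k%:R / N%:R.
  have t0 : 0 <= t by rewrite divr_ge0.
  have t1 : t <= 1 by rewrite ler_pdivrMr // mul1r ler_nat.
  have tE : (k%:R / N%:R : C) = t%:C%C by rewrite /t rmorphM fmorphV !rmorph_nat.
  rewrite (_ : x k - a = (1 - t)%:C%C * (b - a) + t%:C%C * (z - a)); last first.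
    by rewrite /x tE rmorphB rmorph1; ring.
  apply: le_trans (cabsD _ _) _; rewrite !cabsM !cabsR !ger0_norm ?subr_ge0 //.
  apply: le_trans (_ : (1 - t) * rho + t * rho <= _); last by slim_lra.
  by apply: lerD; apply: ler_wpM2l; rewrite ?subr_ge0.
have main k : (k <= N)%N -> forall w, cabs w <= d / 4 -> f (x k + w) = 0.
  elim: k => [_|k IH kN].
    apply: (step _ s) => //; first exact: xin.
    by move=> w ws; apply: f0; rewrite /x mul0r mul0r addr0 cabs_addK.
  apply: (step _ (d / 8)); [by slim_lra|exact: xin|].
  move=> w wd; have := IH (ltnW kN) (w + (z - b) / N%:R).
  rewrite (_ : x k + _ = x k.+1 + w); last by rewrite /x -natr1; field.
  apply; apply: le_trans (cabsD _ _) _; rewrite cabsM cabsV cabs_nat.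
  have : cabs (z - b) / N%:R <= d / 8.
    by rewrite ler_pdivrMr //; move: hN; rewrite ltr_pdivrMr //; slim_lra.
  by slim_lra.
have := main N (leqnn _) 0; rewrite cabs0 addr0 /x divff // mul1r addrC subrK.
by apply; slim_lra.
Qed.

(** Take the largest order to which f is flat at a. It exists, since a function flat to every order
    vanishes near a and then on the whole disc by [hol_identity]. *)
Lemma hol_order f a r : 0 < r -> hol f a r -> (exists2 z, cabs (z - a) < r & f z != 0) ->
  exists k, exists2 g, hol g a r & g a != 0 /\ forall z, f z = (z - a) ^+ k * g z.
Proof.
move=> r0 fh [z zr fz]; have r2 : 0 < r / 2 by rewrite divr_gt0.
have [|M fM] := @bounded_disc f a r (r / 2) r2 _ fh; first by slim_lra.
have fh2 : hol f a (r / 2) by apply: hol_sub fh _; rewrite subrr cabs0; slim_lra.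
have [k kP] : exists k, ~ flat f a k.
  apply: contrapT => nk; have fl l : flat f a l.
    by apply: contrapT => h; apply: nk; exists l.
  have f0 x : cabs (x - a) < r / 8 -> f x = 0.
    move=> xa; rewrite -[x](subrK a) [_ - _ + _]addrC.
    by apply: (flat_small r2 fh2 fl fM); slim_lra.
  have r8 : 0 < r / 8 by rewrite divr_gt0.
  have aa : cabs (a - a) < r by rewrite subrr cabs0.
  by move: fz; rewrite (hol_identity r8 aa fh f0 zr) eqxx.
have [] := @ex_minnP (fun k => `[< ~ flat f a k >]); first by exists k; apply/asboolP.
move=> [|l] /asboolP nl lmin.
  exfalso; apply: nl; exists (r / 2) => //; exists M => w /andP[_ wr].
  by rewrite expr0 mulr1; apply: fM; rewrite cabs_addK.
have fl : flat f a l.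
  by apply: contrapT => h; have := lmin l; rewrite asboolT // ltnn => /(_ isT).
have [g gh gE] := hol_divide r0 fh fl.
exists l, g => //; split=> //; apply/eqP => ga; apply: nl.
have [|d d0 [K hK]] := @flat1 g a _ ga; first by apply: gh; rewrite subrr cabs0.
exists d => //; exists K => w wd; rewrite gE cabsM cabsX cabs_addK exprSr [leRHS]mulrCA.
by rewrite ler_wpM2l ?exprn_ge0 ?cabs_ge0 //; have := hK w wd; rewrite expr1.
Qed.

End CauchyEstimates.

(** * Limits, higher derivatives and primitives *)

Section Limits.
Variable R : realType.
Local Notation C := R[i].
Implicit Types (f g : C -> C) (a b z w : C) (r s M K d : R).

(** Pointwise limits suffice: the constant in the second-order estimate [cauchy_lin] depends on M
    and the radius alone, so the estimate passes to the limit along with the bounded sequence of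
    derivatives. *)
Lemma hol_limit (fk : nat -> C -> C) f a r M : 0 < r ->
  uf (fun k => hol (fk k) a r /\ bdd (fk k) a r M) ->
  (forall z, cabs (z - a) < r -> ucv (fun k => fk k z) (f z)) ->
  hol f a r /\ forall z, cabs (z - a) < r -> ucv (fun k => D (fk k) z) (D f z).
Proof.
move=> r0 hk hf.
suff main z : cabs (z - a) < r ->
    exists2 L, cder f z L & ucv (fun k => D (fk k) z) L.
  by split=> z /main[L h1 h2]; [exists L|rewrite (D_eq h1)].
move=> zr; pose s := r - cabs (z - a); have s0 : 0 < s by rewrite subr_gt0.
have sub : cabs (z - a) + s <= r by rewrite /s; slim_lra.
have {}hk : uf (fun k => hol (fk k) z s /\ bdd (fk k) z s M).
  by apply: ufW hk => k [h1 h2]; split; [exact: hol_sub h1 _|exact: bdd_sub h2 _].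
have [|L hL] := @ucv_ex _ (fun k => D (fk k) z) (8 * M / s).
  by apply: ufW hk => k [h1 h2]; exact: cauchy_D.
exists L => //; apply: (@sqr_small_cder _ _ _ _ (32 * M / s ^+ 2) (s / 4)).
  by rewrite divr_gt0.
move=> w ws; have zw : cabs (z + w - a) < r.
  by apply: disc_sub sub _; rewrite cabs_addK; slim_lra.
apply: (@ucv_le _ (fun k => fk k (z + w) - fk k z - D (fk k) z * w)).
  by apply: ucvB (ucvB (hf _ zw) (hf _ zr)) (ucvM hL (ucv_cst _)).
by apply: ufW hk => k [h1 h2]; apply: cauchy_lin => //; exact: ltW.
Qed.

(** By Cauchy's estimate the f_k are Lipschitz near z with a common constant, so the point of
    evaluation may move. *)
Lemma ucv_moving (fk : nat -> C -> C) f a r M (u : nat -> C) z :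
  uf (fun k => hol (fk k) a r /\ bdd (fk k) a r M) ->
  (forall z, cabs (z - a) < r -> ucv (fun k => fk k z) (f z)) ->
  cabs (z - a) < r -> ucv u z -> ucv (fun k => fk k (u k)) (f z).
Proof.
move=> hk hf zr hu; pose s := r - cabs (z - a); have s0 : 0 < s by rewrite subr_gt0.
have sub : cabs (z - a) + s <= r by rewrite /s; slim_lra.
have {}hk : uf (fun k => hol (fk k) z s /\ bdd (fk k) z s M).
  by apply: ufW hk => k [h1 h2]; split; [exact: hol_sub h1 _|exact: bdd_sub h2 _].
have M0 : 0 <= M by have [k [_ h]] := uf_ex hk; exact: bdd_ge0 h.
apply: ucv_close (hf _ zr) _ => e e0.
pose A := 16 * M / s + 1.
have A0 : 0 < A by rewrite ltr_wpDl // divr_ge0 ?mulr_ge0 // ltW.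
have t0 : 0 < Num.min (s / 4) (e / A) by rewrite lt_min !divr_gt0.
apply: ufW2 hk (hu _ t0) => k [h1 h2]; rewrite le_min => /andP[u1 u2].
rewrite -[u k](subrK z) [_ - _ + _]addrC.
apply: le_trans (cauchy_lip s0 h1 h2 u1) _.
apply: le_trans (_ : A * (e / A) <= e).
  by apply: ler_pM; rewrite ?cabs_ge0 ?divr_ge0 ?mulr_ge0 ?(ltW s0) // /A lerDl.
by rewrite mulrC divfK // gt_eqF.
Qed.

(** The difference quotients are holomorphic and uniformly bounded, and D f is their limit, so
    [hol_limit] applies. *)
Lemma hol_D f a r : hol f a r -> hol (D f) a r.
Proof.
move=> fh z zr; pose t := (r - cabs (z - a)); have t0 : 0 < t by rewrite subr_gt0.
pose s := t / 2; have s0 : 0 < s by rewrite divr_gt0.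
have zt : cabs (z - a) + t <= r by rewrite /t; slim_lra.
have [|M fM] := @bounded_disc _ f z t s s0 _ (hol_sub fh zt); first by rewrite /s; slim_lra.
have fh' : hol f z s by apply: hol_sub fh _; rewrite /s; slim_lra.
have s2 : 0 < s / 2 by rewrite divr_gt0.
pose h k : C := (s / 8 / k.+1%:R)%:C%C.
have hE k : cabs (h k) = s / 8 / k.+1%:R by rewrite cabsR ger0_norm // !divr_ge0 // ltW.
have h0 k : 0 < cabs (h k) by rewrite hE !divr_gt0.
have hn k : h k != 0 by rewrite -cabs_gt0.
have hs k : cabs (h k) <= s / 8.
  by rewrite hE ler_pdivrMr // ler_peMr ?ler1n // divr_ge0 // ltW.
pose fk k x := (f (x + h k) - f x) / h k.
have [] := @hol_limit fk (D f) z (s / 2) (32 * M / s) s2 _ _.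
- apply: uf_all => k; split=> x xs.
    apply: cdiff_div; rewrite ?hn //; last exact: cdiff_cst.
    apply: cdiffB; last by apply: fh'; slim_lra.
    apply: (@cdiff_comp _ f (fun x => x + h k)); first by apply: cdiffD; [exact: cdiff_id|exact: cdiff_cst].
    apply: fh'; rewrite addrAC; apply: le_lt_trans (cabsD _ _) _.
    by have := hs k; slim_lra.
  have sub : cabs (x - z) + s / 2 <= s by slim_lra.
  rewrite cabsM cabsV ler_pdivrMr //.
  rewrite (_ : 32 * M / s = 16 * M / (s / 2)); last by field; rewrite gt_eqF.
  apply: (@cauchy_lip _ f x (s / 2) M) => //.
  - exact: hol_sub fh' sub.
  - exact: bdd_sub fM sub.
  - by have := hs k; slim_lra.
- move=> x xs e e0; have [|d d0 hd] := cderP (_ : cdiff f x) e0; first by apply: fh'; slim_lra.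
  have [N hN] : exists N : nat, s / 8 / d < N%:R.
    by exists (Num.bound (s / 8 / d)); apply: archi_boundP; rewrite !divr_ge0 // ltW.
  apply: (@uf_near _ N) => k Nk.
  have hd' : cabs (h k) < d.
    rewrite hE ltr_pdivrMr // [d * _]mulrC -ltr_pdivrMr //; apply: lt_le_trans hN _.
    by rewrite ler_nat; exact: leq_trans Nk _.
  rewrite -(ler_pM2r (h0 k)) -cabsM /fk mulrBl divfK //.
  exact: hd.
- by move=> + _; apply; rewrite subrr cabs0.
Qed.

Lemma hol_iterD f a r p : hol f a r -> hol (iter p (@D R) f) a r.
Proof. by move=> fh; elim: p => [//|p IH] /=; exact: hol_D. Qed.

Lemma bdd_D f a r M : 0 < r -> hol f a r -> bdd f a r M -> bdd (D f) a (r / 2) (16 * M / r).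
Proof.
move=> r0 fh fM z zr; rewrite (_ : 16 * M / r = 8 * M / (r / 2)); last first.
  by field; rewrite gt_eqF.
by apply: cauchy_D; [rewrite divr_gt0|apply: hol_sub fh _|apply: bdd_sub fM _]; slim_lra.
Qed.

Lemma cauchy_iterD p : exists2 K : R, 0 < K & forall f a r M, 0 < r ->
  hol f a r -> bdd f a r M -> cabs (iter p (@D R) f a) <= K * M / r ^+ p.
Proof.
elim: p => [|p [K K0 hK]].
  by exists 1 => // f a r M r0 fh fM; rewrite mul1r expr0 divr1; apply: fM; rewrite subrr cabs0.
exists (K * 16 * 2 ^+ p); first by rewrite !mulr_gt0 ?exprn_gt0.
move=> f a r M r0 fh fM; rewrite iterSr.
have r2 : 0 < r / 2 by rewrite divr_gt0.
apply: le_trans (hK (D f) a _ _ r2 _ (bdd_D r0 fh fM)) _.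
  by apply: hol_D; apply: hol_sub fh _; rewrite subrr cabs0; slim_lra.
rewrite le_eqVlt; apply/orP; left; apply/eqP; rewrite exprS expr_div_n; field.
by rewrite !expf_neq0 ?gt_eqF.
Qed.

Lemma cderXB a z p : cder (fun x => (x - a) ^+ p) z (p%:R * (z - a) ^+ p.-1).
Proof.
elim: p => [|p IH]; first by rewrite mul0r; exact: cder_cst.
have h := cderM (cderB (cder_id z) (cder_cst a z)) IH.
rewrite (_ : _ * _ = (1 - 0) * (z - a) ^+ p + (z - a) * (p%:R * (z - a) ^+ p.-1)).
  by apply: (cder_local ltr01 _ h) => w _; rewrite exprS.
by case: p {IH h} => [|p] /=; rewrite -!natr1 ?exprS; ring.
Qed.

Lemma cder_poly (c : nat -> C) a z n : cder (fun x => \sum_(p < n) c p * (x - a) ^+ p) z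
  (\sum_(p < n) c p * (p%:R * (z - a) ^+ p.-1)).
Proof.
elim: n => [|n IH].
  by rewrite big_ord0; apply: (cder_local ltr01 _ (cder_cst 0 z)) => w _; rewrite big_ord0.
rewrite big_ord_recr /=; apply: (cder_local ltr01 _ (cderD IH (cderZ (c n) (cderXB a z n)))).
by move=> w _; rewrite big_ord_recr.
Qed.

(** The point is that the coefficients given by [taylor_D] are the derivatives over factorials. By
    induction D f has such an expansion, and differentiating the remainder of f yields a second one;
    [poly_germ] compares the two. *)
Lemma taylor_iterD f a r l : 0 < r -> hol f a r ->
  flat (fun z => f z - \sum_(p < l) iter p (@D R) f a / (p`!)%:R * (z - a) ^+ p) a l.
Proof.
elim: l f r => [|l IH] f r r0 fh.
  have [d d0 hd] := cdiff_cont (fh a ltac:(by rewrite subrr cabs0)) ltr01.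
  exists d => //; exists (cabs (f a) + 1) => w /andP[_ wd].
  rewrite big_ord0 subr0 expr0 mulr1.
  have := hd (a + w); rewrite cabs_addK => /(_ wd); have := le_cabsB (f (a + w)) (f a); slim_lra.
have r2 : 0 < r / 2 by rewrite divr_gt0.
have [|M fM] := @bounded_disc _ f a r (r / 2) r2 _ fh; first by slim_lra.
have fh2 : hol f a (r / 2) by apply: hol_sub fh _; rewrite subrr cabs0; slim_lra.
pose rho := r / 2; rewrite -/rho in r2 fM fh2.
have [c [c0 c1] [_ hc]] := taylor_D r2 fh2 fM.
have M0 := bdd_ge0 r2 fM.
suff cE p : (p < l.+1)%N -> c p = iter p (@D R) f a / (p`!)%:R.
  exists (rho / 4); first by rewrite divr_gt0.
  exists (8 * M * (2 / rho) ^+ l.+1) => w /andP[_ wr].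
  rewrite -[leRHS]mulrA -exprMn [2 / rho * _]mulrAC.
  apply: le_trans _ (hc l.+1 w (ltW wr)).
  rewrite le_eqVlt; apply/orP; left; apply/eqP; congr (cabs (_ - _)).
  by apply: eq_bigr => i _; rewrite cE // [a + w]addrC addrK.
case: p => [_|p pl]; first by rewrite c0 /= fact0 divr1.
have [d d0 [K hK]] := IH (D f) r r0 (hol_D fh).
pose e j := c j.+1 * j.+1%:R - iter j (@D R) (D f) a / (j`!)%:R.
suff e0 : e p = 0.
  have p1 : (p.+1%:R : C) != 0 by rewrite pnatr_eq0.
  have u1 : (p`!%:R : C) != 0 by rewrite pnatr_eq0 -lt0n fact_gt0.
  apply: (mulIf p1); move/subr0_eq: e0 => ->; rewrite iterSr factS natrM.
  move: (p.+1%:R : C) (p`!%:R : C) p1 u1 => t u t0 u0.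
  by field; rewrite t0 u0.
pose K' := 64 * M * (4 / rho) ^+ l.+1 + K.
apply: (@poly_germ _ e l K' (Num.min d (rho / 8))) => //; first by rewrite lt_min d0 divr_gt0.
move=> w; rewrite lt_min => /andP[w0 /andP[wd wr]].
pose g z := f z - \sum_(p < l.+1) c p * (z - a) ^+ p.
have gd z : cabs (z - a) < rho -> cder g z (D f z - \sum_(p < l.+1) c p * (p%:R * (z - a) ^+ p.-1)).
  by move=> zr; apply: cderB (cderP (fh2 _ zr)) _; exact: cder_poly.
have sub : cabs (a + w - a) + cabs w <= rho by rewrite cabs_addK; slim_lra.
(* The remainder g is O(|z - a|^(l+1)); Cauchy's estimate on the disc of radius |w| around a + w
   bounds its derivative by O(|w|^l). *)
have gh : hol g (a + w) (cabs w) by move=> z zw; eexists; apply: gd; exact: disc_sub sub zw.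
have gM : bdd g (a + w) (cabs w) (8 * M * (4 * cabs w / rho) ^+ l.+1).
  move=> z zw; have za : cabs (z - a) <= 2 * cabs w.
    by apply: le_trans (cabs_tri _ (a + w) _) _; rewrite cabs_addK; slim_lra.
  have := hc l.+1 (z - a); rewrite [a + _]addrC subrK => h.
  apply: le_trans (h _) _; first by slim_lra.
  apply: ler_wpM2l; first by rewrite mulr_ge0.
  apply: lerXn2r.
  - by rewrite nnegrE; apply: divr_ge0 (ltW r2); rewrite mulr_ge0 ?cabs_ge0.
  - by rewrite nnegrE; apply: divr_ge0 (ltW r2); rewrite mulr_ge0 ?cabs_ge0.
  - by rewrite ler_pM2r ?invr_gt0 //; slim_lra.
have h1 := cauchy_D w0 gh gM.
have h2 := hK w; rewrite w0 wd in h2; have {}h2 := h2 isT.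
rewrite (_ : \sum_(p < l) _ = (D f (a + w) - \sum_(p < l) iter p (@D R) (D f) a / (p`!)%:R * (a + w - a) ^+ p)
    - D g (a + w)); last first.
  rewrite (D_eq (gd _ _)); last by rewrite cabs_addK; slim_lra.
  rewrite opprB [RHS]addrC subrKA big_ord_recl mul0r mulr0 add0r -sumrB.
  have wa : a + w - a = w by rewrite addrC addKr.
  by apply: eq_bigr => i _; rewrite wa mulrBl; congr (_ - _); rewrite -mulrA.
rewrite mulrDl addrC.
apply: le_trans (cabsD _ _) _; rewrite cabsN.
apply: lerD => //; apply: le_trans h1 _.
rewrite ler_pdivrMr //.
have -> : 4 * cabs w / rho = 4 / rho * cabs w by rewrite mulrAC.
rewrite exprMn le_eqVlt; apply/orP; left; apply/eqP.
by rewrite [cabs w ^+ l.+1]exprSr; ring.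
Qed.

Lemma iterD_eq0 f a r p : 0 < r -> (forall z, cabs (z - a) < r -> f z = 0) ->
  iter p (@D R) f a = 0.
Proof.
move=> r0 f0; rewrite (@iter_D_local _ f (fun=> 0) a r p r0) //.
have : iter p (@D R) (fun=> 0) = (fun=> 0).
  by elim: p => [//|p IH]; rewrite iterS IH; apply/funext => z; apply: D_eq; exact: cder_cst.
by move=> ->.
Qed.

(** All derivatives of f at a vanish, so f - f(a) is flat to every order. *)
Lemma D_eq0_cst f a r : hol f a r -> (forall z, cabs (z - a) < r -> D f z = 0) ->
  forall z, cabs (z - a) < r -> f z = f a.
Proof.
move=> fh Df z zr; have r0 : 0 < r by apply: le_lt_trans zr; exact: cabs_ge0.
pose g z := f z - f a.
have gh : hol g a r by move=> x xr; apply: cdiffB; [exact: fh|exact: cdiff_cst].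
have fl l : flat g a l.
  case: l => [|l].
    have := taylor_iterD 0 r0 gh; rewrite (_ : (fun z => _) = g) //.
    by apply/funext => x; rewrite big_ord0 subr0.
  have := taylor_iterD l.+1 r0 fh; rewrite (_ : (fun z => _) = g) //.
  apply/funext => x.
  rewrite big_ord_recl /= fact0 divr1 expr0 mulr1 big1 ?addr0 // => i _.
  by rewrite -iterS iterSr (@iterD_eq0 _ a r) ?mul0r.
have r2 : 0 < r / 2 by rewrite divr_gt0.
have [|M gM] := @bounded_disc _ g a r (r / 2) r2 _ gh; first by slim_lra.
have gh2 : hol g a (r / 2) by apply: hol_sub gh _; rewrite subrr cabs0; slim_lra.
have r8 : 0 < r / 8 by rewrite divr_gt0.
have aa : cabs (a - a) < r by rewrite subrr cabs0.
apply/subr0_eq/(hol_identity r8 aa gh _ zr) => x xa.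
rewrite -[x](subrK a) [_ - _ + _]addrC.
by apply: (flat_small r2 gh2 fl gM); slim_lra.
Qed.

Lemma sum_half_pow n : \sum_(p < n) (2^-1 : R) ^+ p <= 2.
Proof.
suff -> : \sum_(p < n) (2^-1 : R) ^+ p = 2 - 2 * 2^-1 ^+ n.
  by rewrite gerBl mulr_ge0 // exprn_ge0.
elim: n => [|n IH]; first by rewrite big_ord0 expr0; slim_lra.
by rewrite big_ord_recr /= IH exprS; slim_lra.
Qed.

(** The Taylor polynomials are integrated term by term. On the disc of radius r/8 the terms decrease
    like 2^-p, so the primitives are uniformly bounded and [hol_limit] applies to them. *)
Lemma hol_primitive f a r : 0 < r -> hol f a r ->
  exists F, forall z, cabs (z - a) < r / 8 -> cder F z (f z).
Proof.
move=> r0 fh; have r2 : 0 < r / 2 by rewrite divr_gt0.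
have [|M fM] := @bounded_disc _ f a r (r / 2) r2 _ fh; first by slim_lra.
have fh2 : hol f a (r / 2) by apply: hol_sub fh _; rewrite subrr cabs0; slim_lra.
have M0 := bdd_ge0 r2 fM.
have [c _ [c4 hc]] := taylor_D r2 fh2 fM.
pose c' p := if p is p'.+1 then c p' / p%:R else 0.
pose G n z := \sum_(p < n.+1) c' p * (z - a) ^+ p.
have GD n z : cder (G n) z (\sum_(p < n) c p * (z - a) ^+ p).
  have := @cder_poly c' a z n.+1; rewrite big_ord_recl mul0r add0r.
  by congr cder; apply: eq_bigr => i _; rewrite (_ : nat_of_ord (lift ord0 i) = i.+1) // mulrA divfK // pnatr_eq0.
have r8 : 0 < r / 8 by rewrite divr_gt0.
have Gb n : bdd (G n) a (r / 8) (M * r).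
  move=> z zr; rewrite /G big_ord_recl mul0r add0r.
  apply: le_trans (cabs_sum _ _ _) _.
  apply: le_trans (_ : \sum_(p < n) M * r / 2 * 2^-1 ^+ p <= _); last first.
    rewrite -mulr_sumr; have := sum_half_pow n.
    have : 0 <= M * r by rewrite mulr_ge0 // ltW.
    nra.
  apply: ler_sum => i _; rewrite (_ : nat_of_ord (lift ord0 i) = i.+1) // !cabsM cabsV cabs_nat cabsX.
  have i1 : (i.+1%:R : R)^-1 <= 1 by rewrite invf_le1 // ler1n.
  apply: le_trans (_ : 4 * M * (2 / (r / 2)) ^+ i * 1 * (r / 8) ^+ i.+1 <= _).
    apply: ler_pM; rewrite ?mulr_ge0 ?cabs_ge0 ?exprn_ge0 ?cabs_ge0 ?invr_ge0 //.
      by apply: ler_pM; rewrite ?cabs_ge0 ?invr_ge0.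
    by rewrite lerXn2r ?nnegrE ?cabs_ge0 ?(ltW r8) // ltW.
  rewrite mulr1 exprS mulrCA -!mulrA -exprMn.
  rewrite (_ : (2 / (r / 2) * (r / 8)) = 2^-1); last by field; rewrite gt_eqF.
  by rewrite le_eqVlt; apply/orP; left; apply/eqP; field.
have /choice[F FP] : forall z, exists l, cabs (z - a) < r / 8 -> ucv (fun n => G n z) l.
  move=> z; have [zr|zr] := ltP (cabs (z - a)) (r / 8); last by exists 0.
  by have [l hl] := ucv_ex (uf_all (fun n => Gb n z zr)); exists l.
have [|Fh FD] := @hol_limit G F a (r / 8) (M * r) r8 _ FP.
  by apply: uf_all => n; split; [move=> z _; eexists; exact: GD|exact: Gb].
exists F => z zr; suff <- : D F z = f z by apply: cderP; exact: Fh.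
apply: (ucv_uniq (FD z zr)) => e e0.
have [N hN] := ltr_half_pow (8 * M) e0.
apply: (@uf_near _ N) => n Nn; rewrite (D_eq (GD n z)) cabsB.
have zr8 : cabs (z - a) <= r / 2 / 4 by slim_lra.
have := hc n (z - a) zr8; rewrite [a + _]addrC subrK => /le_trans; apply.
apply: le_trans (ltW hN); apply: ler_wpM2l; first by rewrite mulr_ge0.
apply: le_trans (_ : (2^-1) ^+ n <= _).
  apply: lerXn2r.
  - by rewrite nnegrE; apply: divr_ge0 (ltW r2); rewrite mulr_ge0 ?cabs_ge0.
  - by rewrite nnegrE invr_ge0.
  - by rewrite ler_pdivrMr //; slim_lra.
by rewrite -exprVn ler_wiXn2l //; slim_lra.
Qed.

End Limits.

(** * Growth away from the zeros *)

Section Harnack.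
Variable R : realType.
Local Notation C := R[i].
Implicit Types (f g E F : C -> C) (a b z w : C) (r s M K d e : R).

(** The second-order bound behind d ln|E| = Re (E'/E dz). It comes from 2 ln|1 + h| = ln (1 + y), y
    = 2 Re h + |h|^2, and elementary bounds of the real logarithm. *)
Lemma ln_cabs1D (h : C) : cabs h <= 1 / 2 ->
  `|ln (cabs (1 + h)) - complex.Re h| <= 18 * cabs h ^+ 2.
Proof.
move=> h2; set c := cabs h in h2 *; set x := complex.Re h.
have c0 : 0 <= c := cabs_ge0 h.
have xc : `|x| <= c := Re_le_cabs h.
have u2 : 1 / 2 <= cabs (1 + h).
  by have := le_cabsB 1 (- h); rewrite opprK cabsN cabs1 -/c; slim_lra.
have u0 : 0 < cabs (1 + h) by slim_lra.
pose y := 2 * x + c ^+ 2.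
have yE : cabs (1 + h) ^+ 2 = 1 + y.
  rewrite /y /c /x !cabs_normc; case: (h) => p q /=.
  by rewrite !sqr_sqrtr ?addr_ge0 ?sqr_ge0 //; ring.
have y14 : 1 / 4 <= 1 + y by rewrite -yE; nra.
have lnE : 2 * ln (cabs (1 + h)) = ln (1 + y) by rewrite -yE lnXn // mulr_natl.
have up : ln (1 + y) <= y by apply: le_ln1Dx; slim_lra.
have lo : y - y ^+ 2 * 4 <= ln (1 + y).
  have y0 : 0 < 1 + y by slim_lra.
  have z0 : 1 + (- y / (1 + y)) = (1 + y)^-1 by field; rewrite gt_eqF.
  have : ln (1 + (- y / (1 + y))) <= - y / (1 + y).
    apply: le_ln1Dx; have i0 : 0 < (1 + y)^-1 by rewrite invr_gt0.
    by slim_lra.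
  rewrite z0 lnV ?posrE // => h1.
  have h3 : y ^+ 2 / (1 + y) <= y ^+ 2 * 4.
    apply: ler_wpM2l; first exact: sqr_ge0.
    by rewrite -(ler_pM2l y0) divff ?gt_eqF //; slim_lra.
  have h4 : - y / (1 + y) = - y + y ^+ 2 / (1 + y) by field; rewrite gt_eqF.
  slim_lra.
have yc : `|y| <= 5 / 2 * c.
  apply: le_trans (ler_normD _ _) _; rewrite normrM (ger0_norm (sqr_ge0 c)) (@ger0_norm _ 2) //.
  have : c ^+ 2 <= c / 2 by nra.
  by slim_lra.
have y2 : y ^+ 2 <= 25 / 4 * c ^+ 2.
  rewrite -real_normK ?num_real //; have := normr_ge0 y; nra.
have yx : y = 2 * x + c ^+ 2 by [].
have cc : 0 <= c ^+ 2 by rewrite sqr_ge0.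
by rewrite ler_norml; apply/andP; split; slim_lra.
Qed.

(** No complex logarithm is chosen: ln|E| - Re F has increments o(|w|) at each point, and bisecting
    the segment from a to z shows that it is constant along it. *)
Lemma ln_cabs_primitive E F a r : hol E a r -> (forall z, cabs (z - a) < r -> E z != 0) ->
  (forall z, cabs (z - a) < r -> cder F z (D E z / E z)) ->
  forall z, cabs (z - a) < r ->
    ln (cabs (E z)) - ln (cabs (E a)) = complex.Re (F z - F a).
Proof.
move=> Eh E0 hF; pose Phi z := ln (cabs (E z)) - complex.Re (F z).
have loc z e : cabs (z - a) < r -> 0 < e -> exists2 d, 0 < d &
    forall w, cabs w < d -> `|Phi (z + w) - Phi z| <= e * cabs w.
  move=> zr e0; have Ez := E0 _ zr; pose q := D E z / E z.
  have hG : cder (fun w => E w / E z) z q.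
    have := cderZ (E z)^-1 (cderP (Eh _ zr)); rewrite mulrC.
    by apply: (cder_local ltr01) => w _; rewrite mulrC.
  have e4 : 0 < e / 4 by rewrite divr_gt0.
  have [d1 d10 h1] := hG _ e4; have [d2 d20 h2] := cder_lip hG.
  have [d3 d30 h3] := hF _ zr _ e4.
  set A := cabs q + 1 in h2; have A1 : 1 <= A by rewrite /A lerDr cabs_ge0.
  have A0 : 0 < A by slim_lra.
  pose d := Num.min (Num.min d1 d2) (Num.min d3 (Num.min (1 / (2 * A)) (e / (36 * A ^+ 2)))).
  exists d; first by rewrite !lt_min d10 d20 d30 !divr_gt0 ?mulr_gt0 ?exprn_gt0.
  move=> w; rewrite !lt_min => /andP[/andP[w1 w2] /andP[w3 /andP[w4 w5]]].
  pose h := (E (z + w) - E z) / E z.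
  have hE : E (z + w) / E z - E z / E z = h by rewrite /h mulrBl.
  have k1 := h1 _ w1; have k2 := h2 _ w2; have k3 := h3 _ w3; rewrite hE in k1 k2.
  have hl : cabs h <= 1 / 2.
    by apply: le_trans k2 _; move: w4; rewrite ltr_pdivlMr ?mulr_gt0 // => /ltW; slim_lra.
  have zw : E (z + w) = E z * (1 + h) by rewrite /h; field.
  have h10 : 0 < cabs (1 + h).
    by have := le_cabsB 1 (- h); rewrite opprK cabsN cabs1; slim_lra.
  have P1 : Phi (z + w) - Phi z = (ln (cabs (1 + h)) - complex.Re h)
      + complex.Re (h - q * w) - complex.Re (F (z + w) - F z - q * w).
    rewrite /Phi zw cabsM lnM ?posrE ?cabs_gt0 // -?cabs_gt0 // !ReB; ring.
  have P2 := ln_cabs1D hl.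
  have P3 : 18 * cabs h ^+ 2 <= e / 2 * cabs w.
    have : cabs h ^+ 2 <= (A * cabs w) ^+ 2 by rewrite lerXn2r ?nnegrE ?mulr_ge0 ?cabs_ge0 // ltW.
    move: w5; rewrite ltr_pdivlMr ?mulr_gt0 ?exprn_gt0 // => /ltW w5.
    have := cabs_ge0 w; rewrite exprMn; nra.
  rewrite P1; apply: le_trans (ler_normB _ _) _.
  apply: le_trans (lerD (ler_normD _ _) (Re_le_cabs _)) _.
  apply: le_trans (lerD (lerD P2 (Re_le_cabs _)) (lexx _)) _.
  by slim_lra.
move=> z zr; pose u := z - a; pose psi (t : R) := Phi (a + t%:C%C * u).
have tin t : 0 <= t <= 1 -> cabs (a + t%:C%C * u - a) < r.
  move=> t01; rewrite cabs_addK cabsM cabsR ger0_norm; last by slim_lra.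
  by apply: le_lt_trans zr; rewrite ler_piMl ?cabs_ge0 //; slim_lra.
suff : psi 1 - psi 0 = 0.
  rewrite /psi mul0r addr0 mul1r /u [a + _]addrC subrK /Phi ReB; slim_lra.
apply: eps_eq0 => e e0; have u1 : 0 < cabs u + 1 by rewrite ltr_wpDl ?cabs_ge0.
pose P x (y : R) s := 0 <= x -> x + s <= 1 -> `|psi (x + s) - psi x| <= e * s.
have : P 0 0 1; last by rewrite /P add0r mulr1; apply.
apply: (@quartering _ 1 0 P) => //.
- move=> x y s s0; rewrite /P mulr1 => h1 h2 _ _ x0 xs.
  have xs2 : x + s / 2 + s / 2 = x + s by field.
  have {}h1 := h1 x0 ltac:(slim_lra); have {}h2 := h2 ltac:(slim_lra) ltac:(slim_lra).
  rewrite xs2 in h2; rewrite -(subrKA (psi (x + s / 2))).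
  by apply: le_trans (ler_normD _ _) _; slim_lra.
- move=> p y; rewrite mulr1 add0r => p01 _.
  have [d d0 hd] := loc _ (e / (cabs u + 1)) (tin p p01) (divr_gt0 e0 u1).
  have lp t : `|t| < d / (cabs u + 1) -> `|psi (p + t) - psi p| <= e * `|t|.
    move=> td; have wd : cabs (t%:C%C * u) < d.
      rewrite cabsM cabsR; move: td; rewrite ltr_pdivlMr //; apply: le_lt_trans.
      by rewrite ler_wpM2l // lerDl.
    have := hd _ wd; rewrite /psi rmorphD /= mulrDl addrA => /le_trans; apply.
    rewrite cabsM cabsR -mulrA ler_wpM2l ?(ltW e0) // ler_pdivrMl //.
    by rewrite mulrC ler_wpM2r // lerDl.
  exists (d / (cabs u + 1)); first by rewrite divr_gt0.
  move=> x y' s /andP[s0 sd] px _ _ _ _ _ x0 xs; rewrite mulr1 in px.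
  have k1 := lp (x + s - p); have k2 := lp (x - p).
  rewrite [p + _]addrC subrK in k1; rewrite [p + _]addrC subrK in k2.
  have n1 : `|x + s - p| = x + s - p by rewrite ger0_norm; slim_lra.
  have n2 : `|x - p| = p - x by rewrite ler0_norm; slim_lra.
  have {}k1 := k1 ltac:(rewrite n1; slim_lra); have {}k2 := k2 ltac:(rewrite n2; slim_lra).
  rewrite n1 in k1; rewrite n2 distrC in k2; rewrite -(subrKA (psi p)).
  by apply: le_trans (ler_normD _ _) _; slim_lra.
Qed.

(** -ln|E| is the real part of a holomorphic U with values in the right half plane. The Cayley
    transform T of U vanishes at a and is bounded by 1, so it is small near a; undoing it compares
    Re U(z) with U(a) = M. *)
Lemma harnack E a r : 0 < r -> hol E a r -> (forall z, cabs (z - a) < r -> E z != 0) ->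
  bdd E a r 1 -> forall e z, 0 <= e <= 1 -> cabs (z - a) <= e * r / 8 / 8 / 8 ->
    ln (cabs (E z)) <= (1 - e) * ln (cabs (E a)).
Proof.
move=> r0 Eh E0 EM e z e01 za.
have hq : hol (fun z => D E z / E z) a r.
  by move=> x xr; apply: cdiff_div; [exact: E0|exact: (hol_D Eh)|exact: Eh].
have [F FP] := hol_primitive r0 hq.
have r8 : 0 < r / 8 by rewrite divr_gt0.
have lnF x : cabs (x - a) < r / 8 -> ln (cabs (E x)) - ln (cabs (E a)) = complex.Re (F x - F a).
  apply: (@ln_cabs_primitive E F a (r / 8)) => //.
  - by move=> y yr; apply: Eh; slim_lra.
  - by move=> y yr; apply: E0; slim_lra.
pose M := - ln (cabs (E a)).
have ln0 x : cabs (x - a) < r -> ln (cabs (E x)) <= 0 by move=> xr; apply: ln_le0; exact: EM.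
have er : e * r <= r by rewrite ler_piMl; slim_lra.
have za8 : cabs (z - a) < r / 8 by slim_lra.
have M0 : 0 <= M by rewrite oppr_ge0 ln0 // subrr cabs0.
have zl : ln (cabs (E z)) <= 0 by apply: ln0; slim_lra.
have lM : ln (cabs (E a)) = - M by rewrite /M opprK.
(* For M = 0 the denominator U + M of the Cayley transform may vanish; in that case the claim is
   just ln|E(z)| <= 0. *)
have [M00|Mn0] := eqVneq M 0; first by rewrite lM M00 oppr0 mulr0.
have Mp : 0 < M by rewrite lt_neqAle eq_sym Mn0.
pose U x := M%:C%C - (F x - F a).
have ReU x : cabs (x - a) < r / 8 -> complex.Re (U x) = - ln (cabs (E x)).
  by move=> xr; rewrite ReB -lnF //= /M; ring.
have U0 x : cabs (x - a) < r / 8 -> 0 <= complex.Re (U x).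
  by move=> xr; rewrite ReU // oppr_ge0 ln0 //; slim_lra.
have den x : cabs (x - a) < r / 8 -> M <= cabs (U x + M%:C%C).
  move=> xr; apply: le_trans (le_trans (ler_norm _) (Re_le_cabs _)).
  by have := U0 x xr; case: (U x) => p q /=; slim_lra.
have nz x : cabs (x - a) < r / 8 -> U x + M%:C%C != 0.
  by move=> xr; rewrite -cabs_gt0; exact: lt_le_trans Mp (den x xr).
have Uh x : cabs (x - a) < r / 8 -> cdiff U x.
  move=> xr; apply: cdiffB; first exact: cdiff_cst.
  by apply: cdiffB; [exists (D E x / E x); exact: FP|exact: cdiff_cst].
pose T x := (U x - M%:C%C) / (U x + M%:C%C).
have Th : hol T a (r / 8).
  move=> x xr; apply: cdiff_div; first exact: nz.
    by apply: cdiffB; [exact: Uh|exact: cdiff_cst].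
  by apply: cdiffD; [exact: Uh|exact: cdiff_cst].
have TM : bdd T a (r / 8) 1.
  move=> x xr; rewrite cabsM cabsV ler_pdivrMr ?mul1r; last by rewrite cabs_gt0 nz.
  have := U0 x xr; case: (U x) => p q /= p0; rewrite !cabs_normc /= !oppr0 !addr0.
  by apply: ler_wsqrtr; rewrite lerD2r; nra.
have Ta : T a = 0 by rewrite /T /U (subrr (F a)) subr0 subrr mul0r.
have zr32 : cabs (z - a) <= r / 8 / 4 by slim_lra.
have := cauchy_lip r8 Th TM zr32; rewrite [a + _]addrC subrK Ta subr0.
set t := 16 * 1 / _ * _ => Tt.
(* 16 / (r/8) = 128 / r and 128/512 = 1/4: this is where the three factors 8 of the statement come
   from. *)
have tE : t <= e / 4.
  rewrite /t (_ : 16 * 1 / (r / 8) * cabs (z - a) = 128 / r * cabs (z - a)); last first.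
    by field; rewrite gt_eqF.
  rewrite mulrAC ler_pdivrMr //; slim_lra.
have t0 : 0 <= t by apply: le_trans Tt; exact: cabs_ge0.
pose V := cabs (U z - M%:C%C).
have V0 : 0 <= V by exact: cabs_ge0.
have VT : V <= t * (V + 2 * M).
  have VE : V = cabs (T z) * cabs (U z + M%:C%C).
    by rewrite /V -cabsM /T divfK // nz.
  rewrite {1}VE; apply: ler_pM; rewrite ?cabs_ge0 //.
  rewrite (_ : U z + M%:C%C = (U z - M%:C%C) + (2 * M)%:C%C); last first.
    by rewrite rmorphM /= rmorph_nat; ring.
  apply: le_trans (cabsD _ _) _; rewrite cabsR ger0_norm // mulr_ge0 //.
have V4 : V <= e * M by nra.
have : complex.Re (U z - M%:C%C) >= - V.
  by have := Re_le_cabs (U z - M%:C%C); rewrite ler_norml -/V => /andP[].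
rewrite ReB /= ReU // => hV.
by rewrite lM; slim_lra.
Qed.

End Harnack.

(** * Counting and dividing out zeros *)

Section Growth.
Variable R : realType.
Local Notation C := R[i].
Implicit Types (f g E F G : C -> C) (a b z w : C) (r M K d e : R).

(** [hol_divide1] treats a zero at the centre of a disc. Here it is used on a small disc around b,
    and elsewhere the cofactor is E(z) / (z - b). *)
Lemma hol_factor E b : hol E 0 1 -> cabs b < 1 -> E b = 0 ->
  exists2 g, hol g 0 1 & forall z, E z = (z - b) * g z.
Proof.
move=> Eh b1 Eb; have t0 : 0 < 1 - cabs b by rewrite subr_gt0.
have [|g gh gE] := hol_divide1 t0 _ Eb; first by apply: hol_sub Eh _; rewrite subr0; slim_lra.
exists g => // z z1; have [->|zb] := eqVneq z b; first by apply: gh; rewrite subrr cabs0.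
have d0 : 0 < cabs (z - b) by rewrite cabs_gt0 subr_eq0.
apply: (@cdiff_local _ (fun w => E w / (w - b)) _ _ _ d0) => [w wz|].
  rewrite gE mulrC mulKf // subr_eq0; apply/eqP => wb.
  by move: wz; rewrite wb cabsB ltxx.
apply: cdiff_div; rewrite ?subr_eq0 //; first exact: Eh.
by apply: cdiffB; [exact: cdiff_id|exact: cdiff_cst].
Qed.

(** [s] lists zeros with repetition, not necessarily all of them: the list is lengthened until [E]
    has no zero left in the disc of radius 1/8. *)
Definition zeros_out G (s : seq C) E :=
  [/\ hol E 0 1, forall z, G z = \prod_(b <- s) (z - b) * E z &
      forall b, b \in s -> cabs b < 1 / 8 /\ G b = 0].

(** A form of Jensen's inequality. For |z| >= 1/2 each |z - b| is at least 3/8, so |E| <= (8/3)^N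
    there, and [taylor] carries this inside at the cost of a factor 8. At 0 each factor is at most
    1/8, and (1/8)(8/3) = 1/3. *)
Lemma zeros_out_le G s E : bdd G 0 1 1 -> zeros_out G s E ->
  (forall w, cabs w <= 1 / 4 -> cabs (E w) <= 8 * (8 / 3) ^+ size s) /\
  cabs (G 0) * 3 ^+ size s <= 8.
Proof.
move=> GM [Eh GE sP]; set N := size s.
have [|c _ hc] := @taylor _ E 0 1 ((8 / 3) ^+ N) ltr01 Eh.
  move=> z; rewrite subr0 => /andP[z1 z2].
  have P0 : (3 / 8) ^+ N <= cabs (\prod_(b <- s) (z - b)).
    rewrite cabs_prod /N; elim: (s) sP => [|b t IH] tP; first by rewrite big_nil expr0.
    rewrite big_cons /= exprS; apply: ler_pM; rewrite ?exprn_ge0 //; try slim_lra.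
      have [b8 _] := tP b (mem_head _ _).
      by have := le_cabsB z b; slim_lra.
    by apply: IH => b' b't; apply: tP; rewrite in_cons b't orbT.
  have pos : 0 < (3 / 8 : R) ^+ N by rewrite exprn_gt0 //; slim_lra.
  rewrite -(ler_pM2l pos) -exprMn (_ : 3 / 8 * (8 / 3) = 1 :> R); last by field.
  rewrite expr1n; apply: le_trans (_ : cabs (G z) <= 1); last by apply: GM; rewrite subr0.
  by rewrite GE cabsM ler_wpM2r ?cabs_ge0.
have E1 w : cabs w <= 1 / 4 -> cabs (E w) <= 8 * (8 / 3) ^+ N.
  by move=> w4; have := hc 0 w w4; rewrite big_ord0 subr0 add0r expr0 mulr1.
split=> //; rewrite GE cabsM cabs_prod.
have : \prod_(b <- s) cabs (0 - b) <= (1 / 8) ^+ N.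
  rewrite /N; elim: (s) sP => [|b t IH] tP; first by rewrite big_nil expr0.
  rewrite big_cons exprS; apply: ler_pM.
  - exact: cabs_ge0.
  - by apply: prodr_ge0 => i _; exact: cabs_ge0.
  - by rewrite sub0r cabsN ltW //; have [] := tP b (mem_head _ _).
  - by apply: IH => b' b't; apply: tP; rewrite in_cons b't orbT.
have E10 : cabs (E 0) <= 8 * (8 / 3) ^+ N by apply: E1; rewrite cabs0; slim_lra.
move=> h; apply: le_trans (ler_wpM2r _ (ler_pM _ _ h E10)) _.
- by rewrite exprn_ge0.
- by apply: prodr_ge0 => i _; exact: cabs_ge0.
- exact: cabs_ge0.
rewrite mulrCA -!mulrA -!exprMn (_ : 1 / 8 * (8 / 3 * 3) = 1); last by field.
by rewrite expr1n mulr1.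
Qed.

(** Dividing out zeros must stop, since after N steps |G(0)| 3^N <= 8. *)
Lemma zeros_out_ex G : hol G 0 1 -> bdd G 0 1 1 -> G 0 != 0 ->
  exists s E, zeros_out G s E /\ forall z, cabs z < 1 / 8 -> E z != 0.
Proof.
move=> Gh GM G0; apply: contrapT => nE.
have all N : exists s E, zeros_out G s E /\ size s = N.
  elim: N => [|N [s [E [sE sN]]]].
    by exists [::], G; split=> //; split=> // z; rewrite big_nil mul1r.
  have [b b8 Eb] : exists2 b, cabs b < 1 / 8 & E b = 0.
    apply: contrapT => nb; apply: nE; exists s, E; split=> // z z8.
    by apply/eqP => Ez; apply: nb; exists z.
  have [Eh GE sP] := sE; have b1 : cabs b < 1 by slim_lra.
  have [g gh gE] := hol_factor Eh b1 Eb.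
  exists (b :: s), g; split; last by rewrite /= sN.
  split=> // [z|b']; first by rewrite big_cons GE gE mulrCA mulrA.
  by rewrite inE => /orP[/eqP->|/sP//]; rewrite GE Eb mulr0.
have G00 : 0 < cabs (G 0) by rewrite cabs_gt0.
have [N hN] : exists N : nat, 8 / cabs (G 0) < N%:R.
  by exists (Num.bound (8 / cabs (G 0))); apply: archi_boundP; rewrite divr_ge0 // cabs_ge0.
have [s [E [sE sN]]] := all N; have [_] := zeros_out_le GM sE.
rewrite sN leNgt => /negP; apply; move: hN; rewrite ltr_pdivrMr // mulrC => /lt_le_trans; apply.
by rewrite ler_pM2l // -natrX ler_nat ltnW // ltn_expl.
Qed.

Lemma prod_seq_gt0 (s : seq C) : (forall b, b \in s -> b != 0) ->
  0 < \prod_(b <- s) cabs b.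
Proof.
elim: s => [|b s IH] h; first by rewrite big_nil.
rewrite big_cons mulr_gt0 ?cabs_gt0 ?h ?mem_head // IH // => b' hb'.
by rewrite h // in_cons hb' orbT.
Qed.

Lemma ln2_ge : 1 / 2 <= ln (2 : R).
Proof.
have := @le_ln1Dx R (- (1 / 2)) ltac:(slim_lra).
rewrite (_ : 1 + - (1 / 2) = 2^-1); last by field.
by rewrite lnV ?posrE //; slim_lra.
Qed.

(** [harnack] with its radius hidden behind an existential; from here on only 0 < c <= 1 matters. *)
Lemma harnack_radius : exists2 c : R, 0 < c <= 1 & forall E a r, 0 < r -> hol E a r ->
  (forall z, cabs (z - a) < r -> E z != 0) -> bdd E a r 1 ->
  forall e z, 0 <= e <= 1 -> cabs (z - a) <= e * r * c ->
    ln (cabs (E z)) <= (1 - e) * ln (cabs (E a)).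
Proof.
exists (1 / 8 / 8 / 8); first by apply/andP; split; slim_lra.
move=> E a r r0 Eh E0 EM e z e01 za; apply: (harnack r0) => //.
by apply: le_trans za _; slim_lra.
Qed.

(* [|G|] is at most [|G 0|^(1-4e)] up to a constant on a disc whose radius is
   proportional to the distance to the nearest zero: dividing out the zeros
   costs a power [e] only, since their number is O(ln (1/|G 0|)). *)
Lemma growth : exists2 c : R, 0 < c <= 1 & forall G, hol G 0 1 -> bdd G 0 1 1 ->
  G 0 != 0 -> forall e s, 0 <= e <= 1 -> 0 <= s <= 1 ->
  (forall b, cabs b < 1 / 8 -> G b = 0 -> s <= cabs b) ->
  forall z, cabs z <= e * s * c ->
  cabs (G z) <= expR (4 * ln 8 + (1 - 4 * e) * ln (cabs (G 0))).
Proof.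
have [c c01 harn] := harnack_radius; have [c0 c1] := andP c01.
exists (c / 16); first by apply/andP; split; slim_lra.
move=> G Gh GM G0 e t e01 t01 tP z zt.
have [e0 e1] := andP e01; have [t0 t1] := andP t01.
have ze : cabs (z - 0) <= e * (1 / 8) * c.
  rewrite subr0; apply: le_trans zt _; rewrite -!mulrA ler_wpM2l // mulrA.
  by have : t * c <= c; [exact: ler_piMl (ltW c0) t1|slim_lra].
have z8 : cabs z < 1 / 8.
  have c16 : 0 <= c / 16 by slim_lra.
  by have := ler_piMl c16 (mulr_ile1 e0 t0 e1 t1); slim_lra.
have et0 : 0 <= e * t by rewrite mulr_ge0.
have zet : cabs z <= e * t.
  by apply: le_trans zt _; have := ler_piMr et0 c1; slim_lra.
have ln8 : 0 <= ln (8 : R) by apply: ln_ge0; rewrite ler1n.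
have k4 : e * ln 8 <= ln 8 by exact: ler_piMl.
clear zt t01.
have [s [E [sE E0]]] := zeros_out_ex Gh GM G0.
have [Eb Gb] := zeros_out_le GM sE; have [Eh GE sP] := sE.
set N := size s in Eb Gb; pose K : R := 8 * (8 / 3) ^+ N.
have K0 : 0 < K by rewrite mulr_gt0 // exprn_gt0 //; slim_lra.
have [->|Gz0] := eqVneq (G z) 0; first by rewrite cabs0 expR_ge0.
have Gz : 0 < cabs (G z) by rewrite cabs_gt0.
rewrite -(lnK (_ : cabs (G z) \in Num.pos)) ?posrE // ler_expR.
have G00 : 0 < cabs (G 0) by rewrite cabs_gt0.
pose p := \prod_(b <- s) cabs b.
have nzs b : b \in s -> b != 0.
  by move=> /sP[_ Gb0]; apply: contraNneq G0 => b0; rewrite -[X in G X]b0 Gb0.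
have p0 : 0 < p by exact: prod_seq_gt0.
have p1 : p <= 1.
  rewrite /p; elim: (s) sP => [|b u IH] uP; first by rewrite big_nil.
  rewrite big_cons; apply: mulr_ile1; first exact: cabs_ge0.
  - by apply: prodr_ge0 => i _; exact: cabs_ge0.
  - by have [] := uP b (mem_head _ _); slim_lra.
  - by apply: IH => b' b'u; apply: uP; rewrite in_cons b'u orbT.
have Ez0 : 0 < cabs (E z) by rewrite cabs_gt0 E0.
have E00 : 0 < cabs (E 0) by rewrite cabs_gt0 E0 // cabs0; slim_lra.
have lnG0 : ln (cabs (G 0)) = ln p + ln (cabs (E 0)).
  rewrite GE cabsM cabs_prod lnM ?posrE //.
    by congr (ln _ + _); apply: eq_bigr => b _; rewrite sub0r cabsN.
  by rewrite (eq_bigr (fun b => cabs b)) // => b _; rewrite sub0r cabsN.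
(* Since |z| <= e t <= e |b|, each factor satisfies |z - b| <= (1 + e) |b|. The N factors 1 + e cost
   e N in the logarithm, and N is O(ln 8 - ln|G(0)|). *)
have PB : cabs (\prod_(b <- s) (z - b)) <= (1 + e) ^+ N * p.
  rewrite cabs_prod /N /p; elim: (s) sP => [|b u IH] uP.
    by rewrite !big_nil expr0 mul1r.
  rewrite !big_cons /= exprS mulrACA; apply: ler_pM.
  - exact: cabs_ge0.
  - by apply: prodr_ge0 => i _; exact: cabs_ge0.
  - have [b8 Gb0] := uP b (mem_head _ _); have tb := tP b b8 Gb0.
    apply: le_trans (cabsD _ _) _; rewrite cabsN.
    have etb : e * t <= e * cabs b by apply: ler_wpM2l tb.
    by rewrite mulrDl mul1r; move: zet etb; clear; slim_lra.
  - by apply: IH => b' b'u; apply: uP; rewrite in_cons b'u orbT.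
have e1p : 0 < 1 + e by slim_lra.
have lnz : ln (cabs (G z)) <= e *+ N + ln p + ln (cabs (E z)).
  apply: le_trans (_ : ln ((1 + e) ^+ N * p * cabs (E z)) <= _).
    rewrite ler_ln ?posrE ?mulr_gt0 ?exprn_gt0 // GE cabsM.
    by rewrite ler_wpM2r ?cabs_ge0.
  rewrite !lnM ?posrE ?mulr_gt0 ?exprn_gt0 // !lerD2r lnXn // lerMn2r.
  by apply/orP; right; apply: le_ln1Dx; slim_lra.
(* Harnack's inequality is for functions bounded by 1. K is the bound of E from [zeros_out_le], and
   ln K is again O(ln 8 - ln|G(0)|). *)
pose E1 w := E w * K^-1%:C%C.
have E1h : hol E1 0 (1 / 8).
  move=> w; rewrite subr0 => w8; apply: cdiffM; last exact: cdiff_cst.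
  by apply: Eh; rewrite subr0; slim_lra.
have E1n w : cabs (w - 0) < 1 / 8 -> E1 w != 0.
  rewrite subr0 => w8; rewrite mulf_neq0 ?E0 // -cabs_gt0 cabsR normr_gt0.
  by rewrite invr_neq0 // gt_eqF.
have KV : `|K^-1| = K^-1 by rewrite gtr0_norm // invr_gt0.
have E1M : bdd E1 0 (1 / 8) 1.
  move=> w; rewrite subr0 => w8; rewrite cabsM cabsR KV ler_pdivrMr // mul1r.
  by apply: Eb; slim_lra.
have r8 : 0 < 1 / 8 :> R by rewrite divr_gt0.
have := harn _ _ _ r8 E1h E1n E1M _ _ e01 ze.
have lnE1 w : 0 < cabs (E w) -> ln (cabs (E1 w)) = ln (cabs (E w)) - ln K.
  by move=> Ew; rewrite cabsM cabsR KV lnM ?posrE ?invr_gt0 // lnV ?posrE.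
rewrite !lnE1 // => hE.
have lnp : ln p <= 0 by exact: ln_le0.
have hN : N%:R * (1 / 2) <= ln 8 - ln (cabs (G 0)).
  have : ln (cabs (G 0) * 3 ^+ N) <= ln 8.
    by rewrite ler_ln ?posrE ?mulr_gt0 ?exprn_gt0.
  rewrite lnM ?posrE ?exprn_gt0 // lnXn // -[ln 3 *+ N]mulr_natl.
  have l3 : 1 / 2 <= ln (3 : R).
    by apply: le_trans ln2_ge _; rewrite ler_ln ?posrE //; slim_lra.
  have := ler_wpM2l (ler0n R N) l3; clear; slim_lra.
have hK : ln K <= 2 * ln 8 - ln (cabs (G 0)).
  have : ln K <= ln (8 * 3 ^+ N).
    rewrite ler_ln ?posrE ?mulr_gt0 ?exprn_gt0 // ler_wpM2l //.
    by rewrite lerXn2r ?nnegrE //; slim_lra.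
  have : ln (cabs (G 0) * 3 ^+ N) <= ln 8.
    by rewrite ler_ln ?posrE ?mulr_gt0 ?exprn_gt0.
  by rewrite !lnM ?posrE ?exprn_gt0 //; clear; slim_lra.
rewrite -[e *+ N]mulr_natl in lnz.
have k1 : e * ln K <= e * (2 * ln 8 - ln (cabs (G 0))) by exact: ler_wpM2l hK.
have k2 : e * (N%:R * (1 / 2)) <= e * (ln 8 - ln (cabs (G 0))) by exact: ler_wpM2l hN.
have k3 : 0 <= e * - ln p by rewrite mulr_ge0 // oppr_ge0.
rewrite lnG0 in k1 k2 *; move: lnz hE k1 k2 k3 k4; clear; slim_lra.
Qed.

Lemma cauchy_iterD_upto k : exists2 K : R, 1 <= K & forall p, (p <= k)%N ->
  forall f a r M, 0 < r -> hol f a r -> bdd f a r M ->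
  cabs (iter p (@D R) f a) <= K * M / r ^+ p.
Proof.
elim: k => [|k [K K1 hK]].
  have [K K0 hK] := cauchy_iterD R 0.
  exists (K + 1); first slim_lra.
  move=> p; rewrite leqn0 => /eqP-> f a r M r0 fh fM.
  apply: le_trans (hK f a r M r0 fh fM) _; rewrite expr0 !divr1.
  by apply: ler_wpM2r; [exact: bdd_ge0 fM|slim_lra].
have [K' K'0 hK'] := cauchy_iterD R k.+1.
exists (K + K'); first slim_lra.
move=> p; rewrite leq_eqVlt => /orP[/eqP->|pk] f a r M r0 fh fM.
  apply: le_trans (hK' f a r M r0 fh fM) _.
  rewrite ler_wpM2r ?invr_ge0 ?exprn_ge0 ?(ltW r0) // ler_wpM2r //; last slim_lra.
  exact: bdd_ge0 fM.
apply: le_trans (hK p pk f a r M r0 fh fM) _.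
rewrite ler_wpM2r ?invr_ge0 ?exprn_ge0 ?(ltW r0) // ler_wpM2r //; last slim_lra.
exact: bdd_ge0 fM.
Qed.

(** The A-th power of |G^(p)(0)| = O(|G(0)|^(1 - 4e - k/l)), p <= k. With l dividing A and e =
    1/(4A), the exponent A (1 - 4e - k/l) is the integer A - 1 - (A/l) k. The subtraction is
    truncated; when it gives 0 the claim is Cauchy's estimate. *)
Lemma derivative_order (k l A : nat) : (0 < l)%N -> (0 < A)%N -> (l %| A)%N ->
  exists2 K : R, 0 < K & forall G, hol G 0 1 -> bdd G 0 1 1 -> G 0 != 0 ->
    (forall b, cabs b < 1 -> G b = 0 -> flat G b l) ->
    forall p, (p <= k)%N ->
    cabs (iter p (@D R) G 0) ^+ A <= K * cabs (G 0) ^+ (A - 1 - A %/ l * k).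
Proof.
move=> l0 A0 lA.
have [c c01 grow] := growth; have [c0 _] := andP c01.
have [Kc Kc1 hKc] := cauchy_iterD_upto k.
pose e : R := (4 * A%:R)^-1.
have A1 : 1 <= A%:R :> R by rewrite ler1n.
have e0 : 0 < e by rewrite invr_gt0; slim_lra.
have eA : 4 * e * A%:R = 1 by rewrite /e; field; rewrite gt_eqF //; slim_lra.
have e1 : e <= 1 by nra.
pose T : R := 4 / (e * c); have T1 : 1 <= T.
  rewrite /T ler_pdivlMr ?mulr_gt0 // mul1r; move: c01 e1 e0; clear; nra.
have T0 : 0 < T by slim_lra.
have ln8 : 0 <= ln (8 : R) by apply: ln_ge0; slim_lra.
pose c1 := Kc * T ^+ k * expR (4 * ln 8 + k%:R * ln 8).
have Kc0 : 0 < Kc by slim_lra.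
exists (c1 ^+ A); first by rewrite exprn_gt0 // !mulr_gt0 ?exprn_gt0 ?expR_gt0.
move=> G Gh GM G0 Gfl p pk.
pose L := ln (cabs (G 0)).
have G00 : 0 < cabs (G 0) by rewrite cabs_gt0.
have GE : cabs (G 0) = expR L by rewrite /L lnK // posrE.
have L0 : L <= 0 by apply: ln_le0; apply: GM; rewrite subrr cabs0.
have lR : 0 < l%:R :> R by rewrite ltr0n.
have lR1 : 1 <= l%:R :> R by rewrite ler1n.
(* The solution of |G(0)| = 8 (4 t)^l. At a zero b, [flat_le] evaluated at the origin gives |G(0)|
   <= 8 (4 |b|)^l, so no zero of modulus below 1/8 is closer than t. *)
pose t := expR ((L - ln 8) / l%:R) / 4.
have x0 : (L - ln 8) / l%:R <= 0 by rewrite pmulr_lle0 ?invr_gt0 //; slim_lra.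
have t0 : 0 < t by rewrite divr_gt0 ?expR_gt0.
have t1 : t <= 1.
  have : expR ((L - ln 8) / l%:R) <= 1 by rewrite -[leRHS]expR0 ler_expR.
  by rewrite /t; slim_lra.
have tP b : cabs b < 1 / 8 -> G b = 0 -> t <= cabs b.
  move=> b8 Gb; have b1 : cabs b < 1 by slim_lra.
  have h2 : 0 < 1 / 2 :> R by slim_lra.
  have sub : cabs (b - 0) + 1 / 2 <= 1 :> R by rewrite subr0; slim_lra.
  have wb : cabs (- b) <= 1 / 2 / 4 by rewrite cabsN; slim_lra.
  have := flat_le h2 (hol_sub Gh sub) (bdd_sub GM sub) (Gfl b b1 Gb) wb.
  rewrite subrr cabsN mulr1 (_ : 2 * cabs b / (1 / 2) = 4 * cabs b); last by field.
  move=> hG; have b0 : 0 < cabs b.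
    rewrite cabs_gt0; apply: contraNneq G0 => b0.
    by rewrite -[X in G X]b0 Gb.
  have : ln (cabs (G 0)) <= ln (8 * (4 * cabs b) ^+ l).
    by rewrite ler_ln ?posrE ?mulr_gt0 ?exprn_gt0 ?mulr_gt0.
  rewrite lnM ?posrE ?exprn_gt0 ?mulr_gt0 // lnXn ?mulr_gt0 // -[_ *+ l]mulr_natr -/L => hL.
  have : expR ((L - ln 8) / l%:R) <= 4 * cabs b.
    rewrite -[leRHS]lnK ?posrE ?mulr_gt0 // ler_expR ler_pdivrMr //; slim_lra.
  by rewrite /t; slim_lra.
pose rho := e * t * c; have rho0 : 0 < rho by apply: mulr_gt0 => //; exact: mulr_gt0.
have rho1 : rho <= 1.
  case/andP: c01 => _ c_le1; rewrite /rho; apply: mulr_ile1 => //; last first.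
  - by apply: mulr_ile1 => //; exact: ltW.
  - exact: ltW.
  - by apply: mulr_ge0; exact: ltW.
pose B := expR (4 * ln 8 + (1 - 4 * e) * L).
have GB : bdd G 0 rho B.
  move=> z; rewrite subr0 => zr; apply: (grow G Gh GM G0 e t) => //.
  - by rewrite (ltW e0) e1.
  - by rewrite (ltW t0) t1.
  - exact: ltW.
have Gh' : hol G 0 rho by apply: hol_sub Gh _; rewrite subrr cabs0; slim_lra.
have hp := hKc p pk G 0 rho B rho0 Gh' GB.
set y := cabs _ in hp *; have y0 : 0 <= y by exact: cabs_ge0.
have rhoE : rho^-1 = T * expR (- ((L - ln 8) / l%:R)).
  rewrite /rho /t /T expRN; field.
  by rewrite !gt_eqF ?mulr_gt0 ?expR_gt0.
have T1p : T ^+ p <= T ^+ k by rewrite ler_weXn2l.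
have yB : y <= c1 * expR ((1 - 4 * e - k%:R / l%:R) * L).
  apply: le_trans hp _; rewrite -exprVn rhoE exprMn -expRM_natl /c1 /B.
  rewrite -mulrA [expR _ * (_ * _)]mulrCA !mulrA.
  rewrite -[Kc * _ * _ * _]mulrA -[leRHS]mulrA -!expRD.
  apply: ler_pM; rewrite ?expR_ge0 //.
  - by rewrite mulr_ge0 ?exprn_ge0 // ltW.
  - by rewrite ler_pM2l.
  - rewrite ler_expR.
    have pk' : p%:R <= k%:R :> R by rewrite ler_nat.
    have i1 : l%:R^-1 <= 1 :> R by rewrite invf_le1.
    have i0 : 0 < l%:R^-1 :> R by rewrite invr_gt0.
    have p0 : 0 <= p%:R :> R by [].
    have q1 : p%:R * - ((L - ln 8) / l%:R) <= k%:R * - ((L - ln 8) / l%:R).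
      by rewrite ler_wpM2r // oppr_ge0.
    have q2 := ler_wpM2l (ler0n R k) (ler_piMr ln8 i1).
    rewrite (_ : (1 - 4 * e - k%:R / l%:R) * L = (1 - 4 * e) * L - k%:R * (L * l%:R^-1)); last by ring.
    move: q1; rewrite mulrBl opprB; slim_lra.
have c10 : 0 <= c1 by rewrite !mulr_ge0 ?exprn_ge0 ?expR_ge0 ?(ltW Kc0) ?(ltW T0).
have [B0|Bpos] := leqP A (1 + A %/ l * k).
  have -> : (A - 1 - A %/ l * k = 0)%N by apply/eqP; rewrite -subnDA subn_eq0.
  rewrite expr0 mulr1 lerXn2r ?nnegrE //.
  have o0 : 0 < 1 :> R by [].
  have := hKc p pk G 0 1 1 o0 Gh GM; rewrite -/y expr1n divr1 mulr1 => /le_trans; apply.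
  rewrite /c1 -mulrA ler_peMr ?(ltW Kc0) //.
  have T1k : 1 <= T ^+ k by rewrite exprn_ege1.
  have E1 : 1 <= expR (4 * ln 8 + k%:R * ln 8) :> R.
    have : expR 0 <= expR (4 * ln 8 + k%:R * ln 8) :> R.
      by rewrite ler_expR; apply: addr_ge0; apply: mulr_ge0.
    by rewrite expR0.
  exact: mulr_ege1.
apply: le_trans (_ : (c1 * expR ((1 - 4 * e - k%:R / l%:R) * L)) ^+ A <= _).
  by rewrite lerXn2r ?nnegrE // mulr_ge0 ?expR_ge0.
rewrite exprMn GE -!expRM_natl le_eqVlt; apply/orP; left; apply/eqP; congr (_ * expR _).
rewrite -subnDA natrB ?(ltnW Bpos) // natrD natrM mulrA; congr (_ * _).
have lE : A%:R = (A %/ l)%:R * l%:R :> R by rewrite -natrM divnK.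
rewrite mulrBr mulrBr mulr1 (_ : A%:R * (4 * e) = 1); last by rewrite -[RHS]eA; ring.
by rewrite {2}lE opprD addrA; congr (_ - _); field; rewrite gt_eqF.
Qed.

End Growth.

(** * Wronskians *)

Section Evaluation.
Variables (R : realType) (n : nat).
Local Notation C := R[i].
Implicit Types (Q : mpoly n.+1 C) (x : 'rV[C]_n.+1).

Lemma pevalE Q x : peval Q x =
  \sum_(m <- msupp Q) mcoeff m Q * \prod_(i < n.+1) x 0 i ^+ m i.
Proof. exact: mevalE. Qed.

Lemma peval_homog Q d c x : Q \is ishomog1 d mdeg ->
  peval Q (c *: x) = c ^+ d * peval Q x.
Proof.
move=> Qh; rewrite !pevalE mulr_sumr big_seq [RHS]big_seq; apply: eq_bigr => m mQ.
have -> : \prod_(i < n.+1) (c *: x) 0 i ^+ m i = c ^+ d * \prod_(i < n.+1) x 0 i ^+ m i.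
  under eq_bigr do rewrite mxE exprMn.
  rewrite big_split /=; congr (_ * _); rewrite prodrXr; congr (_ ^+ _).
  by have := dhomog_mf Qh mQ; rewrite /= mdegE.
by rewrite mulrCA.
Qed.

Lemma peval_cdiff Q (X : C -> 'rV[C]_n.+1) z :
  (forall t, cdiff (fun w => X w 0 t) z) -> cdiff (fun w => peval Q (X w)) z.
Proof.
move=> hX; under eq_fun do rewrite pevalE.
apply: cdiff_sum => m; apply: cdiffM; first exact: cdiff_cst.
by apply: cdiff_prod => i; exact: cdiffX.
Qed.

Lemma peval_ucv Q (X : nat -> 'rV[C]_n.+1) x :
  (forall t, ucv (fun k => X k 0 t) (x 0 t)) -> ucv (fun k => peval Q (X k)) (peval Q x).
Proof.
move=> hX; rewrite pevalE.
apply: (@ucv_eq _ (fun k => \sum_(m <- msupp Q) mcoeff m Q * \prod_(i < n.+1) X k 0 i ^+ m i)).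
  by apply: uf_all => k; rewrite pevalE.
apply: (@ucv_sum _ _ _ (fun m k => mcoeff m Q * \prod_(i < n.+1) X k 0 i ^+ m i)) => m.
apply: ucvZ.
by apply: (@ucv_prod _ _ _ (fun i k => X k 0 i ^+ m i)) => i; exact: ucvX.
Qed.

Lemma peval_bounded Q (B : R) : exists2 M : R, 0 < M &
  forall x, (forall t, cabs (x 0 t) <= B) -> cabs (peval Q x) <= M.
Proof.
pose M := \sum_(m <- msupp Q) cabs (mcoeff m Q) * \prod_(i < n.+1) B ^+ m i.
exists (`|M| + 1) => [|x hx]; first by rewrite ltr_wpDl.
apply: le_trans (_ : M <= _); last by have := ler_norm M; slim_lra.
rewrite pevalE; apply: le_trans (cabs_sum _ _ _) _; apply: ler_sum => m _.
rewrite cabsM cabs_prod ler_wpM2l ?cabs_ge0 //; apply: ler_prod => i _.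
rewrite cabsX exprn_ge0 ?cabs_ge0 //= lerXn2r ?nnegrE ?cabs_ge0 //.
exact: le_trans (cabs_ge0 _) (hx i).
Qed.

End Evaluation.

Section Wronskian.
Variable R : realType.
Local Notation C := R[i].
Implicit Types (f g : C -> C) (a b z w : C) (d M : R).

Definition wronskian r (y : 'I_r -> C -> C) z : C :=
  \det (\matrix_(p < r, s < r) iter p (@D R) (y s) z).

(* The coefficients of Leibniz' rule: (mu y)^(p) = sum_i (leibniz mu p i) y^(i). *)
Fixpoint leibniz (mu : C -> C) p i : C -> C :=
  if p is p'.+1 then
    fun x => D (leibniz mu p' i) x + (if i is i'.+1 then leibniz mu p' i' x else 0)
  else if i is 0 then mu else fun=> 0.

Lemma D_cst c z : D (fun=> c : C) z = 0.
Proof. by apply: D_eq; exact: cder_cst. Qed.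

Lemma leibniz_gt mu p i : (p < i)%N -> leibniz mu p i = fun=> 0.
Proof.
elim: p i => [|p IH] [|i] //= pi; apply/funext => x.
by rewrite !IH ?D_cst ?addr0 // ltnW.
Qed.

Lemma leibniz_diag mu p : leibniz mu p p = mu.
Proof.
elim: p => [//|p IH]; apply/funext => x /=.
by rewrite IH leibniz_gt // D_cst add0r.
Qed.

Lemma leibniz_hol mu a r p i : hol mu a r -> hol (leibniz mu p i) a r.
Proof.
move=> mh; elim: p i => [|p IH] [|i] //= z zr.
- exact: cdiff_cst.
- by apply: cdiffD; [exact: (hol_D (IH 0%N))|exact: cdiff_cst].
- by apply: cdiffD; [exact: (hol_D (IH i.+1))|exact: IH].
Qed.

Lemma D_eq_disc f g a r z : cabs (z - a) < r ->
  (forall w, cabs (w - a) < r -> f w = g w) -> D f z = D g z.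
Proof.
move=> zr fg; apply: (@D_local _ f g z (r - cabs (z - a))); first by rewrite subr_gt0.
by move=> w wz; apply: fg; apply: disc_sub wz; slim_lra.
Qed.

Lemma iterD_eq_disc f g a r z p : cabs (z - a) < r ->
  (forall w, cabs (w - a) < r -> f w = g w) -> iter p (@D R) f z = iter p (@D R) g z.
Proof.
move=> zr fg; apply: (@iter_D_local _ f g z (r - cabs (z - a))); first by rewrite subr_gt0.
by move=> w wz; apply: fg; apply: disc_sub wz; slim_lra.
Qed.

Lemma DM f g z : cdiff f z -> cdiff g z ->
  D (fun w => f w * g w) z = D f z * g z + f z * D g z.
Proof. by move=> /cderP hf /cderP hg; apply: D_eq; exact: cderM. Qed.

Lemma DD f g z : cdiff f z -> cdiff g z ->
  D (fun w => f w + g w) z = D f z + D g z.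
Proof. by move=> /cderP hf /cderP hg; apply: D_eq; exact: cderD. Qed.

Lemma D_sum (I : Type) (s : seq I) (F : I -> C -> C) z : (forall i, cdiff (F i) z) ->
  D (fun w => \sum_(i <- s) F i w) z = \sum_(i <- s) D (F i) z.
Proof.
move=> h; elim: s => [|i s IH].
  by under eq_fun do rewrite big_nil; rewrite big_nil D_cst.
under eq_fun do rewrite big_cons.
by rewrite big_cons DD ?IH //; exact: cdiff_sum.
Qed.

Lemma iterD_leibniz mu f a r p N : hol mu a r -> hol f a r -> (p < N)%N ->
  forall z, cabs (z - a) < r ->
  iter p (@D R) (fun w => mu w * f w) z =
    \sum_(i < N) leibniz mu p i z * iter i (@D R) f z.
Proof.
move=> mh fh; elim: p N => [|p IH] [//|N] pN z zr.
  rewrite big_ord_recl /= big1 ?addr0 // => i _.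
  by rewrite mul0r.
rewrite iterS (D_eq_disc zr (IH N.+1 (ltnW pN))) D_sum; last first.
  by move=> i; apply: cdiffM; [exact: (leibniz_hol _ _ mh zr)|exact: (hol_iterD _ fh zr)].
under eq_bigr => i _ do rewrite (DM (leibniz_hol p i mh zr) (hol_iterD i fh zr)).
rewrite big_split /= big_ord_recr /= [X in _ + X]big_ord_recr /=.
rewrite (leibniz_gt _ (_ : (p < N)%N)) // mul0r addr0 D_cst mul0r addr0.
rewrite [RHS]big_ord_recl /= addr0.
case: N pN => [//|N] pN; rewrite big_ord_recl /= -addrA; congr (_ + _).
rewrite [RHS]big_ord_recr /= leibniz_gt // D_cst add0r.
rewrite [X in _ + X = _]big_ord_recr /= addrA -big_split /=; congr (_ + _).
  by apply: eq_bigr => i _; rewrite mulrDl.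
Qed.

(** By Leibniz' rule the matrix of derivatives is multiplied by a lower triangular matrix with mu on
    the diagonal. *)
Lemma wronskian_scale r (y : 'I_r -> C -> C) mu a d z : hol mu a d ->
  (forall s, hol (y s) a d) -> cabs (z - a) < d ->
  wronskian (fun s w => mu w * y s w) z = mu z ^+ r * wronskian y z.
Proof.
move=> mh yh zd; pose T : 'M[C]_r := \matrix_(p < r, i < r) leibniz mu p i z.
have -> : mu z ^+ r = \det T.
  rewrite det_trig; last by apply/is_trig_mxP => i j ij; rewrite mxE leibniz_gt.
  by under eq_bigr do rewrite mxE leibniz_diag; rewrite prodr_const card_ord.
rewrite -det_mulmx; congr (\det _); apply/matrixP => p s; rewrite !mxE.
rewrite (iterD_leibniz (N := r) mh (yh s)) //.
by apply: eq_bigr => i _; rewrite !mxE.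
Qed.

Lemma hol_wronskian r (y : 'I_r -> C -> C) a d :
  (forall s, hol (y s) a d) -> hol (wronskian y) a d.
Proof.
move=> yh z zd; rewrite /wronskian /determinant.
apply: cdiff_sum => s; apply: cdiffM; first exact: cdiff_cst.
apply: cdiff_prod => i.
under eq_fun do rewrite mxE.
exact: (hol_iterD _ (yh _) zd).
Qed.

(** Divide by y_0 where it does not vanish: the first column becomes (1, 0, ..., 0), so the
    Wronskian of the derivatives of the other quotients vanishes. The induction gives a relation
    between these derivatives; integrated, it is a relation between the functions. *)
Lemma wronskian_indep r (y : 'I_r -> C -> C) a d : 0 < d ->
  (forall s, hol (y s) a d) -> (forall z, cabs (z - a) < d -> wronskian y z = 0) ->
  exists2 c : 'I_r -> C, exists s, c s != 0 &
    forall z, cabs (z - a) < d -> \sum_s c s * y s z = 0.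
Proof.
move=> d0 yh W0.
(* Each division shrinks and moves the disc, so a relation is first sought on some smaller disc; the
   identity theorem extends it to the given one. *)
suff [c c0 [b [e [e0 be h]]]] : exists2 c : 'I_r -> C, exists s, c s != 0 &
    exists b, exists e, [/\ 0 < e, cabs (b - a) + e <= d &
      forall z, cabs (z - b) < e -> \sum_s c s * y s z = 0].
  exists c => // z zd; apply: (hol_identity e0 _ _ h zd); first by slim_lra.
  by move=> w wd; apply: cdiff_sum => s; apply: cdiffM; [exact: cdiff_cst|exact: yh].
elim: r y a d d0 yh W0 => [|r IH] y a d d0 yh W0.
  have := W0 a; rewrite subrr cabs0 => /(_ d0) /eqP.
  by rewrite /wronskian det_mx00 oner_eq0.
have [y00|] := pselect (forall z, cabs (z - a) < d -> y ord0 z = 0).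
  exists (fun s => (s == ord0)%:R); first by exists ord0; rewrite eqxx oner_eq0.
  exists a, d; rewrite subrr cabs0 add0r; split=> // z zd.
  rewrite (bigD1 ord0) //= y00 // mulr0 add0r big1 // => i /negPf ->.
  by rewrite mul0r.
move=> /existsNP[b /not_implyP[bd /eqP yb]].
have ayb : 0 < cabs (y ord0 b) / 2 by rewrite divr_gt0 // cabs_gt0.
have [e' e'0 he'] := cdiff_cont (yh ord0 b bd) ayb.
pose e := Num.min e' (d - cabs (b - a)).
have e0 : 0 < e by rewrite lt_min e'0 subr_gt0.
have be : cabs (b - a) + e <= d.
  have : e <= d - cabs (b - a) by rewrite ge_min lexx orbT.
  by slim_lra.
have ynz z : cabs (z - b) < e -> y ord0 z != 0.
  rewrite lt_min => /andP[/he' h _]; rewrite -cabs_gt0.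
  by have := le_cabsB (y ord0 b) (y ord0 z); rewrite cabsB; slim_lra.
pose mu z := (y ord0 z)^-1.
have yh' s : hol (y s) b e by exact: hol_sub (yh s) be.
have mh : hol mu b e by move=> z ze; apply: cdiffV; [exact: ynz|exact: yh'].
pose u s z := mu z * y s z.
have uh s : hol (u s) b e by move=> z ze; apply: cdiffM; [exact: mh|exact: yh'].
have u0 z : cabs (z - b) < e -> u ord0 z = 1 by move=> ze; rewrite /u /mu mulVf // ynz.
have Wu z : cabs (z - b) < e -> wronskian (fun s => D (u (lift ord0 s))) z = 0.
  move=> ze; have : wronskian u z = 0.
    by rewrite (wronskian_scale mh yh' ze) W0 ?mulr0 //; exact: disc_sub be ze.
  rewrite /wronskian (expand_det_col _ ord0) big_ord_recl big1 ?addr0 => [|i _].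
    rewrite mxE /= u0 // mul1r /cofactor /= addn0 expr0 mul1r => <-.
    congr (\det _); apply/matrixP => p s; rewrite !mxE.
    by rewrite -iterSr.
  rewrite mxE lift0 iterSr (iterD_eq_disc (g := fun=> 0) _ ze) => [|w we].
    have -> : iter i (@D R) (fun=> 0) = (fun=> 0).
      by elim: (nat_of_ord i) => [//|p IHp]; rewrite iterS IHp; apply/funext => x; exact: D_cst.
    by rewrite mul0r.
  by rewrite (D_eq_disc we u0) D_cst.
have [c [s0 cs0] [b' [e1 [e10 be1 hc]]]] := IH _ b e e0 (fun s => hol_D (uh (lift ord0 s))) Wu.
pose S z := \sum_s c s * u (lift ord0 s) z.
have sub z : cabs (z - b') < e1 -> cabs (z - b) < e by exact: disc_sub be1.
have Sh : hol S b' e1.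
  move=> z ze; apply: cdiff_sum => s; apply: cdiffM; first exact: cdiff_cst.
  by apply: uh; exact: sub.
have SD z : cabs (z - b') < e1 -> D S z = 0.
  move=> ze; rewrite -(hc z ze) /S D_sum => [|s]; last first.
    by apply: cdiffM; [exact: cdiff_cst|apply: uh; exact: sub].
  apply: eq_bigr => s _; rewrite DM ?D_cst ?mul0r ?add0r //; first exact: cdiff_cst.
  by apply: uh; exact: sub.
(* The constant of integration, with opposite sign, is the coefficient of y_0. *)
exists (fun s => if unlift ord0 s is Some s' then c s' else - S b').
  by exists (lift ord0 s0); rewrite liftK.
exists b', e1; split=> // [|z ze].
  have := cabs_tri b' b a; slim_lra.
rewrite big_ord_recl unlift_none.
under eq_bigr do rewrite liftK.
have ze' := sub z ze; have yz := ynz z ze'.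
have := D_eq0_cst Sh SD ze; rewrite /S => Sz.
have -> : \sum_(i < r) c i * y (lift ord0 i) z = y ord0 z * S z.
  rewrite /S mulr_sumr; apply: eq_bigr => i _; rewrite /u /mu mulrCA; congr (_ * _).
  by rewrite mulVKf.
by rewrite -/(S z) in Sz; rewrite Sz mulNr mulrC addNr.
Qed.

Lemma det_le r (A : 'M[C]_r) (B : R) : (forall i j, cabs (A i j) <= B) ->
  cabs (\det A) <= r`!%:R * B ^+ r.
Proof.
move=> hA; rewrite /determinant; apply: le_trans (cabs_sum _ _ _) _.
apply: le_trans (_ : \sum_(s : 'S_r) B ^+ r <= _); last first.
  by rewrite sumr_const card_Sn mulr_natl.
apply: ler_sum => s _; rewrite cabsM cabsX cabsN cabs1 expr1n mul1r cabs_prod.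
rewrite -[X in _ <= _ ^+ X](card_ord r) -prodr_const.
by apply: ler_prod => i _; rewrite cabs_ge0 hA.
Qed.

Lemma iterD_lincomb r (c : 'I_r -> C) (y : 'I_r -> C -> C) a d p z :
  (forall s, hol (y s) a d) -> cabs (z - a) < d ->
  iter p (@D R) (fun w => \sum_s c s * y s w) z = \sum_s c s * iter p (@D R) (y s) z.
Proof.
move=> yh; elim: p z => [//|p IH] z zd.
rewrite iterS (D_eq_disc zd IH) D_sum => [|s]; last first.
  by apply: cdiffM; [exact: cdiff_cst|exact: (hol_iterD _ (yh s) zd)].
apply: eq_bigr => s _; rewrite DM ?D_cst ?mul0r ?add0r //; first exact: cdiff_cst.
exact: (hol_iterD _ (yh s) zd).
Qed.

(* Expanding the determinant along a column in which [y s0] is replaced by a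
   combination [g] of the [y s]. *)
Lemma wronskian_le r (y : 'I_r -> C -> C) (c : 'I_r -> C) g a d (B e : R) (s0 : 'I_r) z :
  (forall s, hol (y s) a d) -> cabs (z - a) < d ->
  (forall w, cabs (w - a) < d -> g w = \sum_s c s * y s w) ->
  (forall (s : 'I_r) p, (p < r)%N -> cabs (iter p (@D R) (y s) z) <= B) ->
  (forall p, (p < r)%N -> cabs (iter p (@D R) g z) <= e) ->
  cabs (c s0) * cabs (wronskian y z) <= r%:R * (r.-1)`!%:R * B ^+ r.-1 * e.
Proof.
move=> yh zd gE yB ge; rewrite /wronskian -cabsM.
set A := \matrix_(p, s) _.
have -> : c s0 * \det A = \sum_p (\adj A) s0 p * iter p (@D R) g z.
  have := mul_adj_mx A => /(congr1 (fun X : 'M[C]_r => X *m \col_s c s)).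
  rewrite -mulmxA mul_scalar_mx => /matrixP /(_ s0 0).
  rewrite !mxE mulrC => <-; apply: eq_bigr => p _; congr (_ * _).
  rewrite (iterD_eq_disc p zd gE) (iterD_lincomb _ _ yh zd) mxE.
  by apply: eq_bigr => s _; rewrite !mxE mulrC.
apply: le_trans (cabs_sum _ _ _) _.
have -> : r%:R * (r.-1)`!%:R * B ^+ r.-1 * e = \sum_(p < r) (r.-1)`!%:R * (B ^+ r.-1 * e).
  by rewrite sumr_const card_ord -[RHS]mulr_natl !mulrA.
apply: ler_sum => p _; rewrite cabsM mulrA; apply: ler_pM; rewrite ?cabs_ge0 ?ge //.
rewrite mxE /cofactor cabsM cabsX cabsN cabs1 expr1n mul1r.
by apply: det_le => i j; rewrite !mxE; apply: yB.
Qed.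

End Wronskian.

(** * Entire curves with large contact orders *)

Section Families.
Variable R : realType.
Local Notation C := R[i].
Implicit Types (f g : C -> C) (a b z w x : C) (d K M : R).

Let half : R := 1 / 2.
Let half0 : 0 < half. Proof. by rewrite divr_gt0. Qed.

Lemma chain (P : C -> Prop) d a b : 0 < d ->
  (forall x y, cabs (x - y) < d -> P x -> P y) -> P a -> P b.
Proof.
move=> d0 step Pa; pose N := Num.bound (cabs (b - a) / d).
have hN : cabs (b - a) / d < N%:R by apply: archi_boundP; rewrite divr_ge0 ?cabs_ge0 // ltW.
have N0 : 0 < N%:R :> R by apply: le_lt_trans hN; rewrite divr_ge0 ?cabs_ge0 // ltW.
have NC : N%:R != 0 :> C by rewrite -cabs_gt0 cabs_nat.
pose x k : C := a + k%:R / N%:R * (b - a).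
have main k : P (x k).
  elim: k => [|k IH]; first by rewrite /x mul0r mul0r addr0.
  apply: step IH; rewrite (_ : _ - _ = - ((b - a) / N%:R)); last first.
    by rewrite /x -natr1; field.
  by rewrite cabsN cabsM cabsV cabs_nat ltr_pdivrMr // mulrC -ltr_pdivrMr.
by have := main N; rewrite /x divff // mul1r addrC subrK.
Qed.

(** f has no zero on some small disc, so g vanishes there, and then everywhere by [hol_identity]. *)
Lemma hol_mul_eq0 f g a d : 0 < d -> hol f a d -> hol g a d ->
  (forall z, cabs (z - a) < d -> f z * g z = 0) ->
  (exists2 z, cabs (z - a) < d & f z != 0) -> forall z, cabs (z - a) < d -> g z = 0.
Proof.
move=> d0 fh gh fg [b bd fb].
have fb2 : 0 < cabs (f b) / 2 by rewrite divr_gt0 // cabs_gt0.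
have [e e0 he] := cdiff_cont (fh b bd) fb2.
have m0 : 0 < Num.min e (d - cabs (b - a)) by rewrite lt_min e0 subr_gt0.
apply: (hol_identity m0 bd gh) => z; rewrite lt_min => /andP[/he h zd].
have zd' : cabs (z - a) < d by have := cabs_tri z b a; lra.
have fz : f z != 0.
  by rewrite -cabs_gt0; have := le_cabsB (f b) (f z); rewrite cabsB; move: fb2; lra.
by move/eqP: (fg z zd'); rewrite mulf_eq0 (negPf fz) => /eqP.
Qed.

Lemma hol_exp f a d k : hol f a d -> hol (fun z => f z ^+ k) a d.
Proof. by move=> fh z zd; apply: cdiffX; exact: fh. Qed.

Lemma flat_exp f a l k : (0 < k)%N -> flat f a l -> flat (fun z => f z ^+ k) a l.
Proof.
move=> k0 [d d0 [K hK]]; exists (Num.min d 1); first by rewrite lt_min d0 ltr01.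
exists (`|K| ^+ k) => w; rewrite lt_min => /andP[w0 /andP[wd w1]].
have := hK w; rewrite w0 wd => /(_ isT) h; rewrite cabsX.
apply: le_trans (_ : (`|K| * cabs w ^+ l) ^+ k <= _).
  rewrite lerXn2r ?nnegrE ?mulr_ge0 ?exprn_ge0 ?cabs_ge0 //.
  by apply: le_trans h _; rewrite ler_wpM2r ?exprn_ge0 ?cabs_ge0 // ler_norm.
rewrite exprMn ler_wpM2l ?exprn_ge0 // -exprM.
by apply: ler_wiXn2l; rewrite ?cabs_ge0 ?(ltW w1) // leq_pmulr.
Qed.

(* The identity theorem, carried along a chain of discs D(a, 1/2). *)
Lemma propagate (F : C -> C -> C) :
  (forall a, hol (F a) a half) ->
  (forall a b x, cabs (x - a) < half -> cabs (x - b) < half -> F a x = 0 -> F b x = 0) ->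
  forall a b, (forall x, cabs (x - a) < half -> F a x = 0) ->
  forall x, cabs (x - b) < half -> F b x = 0.
Proof.
move=> Fh Fc a b; apply: (@chain (fun a => forall x, cabs (x - a) < half -> F a x = 0) (half / 2)).
  by rewrite divr_gt0.
move=> x y xy Fx.
have h4 : 0 < half / 2 by rewrite divr_gt0.
have yy : cabs (y - y) < half by rewrite subrr cabs0.
apply: (hol_identity h4 yy (Fh y)) => z zy; apply: (Fc x); last apply: Fx.
- by have := cabs_tri z y x; rewrite (cabsB y x); move: xy zy; lra.
- by move: zy; lra.
- by have := cabs_tri z y x; rewrite (cabsB y x); move: xy zy; lra.
Qed.

Lemma punctured_neq0 f a d : 0 < d -> hol f a d -> (exists2 z, cabs (z - a) < d & f z != 0) ->
  exists2 e, 0 < e <= d & forall z, 0 < cabs (z - a) < e -> f z != 0.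
Proof.
move=> d0 fh fn0; have [k [g gh [ga fE]]] := hol_order d0 fh fn0.
have ga2 : 0 < cabs (g a) / 2 by rewrite divr_gt0 // cabs_gt0.
have [|e e0 he] := cdiff_cont (gh a _) ga2; first by rewrite subrr cabs0.
exists (Num.min e d); first by rewrite lt_min e0 d0 ge_min lexx orbT.
move=> z; rewrite lt_min => /andP[z0 /andP[/he h _]].
rewrite fE mulf_neq0 ?expf_neq0 -?cabs_gt0 //.
by have := le_cabsB (g a) (g z); rewrite cabsB; move: ga2; lra.
Qed.

(* Riemann's theorem and Liouville's theorem for a quotient given locally. *)
Lemma quotient_cst (num den : C -> C -> C) K :
  (forall a, hol (num a) a half) -> (forall a, hol (den a) a half) ->
  (forall a, exists2 z, cabs (z - a) < half & den a z != 0) ->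
  (forall a b x, cabs (x - a) < half -> cabs (x - b) < half ->
     num a x * den b x = num b x * den a x) ->
  (forall a b x, cabs (x - a) < half -> cabs (x - b) < half ->
     den a x != 0 -> den b x != 0) ->
  (forall a x, cabs (x - a) < half -> den a x != 0 ->
     cabs (num a x) <= K * cabs (den a x)) ->
  exists k, forall a x, cabs (x - a) < half -> num a x = k * den a x.
Proof.
move=> nh dh dn0 comp dcomp bnd.
(* [v] is the value at [a] of the holomorphic extension of num / den across [a]. Choosing only this
   value at each point glues the local extensions into one function [e], which near [a] coincides
   with the extension at [a] (see [loc]). *)
pose V a v := exists E : C -> C, exists2 d, 0 < d <= half & [/\ hol E a d, E a = v,
  forall z, cabs (z - a) < d -> num a z = E z * den a z &
  forall z, 0 < cabs (z - a) < d -> den a z != 0].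
have aa a d : 0 < d -> cabs (a - a) < d by rewrite subrr cabs0.
have /choice[e eP] : forall a, exists v, V a v.
  move=> a; have [k [g gh [ga gE]]] := hol_order half0 (dh a) (dn0 a).
  have [d /andP[d0 dhalf] hd] := punctured_neq0 half0 (dh a) (dn0 a).
  have ga2 : 0 < cabs (g a) / 2 by rewrite divr_gt0 // cabs_gt0.
  have [d' d'0 hd'] := cdiff_cont (gh a (aa a _ half0)) ga2.
  have fl : flat (num a) a k.
    exists (Num.min d d'); first by rewrite lt_min d0.
    exists (K * (cabs (g a) + cabs (g a) / 2)) => w.
    rewrite lt_min => /andP[w0 /andP[wd wd']].
    have wa : cabs (a + w - a) = cabs w by rewrite cabs_addK.
    have dn : den a (a + w) != 0 by apply: hd; rewrite wa w0.
    apply: le_trans (bnd a (a + w) _ dn) _; first by rewrite wa; lra.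
    have K0 : 0 <= K.
      have dp : 0 < cabs (den a (a + w)) by rewrite cabs_gt0.
      have := le_trans (cabs_ge0 _) (bnd a (a + w) ltac:(rewrite wa; lra) dn).
      by rewrite pmulr_lge0.
    rewrite gE cabsM cabsX wa -mulrA ler_wpM2l // mulrC.
    apply: ler_wpM2r; first by rewrite exprn_ge0 ?cabs_ge0.
    have := hd' (a + w); rewrite wa => /(_ wd'); have := le_cabsB (g (a + w)) (g a); lra.
  have [h hh hE] := hol_divide half0 (nh a) fl.
  exists (h a / g a), (fun z => h z / g z), (Num.min d d').
    by rewrite lt_min d0 d'0 ge_min dhalf.
  have gn z : cabs (z - a) < Num.min d d' -> g z != 0.
    rewrite lt_min => /andP[_ /hd' hz]; rewrite -cabs_gt0.
    by have := le_cabsB (g a) (g z); rewrite cabsB; lra.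
  split=> //.
  - move=> z zd; have zh : cabs (z - a) < half.
      by move: zd; rewrite lt_min => /andP[zd _]; exact: lt_le_trans zd dhalf.
    by apply: cdiff_div; [exact: gn|exact: hh|exact: gh].
  - by move=> z zd; rewrite hE gE mulrCA divfK // gn.
  - by move=> z; rewrite lt_min => /andP[z0 /andP[zd _]]; apply: hd; rewrite z0.
have eE a z : cabs (z - a) < half -> den a z != 0 -> num a z = e z * den a z.
  move=> zh dz; have [E [d /andP[d0 _] [_ Ez hE _]]] := eP z.
  have dzz : den z z != 0 by exact: (dcomp a z z zh (aa z _ half0) dz).
  have h1 := hE z (aa z _ d0); rewrite Ez in h1.
  apply: (mulIf dzz); rewrite (comp a z z zh (aa z _ half0)) h1; ring.
have loc a : exists2 d, 0 < d & exists2 E : C -> C, hol E a d & forall z, cabs (z - a) < d -> e z = E z.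
  have [E [d /andP[d0 dhalf] [Eh Ea hE hn]]] := eP a.
  exists d => //; exists E => // z zd.
  have [->|za] := eqVneq z a; first by rewrite Ea.
  have dn : den a z != 0 by apply: hn; rewrite zd cabs_gt0 subr_eq0 za.
  by apply: (mulIf dn); rewrite -hE // -eE //; exact: lt_le_trans zd dhalf.
have ed z : cdiff e z.
  have [d d0 [E Eh hE]] := loc z.
  apply: (@cdiff_local _ E e z d d0); [by move=> w /hE ->|exact: Eh (aa z d d0)].
have eK z : cabs (e z) <= K.
  apply/ler_addgt0Pl => r r0; have [d1 d10 h1] := cdiff_cont (ed z) r0.
  have [d2 /andP[d20 d2h] h2] := punctured_neq0 half0 (dh z) (dn0 z).
  pose t := Num.min d1 d2 / 2; have m0 : 0 < Num.min d1 d2 by rewrite lt_min d10.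
  have t0 : 0 < t by rewrite divr_gt0.
  have m1 : Num.min d1 d2 <= d1 by rewrite ge_min lexx.
  have m2 : Num.min d1 d2 <= d2 by rewrite ge_min lexx orbT.
  have t1 : t < d1 by rewrite /t; lra.
  have t2 : t < d2 by rewrite /t; lra.
  pose x := z + t%:C%C; have xz : cabs (x - z) = t by rewrite cabs_addK cabsR gtr0_norm.
  have dn : den z x != 0 by apply: h2; rewrite xz t0.
  have xh : cabs (x - z) < half by rewrite xz; lra.
  have := bnd z x xh dn; rewrite (eE z x xh dn) cabsM ler_pM2r ?cabs_gt0 // => ex.
  have := h1 x; rewrite xz => /(_ t1); have := le_cabsB (e z) (e x); rewrite cabsB; lra.
have cst := liouville ed eK; exists (e 0) => a x xh.
have := @hol_mul_eq0 (den a) (fun z => num a z - e 0 * den a z) a half half0 (dh a).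
move=> h; apply/subr0_eq/h => //.
- move=> z zh; apply: cdiffB; first exact: nh.
  by apply: cdiffM; [exact: cdiff_cst|exact: dh].
- move=> z zh; have [->|dn] := eqVneq (den a z) 0; first by rewrite mul0r.
  by rewrite (eE a z zh dn) (cst 0 z) subrr mulr0.
Qed.

End Families.

(** * General position made quantitative *)

Section GeneralPosition.
Variables (R : realType) (n q : nat).
Local Notation C := R[i].
Variable Q : 'I_q -> mpoly n.+1 C.
Hypothesis Q_gp : general_position Q.

(** The increasing enumeration of [A] supplies the indices j_0 < ... < j_n that the definition asks
    for. *)
Lemma general_position_set (A : {set 'I_q}) (x : 'rV[C]_n.+1) : (n < #|A|)%N ->
  (forall j, j \in A -> peval (Q j) x = 0) -> x = 0.
Proof.
move=> nA h; pose k (a : 'I_n.+1) : 'I_#|A| := widen_ord nA a.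
apply: (@Q_gp (fun a => enum_val (k a))) => [a b ab|a]; last first.
  by apply: h; exact: enum_valP.
have ks : sorted ltn (map val (enum A)).
  rewrite sorted_map /enum_mem; apply: sorted_filter.
    by move=> x' y' z' /=; exact: ltn_trans.
  by rewrite -enumT; have := iota_ltn_sorted 0 q; rewrite -val_enum_ord sorted_map.
have vk c : val (enum_val (k c)) = nth 0%N (map val (enum A)) c.
  rewrite (nth_map (enum_val (k c))); last by rewrite -cardE; exact: (ltn_ord (k c)).
  by rewrite {1}(enum_val_nth (enum_val (k c)) (k c)).
rewrite -[_ (enum_val (k a))]/(val _) -[X in (_ < X)%N]/(val (enum_val (k b))) !vk.
apply: (sorted_ltn_nth ltn_trans 0%N ks) => //; rewrite inE size_map -cardE.
  exact: (ltn_ord (k a)).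
exact: (ltn_ord (k b)).
Qed.

(** Compactness: otherwise vectors with more than n values below 1/(k+1) would have an ultralimit
    killed by more than n of the Q_j. This limit is not 0, as one fixed coordinate equals 1 along
    the ultrafilter. *)
Lemma general_position_compact (B : R) : exists2 r : R, 0 < r & forall x : 'rV[C]_n.+1,
  (forall t, cabs (x 0 t) <= B) -> (exists t, x 0 t = 1) ->
  (#|[set j | (cabs (peval (Q j) x) < r)%R]%SET| <= n)%N.
Proof.
apply: contrapT => nr.
have /choice[u uP] : forall k : nat, exists x : 'rV[C]_n.+1,
    [/\ forall t, cabs (x 0 t) <= B, exists t, x 0 t = 1 &
     (n < #|[set j | (cabs (peval (Q j) x) < k.+1%:R^-1)%R]%SET|)%N].
  move=> k; apply: contrapT => nx; apply: nr; exists k.+1%:R^-1; first by rewrite invr_gt0.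
  by move=> x xB x1; rewrite leqNgt; apply/negP => h; apply: nx; exists x.
have [A hA] : exists A : {set 'I_q}, uf (fun k => A = [set j | (cabs (peval (Q j) (u k)) < k.+1%:R^-1)%R]%SET).
  by apply: uf_fin; apply: uf_all => k; eexists.
have [t0 ht0] : exists t, uf (fun k => u k 0 t = 1).
  by apply: uf_fin; apply: uf_all => k; have [_ [t ut] _] := uP k; exists t.
have /choice[v vP] : forall t, exists v, ucv (fun k => u k 0 t) v.
  by move=> t; apply: (@ucv_ex _ _ B); apply: uf_all => k; have [h _ _] := uP k.
pose x : 'rV[C]_n.+1 := \row_t v t.
have ux t : ucv (fun k => u k 0 t) (x 0 t) by rewrite mxE.
have xt0 : x 0 t0 = 1.
  apply: (ucv_uniq (ux t0)); apply: ucv_eq (ucv_cst 1).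
  by apply: ufW ht0 => k ->.
have nA : (n < #|A|)%N.
  by have [k ->] := uf_ex hA; have [] := uP k.
suff x0 : x = 0 by move: xt0; rewrite x0 mxE => /esym/eqP; rewrite oner_eq0.
apply: (general_position_set nA) => j jA.
apply: ucv_uniq (peval_ucv (Q j) ux) _ => e e0.
have [N hN] : exists N : nat, e^-1 < N%:R.
  by exists (Num.bound e^-1); apply: archi_boundP; rewrite invr_ge0 ltW.
have hbig : uf (fun k => (N <= k)%N) by exact: (@uf_near _ N).
apply: ufW2 hA hbig => k Ak Nk; rewrite subr0.
move: jA; rewrite Ak inE => /ltW /le_trans; apply.
rewrite invf_ple ?posrE ?ltr0n //; apply: ltW (lt_le_trans hN _).
by rewrite ler_nat; exact: leq_trans Nk _.
Qed.

End GeneralPosition.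

Section Preliminaries.
Variable R : realType.
Local Notation C := R[i].
Implicit Types (f g : C -> C) (a b c h w x z : C) (d K M : R).

Lemma iterD_affine f a b d c h p x : hol f b d -> cabs (a + h * x - b) < d ->
  iter p (@D R) (fun y => c * f (a + h * y)) x = c * h ^+ p * iter p (@D R) f (a + h * x).
Proof.
move=> fh; elim: p x => [|p IH] x xd; first by rewrite expr0 mulr1.
have [s s0 hs] : exists2 s, 0 < s & forall y, cabs (y - x) < s -> cabs (a + h * y - b) < d.
  have e0 : 0 < (d - cabs (a + h * x - b)) / 2 by rewrite divr_gt0 // subr_gt0.
  have [s s0 hs] := cdiff_cont (cdiffD (cdiff_cst a x) (cdiffM (cdiff_cst h x) (cdiff_id x))) e0.
  exists s => // y /hs /=; have := cabs_tri (a + h * y) (a + h * x) b ; move: e0; slim_lra.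
have xx : cabs (x - x) < s by rewrite subrr cabs0.
rewrite iterS (D_eq_disc xx (fun y ys => IH y (hs y ys))); apply: D_eq.
have h1 : cder (fun y => a + h * y) x (0 + (0 * x + h * 1)).
  by apply: cderD; [exact: cder_cst|apply: cderM; [exact: cder_cst|exact: cder_id]].
have h2 : cder (iter p (@D R) f) (a + h * x) (iter p.+1 (@D R) f (a + h * x)).
  by apply: cderP; apply: (hol_iterD _ fh).
have -> : c * h ^+ p.+1 * iter p.+1 (@D R) f (a + h * x) =
   c * h ^+ p * (iter p.+1 (@D R) f (a + h * x) * (0 + (0 * x + h * 1))).
  by rewrite exprS; ring.
by apply: cderZ; exact: (cder_comp h1 h2).
Qed.

Lemma wronskian_eq_disc r (y y' : 'I_r -> C -> C) a d z : cabs (z - a) < d ->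
  (forall s w, cabs (w - a) < d -> y s w = y' s w) -> wronskian y z = wronskian y' z.
Proof.
move=> zd yE; rewrite /wronskian; congr (\det _); apply/matrixP => p s; rewrite !mxE.
exact: (iterD_eq_disc _ zd (yE s)).
Qed.

(** Among the spanning subfamilies take one of least size; a nontrivial relation would allow one
    more member to be removed. *)
Lemma spanning_basis (M : nat) (y : 'I_M -> C -> C) a d :
  exists r (u : 'I_r -> 'I_M), [/\ (r <= M)%N,
    forall i, exists c : 'I_r -> C, forall x, cabs (x - a) < d -> y i x = \sum_s c s * y (u s) x &
    forall c : 'I_r -> C, (forall x, cabs (x - a) < d -> \sum_s c s * y (u s) x = 0) ->
      forall s, c s = 0].
Proof.
pose P r := exists u : 'I_r -> 'I_M, forall i, exists c : 'I_r -> C,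
  forall x, cabs (x - a) < d -> y i x = \sum_s c s * y (u s) x.
have exP : exists r, `[<P r>].
  exists M; apply/asboolP; exists id => i; exists (fun s => (s == i)%:R) => x _.
  rewrite (bigD1 i) //= eqxx mul1r big1 ?addr0 // => s /negPf ->; exact: mul0r.
have PM : `[<P M>].
  apply/asboolP; exists id => i; exists (fun s => (s == i)%:R) => x _.
  rewrite (bigD1 i) //= eqxx mul1r big1 ?addr0 // => s /negPf ->; exact: mul0r.
case: (ex_minnP exP) => r /asboolP[u uP] rmin; exists r, u; split=> //; first exact: rmin.
move=> c c0 s; apply: contrapT => /eqP cs.
case: r u uP rmin c c0 s cs => [|r] u uP rmin c c0 s cs; first by case: s cs.
suff : P r by move/asboolP/rmin; rewrite ltnn.
exists (fun t => u (lift s t)) => i; have [k kP] := uP i.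
exists (fun t => k (lift s t) - k s / c s * c (lift s t)) => x xd.
have := c0 x xd; rewrite (kP x xd) !(bigD1_ord s) //= => e.
have -> : y (u s) x = - (c s)^-1 * \sum_(t < r) c (lift s t) * y (u (lift s t)) x.
  by apply: (mulfI cs); apply/subr0_eq; rewrite -[RHS]e; field.
rewrite !mulr_sumr -big_split /=; apply: eq_bigr => t _; field.
exact: cs.
Qed.

Lemma peval_basis n L (P : mpoly n.+1 C) (x : 'rV[C]_n.+1) : P \is ishomog1 L mdeg ->
  let b := [seq s2m t | t : L.-tuple 'I_n.+1 <- enum (mpoly.basis n.+1 L)] in
  peval P x = \sum_(i < size b) mcoeff (tnth (in_tuple b) i) P *
    \prod_(t < n.+1) x 0 t ^+ (tnth (in_tuple b) i) t.
Proof.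
move=> Ph b; rewrite pevalE.
rewrite -(big_tuple _ _ (in_tuple b) xpredT
  (fun m => mcoeff m P * \prod_(t < n.+1) x 0 t ^+ m t)) /=.
rewrite [RHS](bigID (fun m => m \in msupp P)) /= [X in _ = _ + X]big1 ?addr0; last first.
  by move=> m /memN_msupp_eq0 ->; rewrite mul0r.
rewrite -[RHS]big_filter; apply: perm_big; apply: uniq_perm.
- exact: msupp_uniq.
- by rewrite filter_uniq // uniq_basis.
- move=> m; rewrite mem_filter; case mP: (m \in msupp P) => //=.
  by rewrite -basis_cover; apply/esym/eqP; exact: (dhomog_mf Ph mP).
Qed.

(** [S] collects the small factors. One power of w is spent on each of them, the other factors are
    bounded below, and the n - #|S| powers of w left over are at most K each. *)
Lemma weighted_prod_le (I : finType) (X S : {set I}) (n : nat) (g : I -> R) (w K : R) :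
  1 <= K -> 0 <= w -> w <= K -> (forall j, 0 <= g j) ->
  S \subset X -> (#|S| <= n)%N ->
  (forall j, j \in X -> w <= K * g j) -> (forall j, j \in X -> j \notin S -> 1 <= K * g j) ->
  w ^+ n <= K ^+ (#|X| + n) * \prod_(j in X) g j.
Proof.
move=> K1 w0 wK g0 SX Sn h1 h2; have K0 : 0 <= K by slim_lra.
rewrite -(subnKC Sn) exprD.
have s1 : w ^+ #|S| <= \prod_(j in S) (K * g j).
  rewrite -prodr_const; apply: ler_prod => j jS; rewrite w0 h1 //.
  exact: (fintype.subsetP SX _ jS).
have s2 : 1 <= \prod_(j in X :\: S) (K * g j).
  apply: (big_ind (fun u => 1 <= u)) => // [u v|j]; first exact: mulr_ege1.
  by rewrite inE => /andP[jS jX]; exact: h2.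
have s3 : w ^+ (n - #|S|) <= K ^+ n.
  apply: le_trans (_ : K ^+ (n - #|S|) <= _); first by rewrite lerXn2r.
  by apply: ler_weXn2l => //; exact: leq_subr.
have s4 : \prod_(j in X) (K * g j) = \prod_(j in S) (K * g j) * \prod_(j in X :\: S) (K * g j).
  by rewrite (big_setID S) /=; congr (_ * _); rewrite (finset.setIidPr SX).
have -> : K ^+ (#|X| + (#|S| + (n - #|S|))) * \prod_(j in X) g j =
    \prod_(j in X) (K * g j) * K ^+ n.
  by rewrite subnKC // exprD big_split /= prodr_const; ring.
apply: ler_pM; rewrite ?exprn_ge0 // s4.
apply: le_trans s1 _; rewrite ler_peMr // prodr_ge0 // => j _.
by rewrite mulr_ge0.
Qed.

End Preliminaries.

(** * The auxiliary quotient and the constancy of the curve *)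

Section Curve.
Variables (R : realType) (n q : nat) (d : 'I_q -> nat).
Local Notation C := R[i].
Variables (Q : 'I_q -> mpoly n.+1 C) (l : 'I_q -> nat).
Hypothesis Q_hyp : forall j, hypersurface_eq (d j) (Q j).
Hypothesis Q_gp : general_position Q.
Hypothesis l_gt0 : forall j, (0 < l j)%N.

Let half : R := 1 / 2.
Let half0 : 0 < half. Proof. by rewrite divr_gt0. Qed.

Variables (ia : C -> 'I_n.+1) (G : C -> C -> 'rV[C]_n.+1).
Hypothesis Gh : forall a t, hol (fun x => G a x 0 t) a half.
Hypothesis Gb : forall a x t, cabs (x - a) < half -> cabs (G a x 0 t) <= 2.
Hypothesis G1 : forall a x, cabs (x - a) < half -> G a x 0 (ia a) = 1.
Hypothesis Gc : forall a b x, cabs (x - a) < half -> cabs (x - b) < half ->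
  G b x = G b x 0 (ia a) *: G a x.
Hypothesis Gm : forall j a, (exists2 x, cabs (x - a) < half & peval (Q j) (G a x) != 0) ->
  forall x, cabs (x - a) < half -> peval (Q j) (G a x) = 0 ->
  flat (fun z => peval (Q j) (G a z)) x (l j).

Local Notation L := (lS d).
(** With the exponent L / d_j all the Q_j(G)^(e_j) have the same degree L in the lift. *)
Let e j := (L %/ d j)%N.

Let d0 j : (0 < d j)%N. Proof. by have [] := Q_hyp j. Qed.

Let dL j : (d j %| L)%N.
Proof. exact: (@biglcmn_sup _ j). Qed.

Let L0 : (0 < L)%N.
Proof. by rewrite /lS; elim/big_ind: _ => // x y x0 y0; rewrite lcmn_gt0 x0. Qed.

Let e0 j : (0 < e j)%N.
Proof. by rewrite divn_gt0 ?d0 // dvdn_leq. Qed.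

Let Gf j a x : C := peval (Q j) (G a x) ^+ e j.

Let aa (a : C) : cabs (a - a) < half. Proof. by rewrite subrr cabs0. Qed.

Let lam_neq0 a b x : cabs (x - a) < half -> cabs (x - b) < half -> G b x 0 (ia a) != 0.
Proof.
move=> xa xb; apply/eqP => h; have := G1 xb.
by rewrite (Gc xa xb) h scale0r mxE => /esym/eqP; rewrite oner_eq0.
Qed.

Let Gf_hol j a : hol (Gf j a) a half.
Proof. by apply: hol_exp => z zd; apply: peval_cdiff => t; exact: Gh. Qed.

Let peval_scale j (c : C) x : peval (Q j) (c *: x) ^+ e j = c ^+ L * peval (Q j) x ^+ e j.
Proof.
have [_ _ Qh] := Q_hyp j.
by rewrite (peval_homog _ _ Qh) exprMn -exprM mulnC divnK.
Qed.

Let Gf_scale j a b x : cabs (x - a) < half -> cabs (x - b) < half ->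
  Gf j b x = G b x 0 (ia a) ^+ L * Gf j a x.
Proof. by move=> xa xb; rewrite /Gf {1}(Gc xa xb) peval_scale. Qed.

Let bas := [seq s2m t | t : L.-tuple 'I_n.+1 <- enum (mpoly.basis n.+1 L)].
Let M := size bas.
Let y (i : 'I_M) a x : C := \prod_(t < n.+1) G a x 0 t ^+ (tnth (in_tuple bas) i) t.

Let y_hol i a : hol (y i a) a half.
Proof. by move=> z zd; apply: cdiff_prod => t; apply: cdiffX; exact: Gh. Qed.

Let y_scale i a b x : cabs (x - a) < half -> cabs (x - b) < half ->
  y i b x = G b x 0 (ia a) ^+ L * y i a x.
Proof.
move=> xa xb; rewrite /y {1}(Gc xa xb).
under eq_bigr do rewrite mxE exprMn.
rewrite big_split /=; congr (_ * _); rewrite prodrXr; congr (_ ^+ _).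
rewrite -mdegE; apply/eqP; rewrite basis_cover; exact: mem_tnth.
Qed.

Let y_le i a x : cabs (x - a) < half -> cabs (y i a x) <= 2 ^+ L.
Proof.
move=> xa; rewrite cabs_prod.
have <- : (\sum_t (tnth (in_tuple bas) i) t)%N = L.
  by rewrite -mdegE; apply/eqP; rewrite basis_cover; exact: mem_tnth.
rewrite -prodrXr; apply: ler_prod => t _; rewrite cabsX exprn_ge0 ?cabs_ge0 //=.
by rewrite lerXn2r ?nnegrE ?cabs_ge0 // Gb.
Qed.

(** Vanishing identically does not depend on the disc, as it is inherited on overlaps through the
    transition factor. So linear relations and independence of the monomials can be settled on the
    disc around 0 once and for all. *)
Let zero_transfer (F : C -> C -> C) (p : nat) : (forall a b x, cabs (x - a) < half -> cabs (x - b) < half ->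
    F b x = G b x 0 (ia a) ^+ p * F a x) ->
  (forall a, hol (F a) a half) ->
  forall a b, (forall x, cabs (x - a) < half -> F a x = 0) ->
  forall x, cabs (x - b) < half -> F b x = 0.
Proof.
move=> Fs Fh; apply: propagate => // a b x xa xb Fa.
by rewrite (Fs a b) // Fa mulr0.
Qed.

Variables (r : nat) (u : 'I_r -> 'I_M) (Gam : 'I_q -> 'I_r -> C).
Hypothesis rM : (r <= M)%N.
Hypothesis Gam0 : forall j x, cabs x < half -> Gf j 0 x = \sum_s Gam j s * y (u s) 0 x.
Hypothesis ind0 : forall c : 'I_r -> C, (forall x, cabs x < half -> \sum_s c s * y (u s) 0 x = 0) ->
      forall s, c s = 0.

Let lin_hol (c : 'I_r -> C) a : hol (fun x => \sum_s c s * y (u s) a x) a half.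
Proof.
move=> z zd; apply: cdiff_sum => s; apply: cdiffM; [exact: cdiff_cst|exact: y_hol].
Qed.

Let lin_scale (c : 'I_r -> C) a b x : cabs (x - a) < half -> cabs (x - b) < half ->
  \sum_s c s * y (u s) b x = G b x 0 (ia a) ^+ L * \sum_s c s * y (u s) a x.
Proof.
move=> xa xb; rewrite mulr_sumr; apply: eq_bigr => s _.
by rewrite (y_scale (u s) xa xb) mulrCA.
Qed.

Let GamE j a x : cabs (x - a) < half -> Gf j a x = \sum_s Gam j s * y (u s) a x.
Proof.
move=> xa; apply/subr0_eq.
apply: (@zero_transfer (fun a x => Gf j a x - \sum_s Gam j s * y (u s) a x) L _ _ 0 a) => //.
- by move=> a' b x' xa' xb'; rewrite (Gf_scale j xa' xb') (lin_scale _ xa' xb') mulrBr.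
- by move=> a' z zd; apply: cdiffB; [exact: Gf_hol|exact: lin_hol].
- by move=> x'; rewrite subr0 => /Gam0 ->; rewrite subrr.
Qed.

Let indep a (c : 'I_r -> C) : (forall x, cabs (x - a) < half -> \sum_s c s * y (u s) a x = 0) ->
      forall s, c s = 0.
Proof.
move=> h; apply: ind0 => x x0.
apply: (@zero_transfer (fun a x => \sum_s c s * y (u s) a x) L _ _ a 0) => //.
- by move=> a' b x' xa' xb'; exact: lin_scale.
- by rewrite subr0.
Qed.

Let W a := wronskian (fun s => y (u s) a).

Let W_hol a : hol (W a) a half.
Proof. by apply: hol_wronskian => s; exact: y_hol. Qed.

Let W_scale a b x : cabs (x - a) < half -> cabs (x - b) < half ->
  W b x = G b x 0 (ia a) ^+ (L * r) * W a x.
Proof.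
move=> xa xb; pose s := Num.min (half - cabs (x - a)) (half - cabs (x - b)).
have s0 : 0 < s by rewrite lt_min !subr_gt0 xa.
have sa w : cabs (w - x) < s -> cabs (w - a) < half.
  by rewrite lt_min => /andP[h _]; apply: disc_sub h; lra.
have sb w : cabs (w - x) < s -> cabs (w - b) < half.
  by rewrite lt_min => /andP[_ h]; apply: disc_sub h; lra.
have xx : cabs (x - x) < s by rewrite subrr cabs0.
rewrite /W (@wronskian_eq_disc _ _ _ (fun k w => G b w 0 (ia a) ^+ L * y (u k) a w) x s) //; last first.
  by move=> k w ws; apply: y_scale; [exact: sa|exact: sb].
rewrite (@wronskian_scale _ _ _ (fun w => G b w 0 (ia a) ^+ L) x s) ?exprM //.
- by move=> w /sb wb; apply: cdiffX; exact: Gh.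
- by move=> k w /sa wa; exact: y_hol.
Qed.

Let W_neq0 a : exists2 x, cabs (x - a) < half & W a x != 0.
Proof.
apply: contrapT => h.
have [|c [s cs] hc] := wronskian_indep half0 (fun s => y_hol (u s) (a := a)).
  by move=> z zd; apply: contrapT => /eqP Wz; apply: h; exists z.
by move: cs; rewrite (indep hc) eqxx.
Qed.

(** A bound at the centres is enough: a point x of another disc is the centre of its own, and
    [W_scale] compares the two lifts. *)
Let W_bounded : exists2 K, 1 <= K & forall a, cabs (W a a) <= K.
Proof.
have [K1 K11 hK1] := cauchy_iterD_upto R r.
pose B := K1 * 2 ^+ L / half ^+ r.
exists (1 + `|r`!%:R * B ^+ r|) => [|a]; first by rewrite lerDl.
apply: le_trans (_ : r`!%:R * B ^+ r <= _); last by have := ler_norm (r`!%:R * B ^+ r); lra.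
apply: det_le => p s; rewrite mxE.
have yb : bdd (y (u s) a) a half (2 ^+ L) by move=> z zd; exact: y_le.
apply: le_trans (hK1 p (ltnW (ltn_ord p)) _ _ _ _ half0 (y_hol (u s) (a := a)) yb) _.
rewrite ler_wpM2l ?mulr_ge0 ?exprn_ge0 //; first lra.
rewrite lef_pV2 ?posrE ?exprn_gt0 //; apply: ler_wiXn2l; rewrite ?(ltW half0) //.
  by rewrite /half; lra.
exact: ltnW.
Qed.

(** G_j is a combination of the basis, so it can replace a column of the Wronskian. Then |W(a)| is
    bounded by the derivatives of G_j at a of order < r, to which [derivative_order] applies with k
    = r - 1. *)
Let W_order j A : (0 < A)%N -> (l j %| A)%N ->
  (exists2 x, cabs x < half & Gf j 0 x != 0) ->
  exists2 K, 1 <= K & forall a, Gf j a a != 0 ->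
   cabs (W a a) ^+ A <= K * cabs (Gf j a a) ^+ (A - 1 - A %/ l j * r.-1).
Proof.
move=> A0 lA Gj0.
have [s0 Gs0] : exists s, Gam j s != 0.
  apply: contrapT => h; have [x x0 /eqP] := Gj0; apply.
  rewrite Gam0 // big1 // => s _.
  by have [->|h'] := eqVneq (Gam j s) 0; [rewrite mul0r|case: h; exists s].
have [K1 K11 hK1] := cauchy_iterD_upto R r.
have [K2 K20 hK2] := @derivative_order R r.-1 (l j) A (l_gt0 j) A0 lA.
have [M0 M00 hM0] := peval_bounded (Q j) 2.
set E := (A - 1 - _)%N in hK2 *; clearbody E.
pose m := M0 ^+ e j; have m0 : 0 < m by rewrite exprn_gt0.
have Gfb a x : cabs (x - a) < half -> cabs (Gf j a x) <= m.
  move=> xa; rewrite cabsX lerXn2r ?nnegrE ?cabs_ge0 ?(ltW M00) //.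
  by apply: hM0 => t; exact: Gb.
clearbody m; pose B := K1 * 2 ^+ L / half ^+ r.
have B0 : 0 <= B.
  by rewrite divr_ge0 ?mulr_ge0 ?exprn_ge0 ?(ltW half0) //; lra.
pose K3 := (2 ^+ r * m) ^+ A * (K2 / m ^+ E).
pose c1 := r%:R * (r.-1)`!%:R * B ^+ r.-1 / cabs (Gam j s0).
have c10 : 0 <= c1 by rewrite divr_ge0 ?mulr_ge0 ?exprn_ge0 ?cabs_ge0.
exists (1 + c1 ^+ A * K3).
  have m0' := ltW m0; have K20' := ltW K20.
  rewrite lerDl; apply: mulr_ge0; first exact: exprn_ge0.
  apply: mulr_ge0; last by rewrite divr_ge0 ?exprn_ge0.
  by apply/exprn_ge0/mulr_ge0 => //; exact: exprn_ge0.
move=> a Ga0.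
have der p : (p < r)%N -> cabs (iter p (@D R) (Gf j a) a) ^+ A <= K3 * cabs (Gf j a a) ^+ E.
  (* Normalised to the unit disc and the bound 1; the powers of 2 and of m that this costs are
     collected in [K3]. *)
  move=> pr; pose F x := (m%:C)%C^-1 * Gf j a (a + 2^-1 * x).
  have c2 : cabs 2^-1 = half :> R.
    by rewrite cabsV cabs_nat /half mul1r.
  have cm : cabs (m%:C)%C^-1 = m^-1 by rewrite cabsV cabsR gtr0_norm.
  have disc (x : C) s : cabs x < s -> cabs (a + 2^-1 * x - a) < half * s.
    by move=> xs; rewrite cabs_addK cabsM c2 ltr_pM2l.
  have disc1 (x : C) : cabs (x - 0) < 1 -> cabs (a + 2^-1 * x - a) < half.
    by rewrite subr0 => /disc; rewrite mulr1.
  have Fh : hol F 0 1.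
    move=> x /disc1 x1; apply: cdiffM; first exact: cdiff_cst.
    apply: (@cdiff_comp _ (Gf j a) (fun x => a + 2^-1 * x)); last exact: Gf_hol.
    by apply: cdiffD; [exact: cdiff_cst|apply: cdiffM; [exact: cdiff_cst|exact: cdiff_id]].
  have Fb : bdd F 0 1 1.
    move=> x /disc1 x1; rewrite cabsM cm mulrC ler_pdivrMr // mul1r.
    exact: Gfb.
  have mC : (m%:C)%C^-1 != 0 :> C by rewrite -cabs_gt0 cm invr_gt0.
  have F0 : F 0 != 0 by rewrite /F mulr0 addr0 mulf_neq0.
  have Fz b : cabs b < 1 -> F b = 0 -> flat F b (l j).
    move=> b1 /eqP; rewrite /F mulf_eq0 (negPf mC) /= => /eqP Gb0.
    have b1' : cabs (a + 2^-1 * b - a) < half by apply: disc1; rewrite subr0.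
    have [s s0' [K hK]] : flat (Gf j a) (a + 2^-1 * b) (l j).
      apply: flat_exp => //; apply: Gm => //.
        by exists a => //; move: Ga0; rewrite /Gf expf_eq0 e0.
      by move/eqP: Gb0; rewrite /Gf expf_eq0 e0 => /eqP.
    exists s => //; exists (m^-1 * (K * half ^+ l j)) => w /andP[w0 ws].
    have e1 : a + 2^-1 * (b + w) = a + 2^-1 * b + 2^-1 * w by ring.
    have e2 : cabs (2^-1 * w) = half * cabs w by rewrite cabsM c2.
    rewrite e1 cabsM cm -!mulrA ler_wpM2l ?invr_ge0 ?(ltW m0) // -exprMn -e2; apply: hK.
    by rewrite e2 mulr_gt0 //=; move: ws w0; rewrite /half; lra.
  have := hK2 F Fh Fb F0 Fz p; rewrite -ltnS (ltn_predK pr) => /(_ pr).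
  rewrite (@iterD_affine _ (Gf j a) a a half) //; last by apply: disc1; rewrite subrr cabs0.
  rewrite /F mulr0 addr0 !cabsM cm cabsX c2 [in X in _ <= X]exprMn => h.
  have {h} : (m^-1 * half ^+ p) ^+ A * cabs (iter p (@D R) (Gf j a) a) ^+ A <=
      K2 * (m^-1 ^+ E * cabs (Gf j a a) ^+ E) by rewrite -exprMn.
  have mp0 : 0 < m^-1 * half ^+ p by rewrite mulr_gt0 ?invr_gt0 ?exprn_gt0.
  rewrite -ler_pdivlMl ?exprn_gt0 // => h; apply: le_trans h _.
  rewrite (_ : K3 * _ = (2 ^+ r * m) ^+ A * (K2 * (m^-1 ^+ E * cabs (Gf j a a) ^+ E))); last first.
    by rewrite /K3 exprVn; ring.
  rewrite -exprVn; apply: ler_wpM2r.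
    apply: mulr_ge0; first exact: ltW.
    by apply: mulr_ge0; apply: exprn_ge0; rewrite ?cabs_ge0 ?invr_ge0 ?(ltW m0).
  have i0 : 0 <= (m^-1 * half ^+ p)^-1 by rewrite invr_ge0 ltW.
  have j0 : 0 <= 2 ^+ r * m by apply: mulr_ge0; [exact: exprn_ge0|exact: ltW].
  rewrite lerXn2r ?nnegrE // invfM invrK mulrC; apply: ler_wpM2r; first exact: ltW.
  rewrite -exprVn /half mul1r invrK.
  by apply: ler_weXn2l; [lra|exact: ltnW].
have r0 : (0 < r)%N by apply: leq_ltn_trans (ltn_ord s0).
(* [wronskian_le] asks for one bound valid for all orders, hence the order with the largest
   derivative. *)
pose p0 := [arg max_(p > Ordinal r0) cabs (iter p (@D R) (Gf j a) a)]%O.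
have p0P (p : nat) : (p < r)%N -> cabs (iter p (@D R) (Gf j a) a) <= cabs (iter p0 (@D R) (Gf j a) a).
  by rewrite /p0; case: arg_maxP => //= i _ h pr; exact: (h (Ordinal pr)).
have yb s (p : nat) : (p < r)%N -> cabs (iter p (@D R) (y (u s) a) a) <= B.
  move=> pr; have yb : bdd (y (u s) a) a half (2 ^+ L) by move=> z zd; exact: y_le.
  apply: le_trans (hK1 p (ltnW pr) _ _ _ _ half0 (y_hol (u s) (a := a)) yb) _.
  rewrite ler_wpM2l ?mulr_ge0 ?exprn_ge0 //; first lra.
  rewrite lef_pV2 ?posrE ?exprn_gt0 //; apply: ler_wiXn2l; rewrite ?(ltW half0) //.
    by rewrite /half; lra.
  exact: ltnW.
have := @wronskian_le _ r (fun s => y (u s) a) (Gam j) (Gf j a) a half B _ s0 a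
  (fun s => y_hol (u s) (a := a)) (aa a) (GamE j (a := a)) yb p0P.
rewrite -/(W a) -ler_pdivlMl ?cabs_gt0 // => h.
have {}h : cabs (W a a) <= c1 * cabs (iter p0 (@D R) (Gf j a) a).
  by apply: le_trans h _; rewrite le_eqVlt; apply/orP; left; apply/eqP; rewrite /c1; ring.
apply: le_trans (_ : (c1 * cabs (iter p0 (@D R) (Gf j a) a)) ^+ A <= _).
  apply: lerXn2r; rewrite ?nnegrE ?cabs_ge0 //.
  exact: mulr_ge0 c10 (cabs_ge0 _).
rewrite exprMn; apply: le_trans (ler_wpM2l _ (der p0 (ltn_ord p0))) _.
  exact: exprn_ge0.
rewrite mulrA; apply: ler_wpM2r; first by rewrite exprn_ge0 ?cabs_ge0.
by rewrite lerDr.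
Qed.

(** The hypersurfaces that do not contain the curve. Only these may enter the denominator; by
    general position at most n are missing. *)
Let X : {set 'I_q} := [set j | `[< exists2 x, cabs x < half & Gf j 0 x != 0 >]]%SET.

Let X_card : (q - n <= #|X|)%N.
Proof.
rewrite leq_subLR -[X in (X <= _)%N](card_ord q) -(cardsC X) addnC leq_add2r.
rewrite leqNgt; apply/negP => h.
have G00 : G 0 0 = 0.
  apply: (general_position_set Q_gp h) => j; rewrite !inE => /asboolP jX.
  apply: contrapT => /eqP Qj; apply: jX; exists 0; first by rewrite cabs0.
  by rewrite /Gf expf_neq0.
have := G1 (aa 0); rewrite G00 mxE => /esym/eqP; exact/negP/oner_neq0.
Qed.

Let X_neq0 j a : j \in X -> exists2 x, cabs (x - a) < half & Gf j a x != 0.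
Proof.
rewrite inE => /asboolP[x x0 Gx]; apply: contrapT => h.
have Ga0 z : cabs (z - a) < half -> Gf j a z = 0.
  by move=> za; apply: contrapT => /eqP Gz; apply: h; exists z.
have := @zero_transfer (Gf j) L (fun a b x => Gf_scale j (a := a) (b := b) (x := x))
  (Gf_hol j) a 0 Ga0 x.
by rewrite subr0 => /(_ x0) /eqP; rewrite (negPf Gx).
Qed.

Let Lam := (\prod_(j < q) l j)%N.
Hypothesis num_lt : (n * M * Lam + (M - 1) * \sum_(j < q) Lam %/ l j < (q - n) * Lam)%N.
(** Each B_j loses 1 to the eps, in total #|X|. The assumption [num_lt], an inequality between
    integers, leaves a gain of at least 1, which the factor #|X| + 1 makes larger than this loss. *)
Let A := (#|X|.+1 * Lam)%N.
Let B j := (A - 1 - A %/ l j * r.-1)%N.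

Let Lam0 : (0 < Lam)%N. Proof. exact: prodn_gt0. Qed.
Let A0 : (0 < A)%N. Proof. by rewrite muln_gt0. Qed.
Let lLam j : (l j %| Lam)%N.
Proof. by rewrite /Lam (bigD1 j) //= dvdn_mulr. Qed.
Let lA j : (l j %| A)%N. Proof. exact: dvdn_mull. Qed.

Let sumB : (n * A * r < \sum_(j in X) B j)%N.
Proof.
pose S := (\sum_(j < q) Lam %/ l j)%N.
have h1 : (n * r * Lam + r.-1 * S < #|X| * Lam)%N.
  apply: leq_ltn_trans (leq_trans num_lt _).
    by rewrite leq_add // leq_mul // ?leq_mul // -subn1 leq_sub2r.
  by rewrite leq_mul2r X_card orbT.
have h2 : (\sum_(j in X) A <= \sum_(j in X) B j + (#|X| + r.-1 * (#|X|.+1 * S)))%N.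
  apply: leq_trans (_ : \sum_(j in X) (B j + (1 + r.-1 * (#|X|.+1 * (Lam %/ l j)))) <= _)%N.
    apply: leq_sum => j _; rewrite /B {2 3}/A -muln_divA // -/A; lia.
  rewrite big_split leq_add2l big_split /= sum1_card leq_add2l -big_distrr /= leq_mul2l.
  apply/orP; right; rewrite -big_distrr /= leq_mul2l; apply/orP; right.
  by rewrite [leqRHS](bigID (fun j => j \in X)) leq_addr.
rewrite sum_nat_const in h2; move: h1 h2; rewrite /A; set x := #|X|; set T := (\sum_(j in X) _)%N.
clearbody x T S; clear; nia.
Qed.

Let c := (L * (\sum_(j in X) B j - n * A * r))%N.

Let c0 : (0 < c)%N. Proof. by rewrite muln_gt0 L0 subn_gt0 sumB. Qed.

(** W^(A n) has degree L r A n in the lift; a monomial of degree c raises it to the degree N of the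
    denominator. The monomials G_t^c and G_t^(c-1) G_s will both be used: the ratio of the two
    constants is that of the coordinates. *)
Let num s t a x : C := W a x ^+ (A * n) * (G a x 0 t ^+ c.-1 * G a x 0 s).
Let den a x : C := \prod_(j in X) Gf j a x ^+ B j.
Let N := (L * \sum_(j in X) B j)%N.

Let num_scale s t a b x : cabs (x - a) < half -> cabs (x - b) < half ->
  num s t b x = G b x 0 (ia a) ^+ N * num s t a x.
Proof.
move=> xa xb; rewrite /num (W_scale xa xb).
have E k : G b x 0 k = G b x 0 (ia a) * G a x 0 k by rewrite {1}(Gc xa xb) mxE.
rewrite (E t) (E s); set lam := G b x 0 (ia a).
have -> : N = (L * r * (A * n) + c.-1.+1)%N.
  by rewrite (prednK c0) /N /c; have := sumB; nia.
move: (A * n)%N c.-1 => p k; rewrite exprD exprS !exprMn (exprM lam (L * r)).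
move: (W a x ^+ _) (lam ^+ (L * r) ^+ _) (lam ^+ k) (G a x 0 t ^+ k) (G a x 0 s) => w1 w2 w3 w4 w5.
by clearbody lam; clear; ring.
Qed.

Let den_scale a b x : cabs (x - a) < half -> cabs (x - b) < half ->
  den b x = G b x 0 (ia a) ^+ N * den a x.
Proof.
move=> xa xb; rewrite /N big_distrr /= -prodrXr -big_split /=.
by apply: eq_bigr => j _; rewrite (Gf_scale j xa xb) exprMn exprM.
Qed.

Let den_neq0 a : exists2 x, cabs (x - a) < half & den a x != 0.
Proof.
rewrite /den; elim: (index_enum _) => [|j s IH].
  by exists a => //; rewrite big_nil oner_neq0.
have [jX|jX] := boolP (j \in X); last first.
  by have [x xa h] := IH; exists x => //; rewrite big_cons (negPf jX).
apply: contrapT => h; have [x xa /eqP] := IH; apply.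
apply: (@hol_mul_eq0 _ (fun x => Gf j a x ^+ B j)
  (fun x => \prod_(j <- s | j \in X) Gf j a x ^+ B j) a half) => //.
- exact: hol_exp (Gf_hol j (a := a)).
- by move=> z zd; apply: cdiff_prod => i; apply: cdiffX; exact: Gf_hol.
- move=> z zd; apply: contrapT => /eqP hz; apply: h; exists z => //.
  by rewrite big_cons jX.
- by have [z za Gz] := X_neq0 a jX; exists z => //; rewrite expf_neq0.
Qed.

Let num_le s t : exists K, forall a x, cabs (x - a) < half -> den a x != 0 ->
  cabs (num s t a x) <= K * cabs (den a x).
Proof.
have [KW KW1 hKW] := W_bounded.
have [r0 r00 hr0] := general_position_compact Q_gp 2.
have /choice[Kj hKj] : forall j, exists K, 1 <= K /\ (j \in X -> forall a, Gf j a a != 0 ->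
    cabs (W a a) ^+ A <= K * cabs (Gf j a a) ^+ B j).
  move=> j; have [jX|] := boolP (j \in X); last by exists 1.
  have Gj0 : exists2 x, cabs x < half & Gf j 0 x != 0 by move: jX; rewrite inE => /asboolP.
  by have [K K1 hK] := W_order A0 (lA j) Gj0; exists K.
have Kj0 j : 0 <= Kj j by have [h _] := hKj j; exact: le_trans h.
have rj0 j : 0 <= r0^-1 ^+ (e j * B j) by rewrite exprn_ge0 // invr_ge0 ltW.
pose S0 := \sum_j (Kj j + r0^-1 ^+ (e j * B j)).
have S0j j : Kj j + r0^-1 ^+ (e j * B j) <= S0.
  by rewrite /S0 (bigD1 j) //= lerDl sumr_ge0 // => i _; rewrite addr_ge0.
have S00 : 0 <= S0 by rewrite sumr_ge0 // => i _; rewrite addr_ge0.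
have KjS j : Kj j <= S0 by apply: le_trans (S0j j); rewrite lerDl.
have rjS j : r0^-1 ^+ (e j * B j) <= S0 by apply: le_trans (S0j j); rewrite lerDr.
have KW0 : 0 <= KW by exact: le_trans KW1.
have [K [K1 KA KS]] : exists K, [/\ 1 <= K, KW ^+ A <= K & S0 <= K].
  exists (1 + KW ^+ A + S0).
  have v0 := exprn_ge0 A KW0; split; last by rewrite lerDr addr_ge0.
    by rewrite -addrA lerDl addr_ge0.
  by rewrite addrAC lerDr addr_ge0.
have K0 : 0 <= K by exact: le_trans K1.
have center x : den x x != 0 -> cabs (W x x) ^+ (A * n) <= K ^+ (#|X| + n) * cabs (den x x).
  move=> dx; pose S : {set 'I_q} := [set j in X | (cabs (peval (Q j) (G x x)) < r0)%R]%SET.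
  have W0 := cabs_ge0 (W x x).
  have WK : cabs (W x x) ^+ A <= K.
    apply: le_trans (_ : KW ^+ A <= _) => //.
    by rewrite lerXn2r ?nnegrE ?hKW.
  rewrite exprM cabs_prod; under [X in _ <= _ * X]eq_bigr do rewrite cabsX.
  apply: (@weighted_prod_le _ _ X S n (fun j => cabs (Gf j x x) ^+ B j)) => //.
  - exact: exprn_ge0.
  - by move=> j; rewrite exprn_ge0 ?cabs_ge0.
  - by apply/fintype.subsetP => j; rewrite inE => /andP[].
  - apply: leq_trans (hr0 (G x x) _ _); last 2 first.
    + by move=> k; exact: Gb.
    + by exists (ia x); exact: G1.
    by apply: subset_leq_card; apply/fintype.subsetP => j; rewrite !inE => /andP[].
  (* A zero of G_j at the centre is compatible with a nonzero denominator only if B_j = 0, as 0^0 =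
     1. *)
  - move=> j jX; have [Gj0|Gj] := eqVneq (Gf j x x) 0.
      have -> : B j = 0%N.
        apply/eqP; move: dx; rewrite /den (bigD1 j) //= Gj0 mulf_eq0 negb_or => /andP[].
        by rewrite expf_eq0 eqxx andbT -leqNgt leqn0.
      by rewrite expr0 mulr1.
    have [_ h] := hKj j; apply: le_trans (h jX x Gj) _.
    apply: ler_wpM2r; first by rewrite exprn_ge0 ?cabs_ge0.
    exact: le_trans (KjS j) KS.
  - move=> j jX; rewrite inE jX /= -leNgt => hj.
    have h1 : r0 ^+ (e j * B j) <= cabs (Gf j x x) ^+ B j.
      rewrite cabsX -exprM; apply: lerXn2r; rewrite ?nnegrE ?cabs_ge0 //; exact: ltW.
    apply: le_trans (_ : r0^-1 ^+ (e j * B j) * r0 ^+ (e j * B j) <= _).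
      by rewrite -exprMn mulVf ?expr1n // gt_eqF.
    apply: ler_pM => //; first by rewrite exprn_ge0 // ltW.
    exact: le_trans (rjS j) KS.
exists (K ^+ (#|X| + n) * (2 ^+ c.-1 * 2)) => a x xa dx.
(* The estimate at x is made with the lift centred at x; passing to it multiplies numerator and
   denominator by the same lam^N. *)
have xx := aa x; pose lam := G x x 0 (ia a).
have lam0 : 0 < cabs lam by rewrite cabs_gt0; exact: lam_neq0.
rewrite -(ler_pM2l (exprn_gt0 N lam0)) mulrCA -!cabsX -!cabsM.
rewrite -(num_scale s t xa xx) -(den_scale xa xx) /num cabsM cabsX.
have dxx : den x x != 0.
  by rewrite (den_scale xa xx) mulf_neq0 // expf_neq0 //; exact: lam_neq0.
apply: le_trans (ler_pM _ _ (center x dxx) (_ : _ <= 2 ^+ c.-1 * 2)) _; rewrite ?exprn_ge0 ?cabs_ge0 //.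
  rewrite cabsM cabsX; apply: ler_pM; rewrite ?exprn_ge0 ?cabs_ge0 ?Gb //.
  by rewrite lerXn2r ?nnegrE ?cabs_ge0 ?Gb.
by rewrite mulrAC.
Qed.

Let num_cst s t : exists k, forall a x, cabs (x - a) < half -> num s t a x = k * den a x.
Proof.
have [K hK] := num_le s t.
apply: (quotient_cst _ _ den_neq0 _ _ hK).
- move=> a x xa; apply: cdiffM; first by apply: cdiffX; exact: W_hol.
  by apply: cdiffM; [apply: cdiffX|]; exact: Gh.
- by move=> a x xa; apply: cdiff_prod => j; apply: cdiffX; exact: Gf_hol.
- move=> a b x xa xb; rewrite (num_scale s t xa xb) (den_scale xa xb).
  by rewrite mulrCA mulrA.
- move=> a b x xa xb dx; rewrite (den_scale xa xb) mulf_neq0 // expf_neq0 //; exact: lam_neq0.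
Qed.

(** The two constant quotients give kt G_s = ks G_t once the nonzero function W^(A n) G_t^(c-1) is
    cancelled. If G_t vanishes identically both sides are 0; otherwise kt is not 0. Equality of all
    these products says that the projective points at a and b coincide. *)
Lemma curve_constant_of_basis s t a b : G a a 0 s * G b b 0 t = G a a 0 t * G b b 0 s.
Proof.
have [kt hkt] := num_cst t t; have [ks hks] := num_cst s t.
have [Gt|Gt] := pselect (forall x, cabs (x - 0) < half -> G 0 x 0 t = 0).
  have Gt0 z : G z z 0 t = 0.
    apply: (@zero_transfer (fun a x => G a x 0 t) 1 _ (fun a => Gh (a := a) t) 0 z) => //.
    by move=> a' b' x xa xb; rewrite expr1 {1}(Gc xa xb) mxE.
  by rewrite !Gt0 mul0r mulr0.
have Gtn z : exists2 x, cabs (x - z) < half & G z x 0 t != 0.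
  apply: contrapT => h; apply: Gt.
  apply: (@zero_transfer (fun a x => G a x 0 t) 1 _ (fun a => Gh (a := a) t) z 0) => //.
    by move=> a' b' x xa xb; rewrite expr1 {1}(Gc xa xb) mxE.
  by move=> x xz; apply: contrapT => /eqP hx; apply: h; exists x.
have WGn z : exists2 x, cabs (x - z) < half & W z x ^+ (A * n) * G z x 0 t ^+ c.-1 != 0.
  apply: contrapT => h; have [x xz /eqP] := Gtn z.
  suff G0 : forall x, cabs (x - z) < half -> G z x 0 t ^+ c.-1 = 0.
    by apply; have /eqP := G0 x xz; rewrite expf_eq0 => /andP[_ /eqP].
  apply: (@hol_mul_eq0 _ (fun x => W z x ^+ (A * n)) (fun x => G z x 0 t ^+ c.-1) z half half0).
  - by apply: hol_exp; exact: W_hol.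
  - by apply: hol_exp; exact: Gh.
  - by move=> y' yz; apply: contrapT => /eqP hy; apply: h; exists y'.
  - by have [y' yz Wy] := W_neq0 z; exists y' => //; rewrite expf_neq0.
have key z : kt * G z z 0 s = ks * G z z 0 t.
  apply/subr0_eq.
  apply: (@hol_mul_eq0 _ (fun x => W z x ^+ (A * n) * G z x 0 t ^+ c.-1)
    (fun x => kt * G z x 0 s - ks * G z x 0 t) z half half0 _ _ _ (WGn z)) => //.
  - by move=> x xz; apply: cdiffM; apply: cdiffX; [exact: W_hol|exact: Gh].
  - by move=> x xz; apply: cdiffB; apply: cdiffM; try exact: cdiff_cst; exact: Gh.
  - move=> x xz; have := hkt z x xz; have := hks z x xz; rewrite /num.
    move: (W z x ^+ (A * n)) (G z x 0 t ^+ c.-1) (den z x) => w g v e1 e2.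
    rewrite mulrBr (_ : _ * (kt * _) = kt * (w * (g * G z x 0 s))); last by ring.
    rewrite (_ : _ * (ks * _) = ks * (w * (g * G z x 0 t))); last by ring.
    by rewrite e1 e2 mulrCA subrr.
have kt0 : kt != 0.
  apply/eqP => kt0; have [x xz] := Gtn 0; apply/negP; rewrite negbK.
  have := @hol_mul_eq0 _ (fun x => W 0 x ^+ (A * n) * G 0 x 0 t ^+ c.-1) (fun x => G 0 x 0 t)
    0 half half0 _ _ _ (WGn 0).
  move=> h; apply/eqP/h => //.
  - by move=> w wz; apply: cdiffM; apply: cdiffX; [exact: W_hol|exact: Gh].
  - by move=> w wz; have := hkt 0 w wz; rewrite kt0 mul0r /num mulrA.
apply: (mulfI kt0); rewrite mulrA key [RHS]mulrCA key; ring.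
Qed.

End Curve.

Section CurveTheorem.
Variables (R : realType) (n q : nat) (d : 'I_q -> nat).
Local Notation C := R[i].
Variables (Q : 'I_q -> mpoly n.+1 C) (l : 'I_q -> nat).
Let half : R := 1 / 2.

(* The map [x |-> [G a x]] to projective space is given on the disc of radius
   1/2 around each [a] by a lift normalised by its coordinate [ia a]. *)
Theorem curve_constant (ia : C -> 'I_n.+1) (G : C -> C -> 'rV[C]_n.+1) :
  (forall j, hypersurface_eq (d j) (Q j)) -> general_position Q ->
  (forall j, (0 < l j)%N) ->
  let N := 'C(n + lS d, n) in let Lam := (\prod_(j < q) l j)%N in
  (n * N * Lam + (N - 1) * \sum_(j < q) Lam %/ l j < (q - n) * Lam)%N ->
  (forall a t, hol (fun x => G a x 0 t) a half) ->
  (forall a x t, cabs (x - a) < half -> cabs (G a x 0 t) <= 2) ->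
  (forall a x, cabs (x - a) < half -> G a x 0 (ia a) = 1) ->
  (forall a b x, cabs (x - a) < half -> cabs (x - b) < half ->
     G b x = G b x 0 (ia a) *: G a x) ->
  (forall j a, (exists2 x, cabs (x - a) < half & peval (Q j) (G a x) != 0) ->
     forall x, cabs (x - a) < half -> peval (Q j) (G a x) = 0 ->
     flat (fun z => peval (Q j) (G a z)) x (l j)) ->
  forall s t a b, G a a 0 s * G b b 0 t = G a a 0 t * G b b 0 s.
Proof.
move=> Q_hyp Q_gp l0 N Lam num_lt Gh Gb G1 Gc Gm s t a b.
pose bas := [seq s2m t | t : (lS d).-tuple 'I_n.+1 <- enum (mpoly.basis n.+1 (lS d))].
pose y (i : 'I_(size bas)) x : C :=
  \prod_(t < n.+1) G 0 x 0 t ^+ (tnth (in_tuple bas) i) t.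
have [r [u [rM span ind]]] := spanning_basis y 0 half.
have sz : size bas = N by rewrite mpoly.size_basis /N -(bin_sub (leq_addr (lS d) n)) addKn addnC.
have /choice[c hc] : forall i : 'I_(size bas), exists c : 'I_r -> C,
  forall x, cabs x < half -> y i x = \sum_s c s * y (u s) x.
  by move=> i; have [c h] := span i; exists c => x x0; apply: h; rewrite subr0.
pose P j := Q j ^+ (lS d %/ d j).
pose Gam j (s : 'I_r) := \sum_(i < size bas) mcoeff (tnth (in_tuple bas) i) (P j) * c i s.
apply: (@curve_constant_of_basis R n q d Q l Q_hyp Q_gp l0 ia G Gh Gb G1 Gc Gm r u Gam rM _ _ _) => //.
- move=> j x x0; have [dj0 _ Qh] := Q_hyp j.
  have Ph : P j \is ishomog1 (lS d) mdeg.
    have dL : (d j %| lS d)%N by exact: (@biglcmn_sup _ j).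
    by have := dhomogMn (lS d %/ d j) Qh; rewrite mulnC divnK.
  have -> : peval (Q j) (G 0 x) ^+ (lS d %/ d j) = peval (P j) (G 0 x).
    by rewrite /peval /P rmorphXn.
  rewrite (peval_basis _ Ph) /Gam; under [RHS]eq_bigr do rewrite mulr_suml.
  rewrite exchange_big /=; apply: eq_bigr => i _.
  have := hc i x x0; rewrite {1}/y => ->; rewrite mulr_sumr.
  by apply: eq_bigr => k _; rewrite mulrA.
- by move=> k hk; apply: ind => x; rewrite subr0; exact: hk.
- by rewrite sz.
Qed.

End CurveTheorem.

(** * Rescaling *)

Section Sequences.
Variable R : realType.
Local Notation C := R[i].
Implicit Types (f g mu : C -> C) (a b w x z : C) (d r s K M : R).

Lemma ucv_iterD p (fk : nat -> C -> C) f a r M (u : nat -> C) z :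
  uf (fun k => hol (fk k) a r /\ bdd (fk k) a r M) ->
  (forall z, cabs (z - a) < r -> ucv (fun k => fk k z) (f z)) ->
  cabs (z - a) < r -> ucv u z ->
  ucv (fun k => iter p (@D R) (fk k) (u k)) (iter p (@D R) f z).
Proof.
elim: p fk f a r M => [|p IH] fk f a r M hk hf zr hu; first exact: ucv_moving hk hf zr hu.
pose s := r - cabs (z - a); have s0 : 0 < s by rewrite subr_gt0.
have sub : cabs (z - a) + s <= r by rewrite /s; slim_lra.
have {}hk : uf (fun k => hol (fk k) z s /\ bdd (fk k) z s M).
  by apply: ufW hk => k [h1 h2]; split; [exact: hol_sub h1 _|exact: bdd_sub h2 _].
have {}hf x : cabs (x - z) < s -> ucv (fun k => fk k x) (f x).
  by move=> xs; apply: hf; exact: disc_sub sub xs.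
have [fh Df] := hol_limit s0 hk hf.
have hs : s / 2 <= s by slim_lra.
under eq_fun do rewrite iterSr.
rewrite iterSr; apply: (IH _ _ z (s / 2) (16 * M / s)) => //.
- apply: ufW hk => k [h1 h2]; split; last exact: bdd_D.
  by apply: hol_sub (hol_D h1) _; rewrite subrr cabs0 add0r.
- by move=> x xs; apply: Df; slim_lra.
- by rewrite subrr cabs0 divr_gt0.
Qed.

Lemma iterDD f g a d p z : hol f a d -> hol g a d -> cabs (z - a) < d ->
  iter p (@D R) (fun x => f x + g x) z = iter p (@D R) f z + iter p (@D R) g z.
Proof.
move=> fh gh; elim: p z => [//|p IH] z zd.
rewrite iterS (D_eq_disc zd IH) DD //; [exact: hol_iterD fh _ zd|exact: hol_iterD gh _ zd].
Qed.

(** [K] depends on p and on the bound of [mu] on a fixed disc, not on [f] or its radius [d]. This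
    matters in [G_mult], where [mu] changes the normalising coordinate and the radius on which the
    other coordinate is nonzero is not controlled. *)
Lemma iterDM_le p M s : 0 < s -> exists2 K, 0 <= K & forall mu f z d eta,
  hol mu z s -> bdd mu z s M -> 0 < d -> hol f z d ->
  (forall m, (m <= p)%N -> cabs (iter m (@D R) f z) <= eta) ->
  cabs (iter p (@D R) (fun x => mu x * f x) z) <= K * eta.
Proof.
elim: p M s => [|p IH] M s s0.
  exists `|M| => // mu f z d eta mh mM d0 fh h.
  rewrite cabsM; apply: ler_pM; rewrite ?cabs_ge0 ?(h 0%N) //.
  by apply: le_trans (ler_norm M); apply: mM; rewrite subrr cabs0.
have s2 : 0 < s / 2 by rewrite divr_gt0.
have [K1 K10 h1] := IH (16 * M / s) _ s2; have [K2 K20 h2] := IH M _ s0.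
exists (K1 + K2); first exact: addr_ge0.
move=> mu f z d eta mh mM d0 fh h.
pose t := Num.min s d; have t0 : 0 < t by rewrite lt_min s0.
have mt : hol mu z t by move=> x; rewrite lt_min => /andP[/mh].
have ft : hol f z t by move=> x; rewrite lt_min => /andP[_ /fh].
have zz (e : R) : 0 < e -> cabs (z - z) < e by rewrite subrr cabs0.
rewrite iterSr (@iterD_eq_disc _ _ (fun x => D mu x * f x + mu x * D f x) z t) ?zz //; last first.
  by move=> x xt; rewrite DM //; [exact: mt|exact: ft].
rewrite (@iterDD (fun x => D mu x * f x) (fun x => mu x * D f x) z t) ?zz //; last 2 first.
- by move=> x xt; apply: cdiffM; [exact: hol_D mt _ xt|exact: ft].
- by move=> x xt; apply: cdiffM; [exact: mt|exact: hol_D ft _ xt].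
rewrite mulrDl; apply: le_trans (cabsD _ _) _; apply: lerD.
- apply: (h1 _ _ _ d) => //; last by move=> m mp; apply: h; exact: leqW.
    by apply: hol_sub (hol_D mh) _; rewrite subrr cabs0 add0r; slim_lra.
  exact: bdd_D.
- apply: (h2 _ _ _ d) => //; first exact: hol_D.
  by move=> m mp; rewrite -iterSr; exact: h.
Qed.

(** If f_k had no zero near a, [harnack] with e = 1/2 would give |f_k(z)|^2 <= B |f_k(a)|, which
    tends to 0, at a point z where the limit is not 0. The zeros so found lie in a disc in which a
    is the only zero of f, so they tend to a. *)
Lemma hurwitz (fk : nat -> C -> C) f a r M : 0 < r ->
  uf (fun k => hol (fk k) a r /\ bdd (fk k) a r M) ->
  (forall z, cabs (z - a) < r -> ucv (fun k => fk k z) (f z)) ->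
  f a = 0 -> (exists2 z, cabs (z - a) < r & f z != 0) ->
  exists2 u : nat -> C, ucv u a &
    uf (fun k => cabs (u k - a) < r /\ fk k (u k) = 0).
Proof.
move=> r0 hk hf fa fn0; have [fh _] := hol_limit r0 hk hf.
have [s0 /andP[s00 s0r] hs0] := punctured_neq0 r0 fh fn0.
pose s := s0 / 2; have s_gt0 : 0 < s by rewrite divr_gt0.
have ss0 : s < s0 by rewrite /s; slim_lra.
have aa : cabs (a - a) < r by rewrite subrr cabs0.
have zeros : uf (fun k => exists2 z, cabs (z - a) < s & fk k z = 0).
  apply: contrapT => /uf_not nz.
  pose B := `|M| + 1; have B0 : 0 < B by rewrite ltr_wpDl.
  pose z := a + (s / 2 / 8 / 8 / 8)%:C%C.
  have zE : cabs (z - a) = s / 2 / 8 / 8 / 8.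
    by rewrite cabs_addK cabsR gtr0_norm // !divr_gt0.
  have za : 0 < cabs (z - a) < s0 by rewrite zE; apply/andP; split; slim_lra.
  have fz0 : f z != 0 by exact: hs0.
  have key : uf (fun k => cabs (fk k z) ^+ 2 <= B * cabs (fk k a)).
    apply: ufW2 hk nz => k [h1 h2] h3.
    have hB : cabs ((B%:C)%C^-1 : C) = B^-1 by rewrite cabsV cabsR gtr0_norm.
    have BC : (B%:C)%C^-1 != 0 :> C by rewrite -cabs_gt0 hB invr_gt0.
    have n0 x : cabs (x - a) < s -> fk k x != 0.
      by move=> xs; apply/eqP => fx; apply: h3; exists x.
    have := @harnack _ (fun x => (B%:C)%C^-1 * fk k x) a s s_gt0.
    have p1 : hol (fun x => (B%:C)%C^-1 * fk k x) a s.
      by move=> x xs; apply: cdiffM; [exact: cdiff_cst|apply: h1; slim_lra].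
    have p2 x : cabs (x - a) < s -> (B%:C)%C^-1 * fk k x != 0 by move=> /n0 ?; exact: mulf_neq0.
    have p3 : bdd (fun x => (B%:C)%C^-1 * fk k x) a s 1.
      move=> x xs; rewrite cabsM hB mulrC ler_pdivrMr // mul1r.
      apply: le_trans (h2 x _) _; first slim_lra.
      by have := ler_norm M; rewrite /B; slim_lra.
    have p4 : is_true (0 <= (1 / 2 : R) <= 1) by apply/andP; split; slim_lra.
    have p5 : cabs (z - a) <= 1 / 2 * s / 8 / 8 / 8 by rewrite zE; clear; slim_lra.
    move=> /(_ p1 p2 p3 (1 / 2) z p4 p5).
    have fz : fk k z != 0 by apply: n0; rewrite zE; slim_lra.
    have fa' : fk k a != 0 by apply: n0; rewrite subrr cabs0.
    have z0 : 0 < cabs (fk k z) by rewrite cabs_gt0.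
    have a0 : 0 < cabs (fk k a) by rewrite cabs_gt0.
    rewrite !cabsM hB !lnM ?posrE ?invr_gt0 // !lnV ?posrE // => h.
    rewrite -ler_ln ?posrE ?exprn_gt0 ?mulr_gt0 // lnXn // lnM ?posrE //.
    by rewrite -mulr_natl; move: h; slim_lra.
  have /eqP := fz0; apply; apply/ceps_eq0 => e e0.
  have t0 : 0 < e ^+ 2 / B by rewrite divr_gt0 ?exprn_gt0.
  have := hf a aa; rewrite fa => /(_ _ t0) fa0.
  have zr : cabs (z - a) < r by have /andP[_ z2] := za; slim_lra.
  apply: (ucv_le (hf z zr)); apply: ufW2 key fa0 => k h1; rewrite subr0 => h2.
  rewrite -(ler_pXn2r (n := 2)) ?nnegrE ?cabs_ge0 ?(ltW e0) //.
  by apply: le_trans h1 _; rewrite mulrC -ler_pdivlMr.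
have /choice[u hu] : forall k, exists w, (exists2 z, cabs (z - a) < s & fk k z = 0) ->
    cabs (w - a) < s /\ fk k w = 0.
  move=> k; have [[z zs fz]|n] := pselect (exists2 z, cabs (z - a) < s & fk k z = 0).
    by exists z.
  by exists 0.
have {}hu : uf (fun k => cabs (u k - a) < s /\ fk k (u k) = 0).
  by apply: ufW zeros => k /hu.
have [b ub] : exists b, ucv u b.
  apply: (@ucv_ex _ _ (cabs a + s)); apply: ufW hu => k [h _].
  by have := le_cabsB (u k) a; slim_lra.
have bs : cabs (b - a) <= s.
  by apply: (ucv_le (ucvB ub (ucv_cst a))); apply: ufW hu => k [/ltW].
have br : cabs (b - a) < r by slim_lra.
have fb : f b = 0.
  apply: (ucv_uniq (ucv_moving hk hf br ub)); apply: ucv_eq (ucv_cst 0).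
  by apply: ufW hu => k [_ ->].
have ba : b = a.
  apply: contrapT => /eqP nba; have /eqP := fb; apply/negP/hs0.
  by rewrite cabs_gt0 subr_eq0 nba; slim_lra.
exists u; first by rewrite -ba.
by apply: ufW hu => k [h1 h2]; split=> //; slim_lra.
Qed.

End Sequences.

(** * Dominating coordinates and Hofer's selection *)

Section Good.
Variables (R : realType) (n : nat).
Local Notation C := R[i].
Implicit Types (H : C -> 'rV[C]_n.+1) (a b w x z : C) (d r s K M : R).

(** Unchanged when H is multiplied by a nowhere vanishing function, so it concerns the projective
    curve. At a single point the largest coordinate dominates with factor 1; the factor 2 leaves
    room for a neighbourhood. *)
Definition good H a s := exists i, forall x, cabs (x - a) < s ->
  forall t, cabs (H x 0 t) <= 2 * cabs (H x 0 i).

Lemma good_sub H a s b r : cabs (b - a) + r <= s -> good H a s -> good H b r.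
Proof.
by move=> h [i hi]; exists i => x xb; apply: hi; exact: disc_sub xb.
Qed.

Lemma good_local H a : (forall x t, cdiff (fun z => H z 0 t) x) -> H a != 0 ->
  exists2 s, 0 < s & good H a s.
Proof.
move=> Hd Ha.
pose i := [arg max_(i > ord0) cabs (H a 0 i)]%O.
have iP t : cabs (H a 0 t) <= cabs (H a 0 i) by rewrite /i; case: arg_maxP => //= j _ h; exact: h.
have i0 : 0 < cabs (H a 0 i).
  rewrite cabs_gt0; apply/eqP => hi; move/eqP: Ha; apply; apply/rowP => t; rewrite mxE.
  by apply/eqP; rewrite -cabs_eq0 eq_le cabs_ge0 (le_trans (iP t)) // hi cabs0.
have e0 : 0 < cabs (H a 0 i) / 4 by rewrite divr_gt0.
have /choice[s hs] : forall t, exists s, 0 < s /\ forall x, cabs (x - a) < s ->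
    cabs (H x 0 t - H a 0 t) <= cabs (H a 0 i) / 4.
  by move=> t; have [s s0 h] := cdiff_cont (Hd a t) e0; exists s.
pose m := \big[Num.min/1]_t s t.
have m0 : 0 < m by rewrite /m; elim/big_ind: _ => // [x y x0 y0|t _]; [rewrite lt_min x0|case: (hs t)].
exists m => //; exists i => x xm t.
have mt u : m <= s u by exact: bigmin_le_cond.
have [_ h1] := hs t; have [_ h2] := hs i.
have k1 := h1 x (lt_le_trans xm (mt t)); have k2 := h2 x (lt_le_trans xm (mt i)).
have := le_cabsB (H x 0 t) (H a 0 t); have := le_cabsB (H a 0 i) (H x 0 i).
by rewrite [cabs (H a 0 i - _)]cabsB; have := iP t; move: k1 k2; slim_lra.
Qed.

(** A Lebesgue number argument: centres at which the radius 1/(k+1) fails would accumulate at a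
    point, contrary to [good_local] there. *)
Lemma good_uniform H B : (forall x t, cdiff (fun z => H z 0 t) x) -> (forall x, H x != 0) ->
  exists2 s, 0 < s & forall a, cabs a <= B -> good H a s.
Proof.
move=> Hd H0; apply: contrapT => nh.
have /choice[u uP] : forall k : nat, exists a, cabs a <= B /\ ~ good H a k.+1%:R^-1.
  move=> k; apply: contrapT => h; apply: nh; exists k.+1%:R^-1; first by rewrite invr_gt0.
  by move=> a aB; apply: contrapT => ga; apply: h; exists a.
have [a ua] : exists a, ucv u a.
  by apply: (@ucv_ex _ _ B); apply: uf_all => k; have [] := uP k.
have [s s0 gs] := good_local Hd (H0 a).
have s2 : 0 < s / 2 by rewrite divr_gt0.
pose N := Num.bound (s / 2)^-1.
have hbig : uf (fun k => (N <= k)%N) by exact: (@uf_near _ N).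
have [k [h1 Nk]] := uf_ex (ufI (ua _ s2) hbig).
have [_] := uP k; apply; apply: good_sub gs.
suff h3 : k.+1%:R^-1 <= s / 2 by rewrite [leRHS](splitr s) lerD.
rewrite invf_ple ?posrE ?ltr0n //; apply: le_trans (_ : N%:R <= _).
  by apply/ltW/archi_boundP; rewrite invr_ge0 ltW.
by rewrite ler_nat; exact: leqW.
Qed.

(* Hofer's lemma: if it failed, halving the radius could be iterated. *)
Lemma good_selection H r e : (forall x t, cdiff (fun z => H z 0 t) x) -> (forall x, H x != 0) ->
  0 <= r -> 0 < e -> ~ good H 0 e ->
  exists w d, [/\ 0 < d <= e, cabs w <= 2 * r * e, ~ good H w d &
    forall x, cabs (x - w) <= r * d -> good H x (d / 2)].
Proof.
move=> Hd H0 r0 e0 ne; apply: contrapT => nh.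
have main k : exists w, cabs w + 2 * r * (e / 2 ^+ k) <= 2 * r * e /\ ~ good H w (e / 2 ^+ k).
  elim: k => [|k [w [wr nw]]]; first by exists 0; rewrite cabs0 add0r expr0 divr1.
  have p0 : 0 < e / 2 ^+ k by rewrite divr_gt0 // exprn_gt0.
  apply: contrapT => h; apply: nh; exists w, (e / 2 ^+ k); split=> //.
  - by rewrite p0 ler_pdivrMr ?exprn_gt0 // ler_peMr ?(ltW e0) // exprn_ege1 // ler1n.
  - by apply: le_trans wr; rewrite lerDl !mulr_ge0 // ltW.
  - have e2 : e / 2 ^+ k / 2 = e / 2 ^+ k.+1 by rewrite exprSr invfM mulrA.
    move=> x xw; apply: contrapT => nx; apply: h; exists x; split; last by rewrite -e2.
    rewrite -e2; move: wr xw p0; set p := e / _; clearbody p.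
    have := cabs_tri x w 0; rewrite !subr0; nra.
have [s s0 hs] := @good_uniform H (2 * r * e) Hd H0.
have [k ks] := ltr_half_pow e s0; have [w [wr nw]] := main k; apply: nw.
apply: good_sub (hs w _); first by rewrite subrr cabs0 add0r ltW.
by apply: le_trans wr; rewrite lerDl !mulr_ge0 // ltW // divr_gt0 // exprn_gt0.
Qed.

End Good.

(** * The ultralimit of the rescaled curves *)

Section Limit.
Variables (R : realType) (n q : nat) (d : 'I_q -> nat).
Local Notation C := R[i].
Variables (Q : 'I_q -> mpoly n.+1 C) (l : 'I_q -> nat).
Hypothesis Q_hyp : forall j, hypersurface_eq (d j) (Q j).
Hypothesis Q_gp : general_position Q.
Hypothesis l_gt0 : forall j, (0 < l j)%N.
Hypothesis num_lt : let N := 'C(n + lS d, n) in let Lam := (\prod_(j < q) l j)%N in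
  (n * N * Lam + (N - 1) * \sum_(j < q) Lam %/ l j < (q - n) * Lam)%N.

Let half : R := 1 / 2.
Let half0 : 0 < half. Proof. by rewrite divr_gt0. Qed.
Let aa (a : C) : cabs (a - a) < half. Proof. by rewrite subrr cabs0. Qed.

Variable g : nat -> C -> 'rV[C]_n.+1.
Hypothesis gd : forall k x t, cdiff (fun z => g k z 0 t) x.
Hypothesis g_good : forall k x, cabs x <= k%:R -> good (g k) x half.
Hypothesis g_neq0 : forall k x, g k x != 0.
Hypothesis g_mult : forall j (B e : R), 0 < e -> uf (fun k => forall z, cabs z <= B ->
  peval (Q j) (g k z) = 0 -> exists2 i, g k z 0 i != 0 &
    forall p, (p < l j)%N ->
    cabs (iter p (@D R) (fun x => peval (Q j) ((g k x 0 i)^-1 *: g k x)) z) <= e).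

Let dom a i k := forall x, cabs (x - a) < half -> forall t, cabs (g k x 0 t) <= 2 * cabs (g k x 0 i).

Let dom_ex a : exists i, uf (dom a i).
Proof.
apply: uf_fin; apply: (@uf_near _ (Num.bound (cabs a))) => k ak.
have [|i hi] := @g_good k a; last by exists i.
by apply: le_trans (ltW (archi_boundP (cabs_ge0 a))) _; rewrite ler_nat.
Qed.

(** For each disc one dominating coordinate that serves almost all k in the sense of the
    ultrafilter, so that the lifts [h] normalised by it have a limit in k. *)
Let ia a := projT1 (cid (dom_ex a)).
Let iaP a : uf (dom a (ia a)). Proof. exact: projT2 (cid (dom_ex a)). Qed.

Let g_ia a i k x : dom a i k -> cabs (x - a) < half -> g k x 0 i != 0.
Proof.
move=> h xa; apply/eqP => gi; have /eqP := g_neq0 k x; apply; apply/rowP => t; rewrite mxE.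
apply/eqP; rewrite -cabs_eq0 eq_le cabs_ge0 andbT.
by apply: le_trans (h x xa t) _; rewrite gi cabs0 mulr0.
Qed.

Let h a k x : 'rV[C]_n.+1 := (g k x 0 (ia a))^-1 *: g k x.

Let h_hol a k t : dom a (ia a) k -> hol (fun x => h a k x 0 t) a half.
Proof.
move=> ok x xa; under eq_fun do rewrite mxE mulrC.
by apply: cdiff_div; [exact: g_ia ok xa|exact: gd|exact: gd].
Qed.

Let h_le a k t x : dom a (ia a) k -> cabs (x - a) < half -> cabs (h a k x 0 t) <= 2.
Proof.
move=> ok xa; rewrite mxE cabsM cabsV mulrC ler_pdivrMr ?cabs_gt0 ?(g_ia ok xa) //.
exact: ok.
Qed.

Let G_ex a x : exists v : 'rV[C]_n.+1, cabs (x - a) < half ->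
  forall t, ucv (fun k => h a k x 0 t) (v 0 t).
Proof.
have [xa|xa] := pselect (cabs (x - a) < half); last by exists 0.
have /choice[v hv] : forall t, exists v, ucv (fun k => h a k x 0 t) v.
  by move=> t; apply: (@ucv_ex _ _ 2); apply: ufW (iaP a) => k ok; exact: h_le.
by exists (\row_t v t) => _ t; rewrite mxE.
Qed.

Let G a x := projT1 (cid (G_ex a x)).
Let GP a x t : cabs (x - a) < half -> ucv (fun k => h a k x 0 t) (G a x 0 t).
Proof. by move=> xa; exact: projT2 (cid (G_ex a x)) xa t. Qed.

Let h_bdd a t : uf (fun k => hol (fun x => h a k x 0 t) a half /\ bdd (fun x => h a k x 0 t) a half 2).
Proof. by apply: ufW (iaP a) => k ok; split; [exact: h_hol|move=> x; exact: h_le]. Qed.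

Let G_hol a t : hol (fun x => G a x 0 t) a half.
Proof.
have hc x : cabs (x - a) < half -> ucv (fun k => h a k x 0 t) (G a x 0 t) by exact: GP.
by have [] := hol_limit half0 (h_bdd a t) hc.
Qed.

Let G_le a x t : cabs (x - a) < half -> cabs (G a x 0 t) <= 2.
Proof.
by move=> xa; apply: (ucv_le (GP t xa)); apply: ufW (iaP a) => k ok; exact: h_le.
Qed.

Let G_ia a x : cabs (x - a) < half -> G a x 0 (ia a) = 1.
Proof.
move=> xa; apply: (ucv_uniq (GP (ia a) xa)); apply: ucv_eq (ucv_cst 1).
by apply: ufW (iaP a) => k ok; rewrite mxE mulVf // (g_ia ok xa).
Qed.

Let G_lift a b x : cabs (x - a) < half -> cabs (x - b) < half ->
  G b x = G b x 0 (ia a) *: G a x.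
Proof.
move=> xa xb; apply/rowP => t; rewrite mxE.
apply: (ucv_uniq (GP t xb)); apply: ucv_eq (ucvM (GP (ia a) xb) (GP t xa)).
apply: ufW (iaP a) => k ok; rewrite !mxE -mulrA mulVKf ?(g_ia ok xa) //.
Qed.

(** By [hurwitz] a zero x of the limit is a limit of zeros u_k. There the derivatives of order < l_j
    tend to 0, but for a normalising coordinate i that depends on k. Multiplication by the bounded
    factor (h_i)^(d_j) restores the normalisation of G, so these derivatives of the limit vanish at
    x. *)
Let G_mult j a : (exists2 x, cabs (x - a) < half & peval (Q j) (G a x) != 0) ->
  forall x, cabs (x - a) < half -> peval (Q j) (G a x) = 0 ->
  flat (fun z => peval (Q j) (G a z)) x (l j).
Proof.
move=> [y ya Qy] x xa Qx; pose qk k z := peval (Q j) (h a k z).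
pose f z := peval (Q j) (G a z); have [_ _ Qh] := Q_hyp j.
have [M M0 hM] := peval_bounded (Q j) 2.
have qb : uf (fun k => hol (qk k) a half /\ bdd (qk k) a half M).
  apply: ufW (iaP a) => k ok; split.
    by move=> z za; apply: peval_cdiff => t; exact: h_hol.
  by move=> z za; apply: hM => t; exact: h_le.
have qf z : cabs (z - a) < half -> ucv (fun k => qk k z) (f z).
  by move=> za; apply: peval_ucv => t; exact: GP.
have [fh _] := hol_limit half0 qb qf.
pose r := half - cabs (x - a); have r0 : 0 < r by rewrite subr_gt0.
have sub : cabs (x - a) + r <= half by rewrite /r addrC subrK.
have [u ux hu] : exists2 u, ucv u x & uf (fun k => cabs (u k - x) < r /\ qk k (u k) = 0).
  apply: (@hurwitz _ qk f x r M) => //.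
  - by apply: ufW qb => k [q1 q2]; split; [exact: hol_sub q1 sub|exact: bdd_sub q2 sub].
  - by move=> z zx; apply: qf; exact: disc_sub sub zx.
  - apply: contrapT => hn; have /eqP := Qy; apply.
    apply: (hol_identity r0 xa fh) ya => z zx; apply: contrapT => /eqP fz.
    by apply: hn; exists z.
have Dq p : (p < l j)%N -> iter p (@D R) f x = 0.
  move=> pl; apply/ceps_eq0 => e e0.
  have r2 : 0 < r / 2 by rewrite divr_gt0.
  have [K K0 hK] := iterDM_le p (2 ^+ d j) r2.
  have eK : 0 < e / (K + 1) by rewrite divr_gt0 // ltr_wpDl.
  have B := g_mult j (cabs x + r) eK.
  apply: (ucv_le (ucv_iterD p qb qf xa ux)).
  apply: ufW2 (ufI (iaP a) hu) (ufI B (ux _ r2)) => k [ok [ur qu]] [mult ur2].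
  set z := u k in ur qu ur2 *.
  have za : cabs (z - a) < half by exact: disc_sub sub ur.
  have gz := g_ia ok za.
  have zB : cabs z <= cabs x + r by have := le_cabsB z x; lra.
  have Qz : peval (Q j) (g k z) = 0.
    move: qu; rewrite /qk /h (peval_homog _ _ Qh) => /eqP; rewrite mulf_eq0 expf_eq0 invr_eq0.
    by rewrite (negPf gz) andbF => /eqP.
  have [i gi hi] := mult z zB Qz.
  have g4 : 0 < cabs (g k z 0 i) / 2 by rewrite divr_gt0 // cabs_gt0.
  have [s1 s10 hs1] := cdiff_cont (gd k z i) g4.
  pose s := Num.min s1 (r / 2); have s0 : 0 < s by rewrite lt_min s10.
  have gis w : cabs (w - z) < s -> g k w 0 i != 0.
    rewrite lt_min => /andP[/hs1 hw _]; rewrite -cabs_gt0.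
    by have := le_cabsB (g k z 0 i) (g k w 0 i); rewrite cabsB; move: g4; lra.
  have sa w : cabs (w - z) < r / 2 -> cabs (w - a) < half.
    move=> wz; apply: disc_sub sub _; have := cabs_tri w z x; lra.
  pose F w := peval (Q j) ((g k w 0 i)^-1 *: g k w).
  pose mu w := h a k w 0 i ^+ d j.
  have E w : cabs (w - z) < s -> qk k w = mu w * F w.
    move=> ws; rewrite /qk /F /mu -(peval_homog _ _ Qh) scalerA mxE.
    by rewrite -mulrA mulfV ?mulr1 // gis.
  rewrite (@iter_D_local _ _ (fun w => mu w * F w) z s) //.
  apply: le_trans (hK mu F z s (e / (K + 1)) _ _ s0 _ _) _.
  - by move=> w /sa wa; apply: cdiffX; exact: h_hol.
  - move=> w /sa wa; rewrite cabsX lerXn2r ?nnegrE ?cabs_ge0 //; exact: h_le.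
  - move=> w /gis wz; apply: peval_cdiff => t; under eq_fun do rewrite mxE mulrC.
    by apply: cdiff_div.
  - by move=> m mp; apply: hi; exact: leq_ltn_trans pl.
  rewrite mulrA ler_pdivrMr; last by rewrite ltr_wpDl.
  by rewrite mulrC ler_wpM2l ?(ltW e0) // lerDl.
have := taylor_iterD (l j) r0 (hol_sub fh sub).
rewrite (_ : (fun z => _) = f) //; apply/funext => z.
by rewrite big1 ?subr0 // => p _; rewrite Dq // !mul0r.
Qed.

(** By [curve_constant] the limit is one projective point v. If its largest coordinate i failed to
    dominate on the unit disc, the points of failure would tend to some a with 2 |G_i(a)| <=
    |G_t(a)|, while |v_t| <= |v_i| and v_i is not 0. *)
Lemma good_limit : uf (fun k => good (g k) 0 1).
Proof.
have cst := curve_constant Q_hyp Q_gp l_gt0 num_lt G_hol G_le G_ia G_lift G_mult.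
pose v := G 0 0.
pose i := [arg max_(i > ord0) cabs (v 0 i)]%O.
have iP t : cabs (v 0 t) <= cabs (v 0 i) by rewrite /i; case: arg_maxP => //= j _ hj; exact: hj.
have vi : 0 < cabs (v 0 i).
  by apply: lt_le_trans (iP (ia 0)); rewrite /v (G_ia (aa 0)) cabs1.
apply: contrapT => /uf_not ng.
have {}ng : uf (fun k => exists t, exists x, cabs x < 1 /\ 2 * cabs (g k x 0 i) < cabs (g k x 0 t)).
  apply: ufW ng => k nk; apply: contrapT => nt; apply: nk; exists i => x; rewrite subr0 => x1 t.
  by rewrite leNgt; apply/negP => lt; apply: nt; exists t, x.
have [t ht] := uf_fin ng.
have /choice[u hu] : forall k, exists w, (exists x, cabs x < 1 /\ 2 * cabs (g k x 0 i) < cabs (g k x 0 t)) ->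
    cabs w < 1 /\ 2 * cabs (g k w 0 i) < cabs (g k w 0 t).
  move=> k; have [[x hx]|nx] := pselect (exists x, cabs x < 1 /\ 2 * cabs (g k x 0 i) < cabs (g k x 0 t)).
    by exists x.
  by exists 0.
have {ht}hu : uf (fun k => cabs (u k) < 1 /\ 2 * cabs (g k (u k) 0 i) < cabs (g k (u k) 0 t)).
  by apply: ufW ht => k; exact: hu.
have [a ua] : exists a, ucv u a.
  by apply: (@ucv_ex _ _ 1); apply: ufW hu => k [/ltW].
have lim s : ucv (fun k => h a k (u k) 0 s) (G a a 0 s).
  have hc x : cabs (x - a) < half -> ucv (fun k => h a k x 0 s) (G a x 0 s) by exact: GP.
  exact: (ucv_moving (h_bdd a s) hc (aa a) ua).
have le_ti : 2 * cabs (G a a 0 i) <= cabs (G a a 0 t).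
  apply/ler_addgt0Pl => e e0; have e4 : 0 < e / 4 by rewrite divr_gt0.
  have h4 : 0 < half / 2 by rewrite divr_gt0.
  have [k [[[u1 u2] [l1 l2]] [ok ha]]] := uf_ex (ufI (ufI hu (ufI (lim i _ e4) (lim t _ e4))) (ufI (iaP a) (ua _ h4))).
  have uk : cabs (u k - a) < half by move: ha half0; lra.
  have gk : 0 < cabs (g k (u k) 0 (ia a)) by rewrite cabs_gt0 (g_ia ok uk).
  have : 2 * cabs (h a k (u k) 0 i) <= cabs (h a k (u k) 0 t).
    by rewrite !mxE !cabsM cabsV mulrCA ler_pM2l ?invr_gt0 // ltW.
  have := le_cabsB (G a a 0 i) (h a k (u k) 0 i); have := le_cabsB (h a k (u k) 0 t) (G a a 0 t).
  by rewrite [cabs (G a a 0 i - _)]cabsB; move: l1 l2; lra.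
have e1 := cst t i a 0; have e2 := cst (ia a) i a 0.
rewrite (G_ia (aa a)) mul1r -/v in e2; rewrite -/v in e1.
have Gi : 0 < cabs (G a a 0 i).
  rewrite cabs_gt0; apply/eqP => Gi; move: e2 vi; rewrite Gi mul0r => ->.
  by rewrite cabs0 ltxx.
move/(congr1 (@cabs R)): e1; rewrite !cabsM => e1.
have := iP t; have h1 : cabs (G a a 0 t) * cabs (v 0 i) <= cabs (G a a 0 i) * cabs (v 0 i).
  by rewrite e1 ler_wpM2l // ltW.
by move: h1; rewrite ler_pM2r //; move: le_ti Gi; lra.
Qed.

End Limit.

Section NormalFamily.
Variables (R : realType) (n q : nat) (d : 'I_q -> nat).
Local Notation C := R[i].
Variables (Q : 'I_q -> mpoly n.+1 C) (l : 'I_q -> nat).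

Theorem normal_family (T : Type) (H : T -> C -> 'rV[C]_n.+1) :
  (forall j, hypersurface_eq (d j) (Q j)) -> general_position Q ->
  (forall j, (0 < l j)%N) ->
  let N := 'C(n + lS d, n) in let Lam := (\prod_(j < q) l j)%N in
  (n * N * Lam + (N - 1) * \sum_(j < q) Lam %/ l j < (q - n) * Lam)%N ->
  (forall k x t, cdiff (fun z => H k z 0 t) x) -> (forall k x, H k x != 0) ->
  (forall j, exists K : R, forall k z, cabs z < 1 -> peval (Q j) (H k z) = 0 ->
     exists2 i, H k z 0 i != 0 & forall p, (0 < p < l j)%N ->
     cabs (iter p (@D R) (fun x => peval (Q j) ((H k x 0 i)^-1 *: H k x)) z) <= K) ->
  exists2 s : R, 0 < s & forall k, good (H k) 0 s.
Proof.
move=> Q_hyp Q_gp l0 N Lam num_lt Hd H0 Hm; apply: contrapT => nh.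
(* Hofer's selection is made with r = k and radius 1/(4k+1): the new centres stay within 2k/(4k+1)
   <= 1/2, well inside the unit disc where the derivatives are controlled, while the radii tend to
   0. *)
have /choice[tau htau] : forall k : nat, exists u, ~ good (H u) 0 (4 * k).+1%:R^-1.
  move=> k; apply: contrapT => h; apply: nh; exists (4 * k).+1%:R^-1; first by rewrite invr_gt0.
  by move=> u; apply: contrapT => gu; apply: h; exists u.
have /choice[wd hwd] : forall k : nat, exists wd : C * R,
    [/\ 0 < wd.2 <= (4 * k).+1%:R^-1, cabs wd.1 <= 1 / 2, ~ good (H (tau k)) wd.1 wd.2 &
    forall x, cabs (x - wd.1) <= k%:R * wd.2 -> good (H (tau k)) x (wd.2 / 2)].
  move=> k; have e0 : 0 < (4 * k).+1%:R^-1 :> R by rewrite invr_gt0.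
  have [w [s [s0 ws ng gs]]] := good_selection (Hd (tau k)) (H0 (tau k)) (ler0n R k) e0 (@htau k).
  exists (w, s); split=> //=; apply: le_trans ws _.
  rewrite ler_pdivrMr ?ltr0n // (_ : (4 * k).+1%:R = 4 * k%:R + 1 :> R); last first.
    by rewrite -natr1 natrM.
  by have := ler0n R k; slim_lra.
pose w k := (wd k).1; pose s k := (wd k).2.
pose g k x := H (tau k) (w k + (s k)%:C%C * x).
have s0 k : 0 < s k by have [/andP[]] := hwd k.
have sk k : s k <= (4 * k).+1%:R^-1 by have [/andP[]] := hwd k.
have sE k : cabs ((s k)%:C%C : C) = s k by rewrite cabsR gtr0_norm.
have s1 k : s k <= 1.
  by apply: le_trans (sk k) _; rewrite invf_ple ?posrE ?ltr0n // invr1 ler1n.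
have small e : 0 < e -> uf (fun k => s k <= e).
  move=> e0; apply: (@uf_near _ (Num.bound e^-1)) => k ek.
  apply: le_trans (sk k) _; rewrite invf_ple ?posrE ?ltr0n //.
  apply: le_trans (ltW (archi_boundP _)) _; first by rewrite invr_ge0 ltW.
  by rewrite ler_nat; apply: leqW; apply: leq_trans ek (leq_pmull _ _).
have affine k (x : C) : cdiff (fun x => w k + (s k)%:C%C * x) x.
  by apply: cdiffD; [exact: cdiff_cst|apply: cdiffM; [exact: cdiff_cst|exact: cdiff_id]].
have gd k x t : cdiff (fun z => g k z 0 t) x.
  by apply: (@cdiff_comp _ (fun z => H (tau k) z 0 t)); [exact: affine|exact: Hd].
have g_good k x : cabs x <= k%:R -> good (g k) x (1 / 2).
  move=> xk; have [_ _ _ /(_ (w k + (s k)%:C%C * x))] := hwd k.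
  rewrite -/(w k) -/(s k) cabs_addK cabsM sE mulrC ler_pM2r // => /(_ xk) [i hi].
  exists i => z zx t; apply: hi.
  rewrite (_ : _ - _ = (s k)%:C%C * (z - x)); last by ring.
  by rewrite cabsM sE ltr_pM2l //; move: zx; rewrite div1r.
have ng k : ~ good (g k) 0 1.
  have [_ _ h _] := hwd k => -[i hi]; apply: h; exists i => x xw t.
  have sC : (s k)%:C%C != 0 :> C by rewrite -cabs_gt0 sE.
  have := hi ((x - w k) / (s k)%:C%C); rewrite subr0 cabsM cabsV sE ltr_pdivrMr // mul1r.
  by move=> /(_ xw t); rewrite /g mulrC divfK // addrC subrK.
have g_mult j (B e : R) : 0 < e -> uf (fun k => forall z, cabs z <= B ->
  peval (Q j) (g k z) = 0 -> exists2 i, g k z 0 i != 0 &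
    forall p, (p < l j)%N ->
    cabs (iter p (@D R) (fun x => peval (Q j) ((g k x 0 i)^-1 *: g k x)) z) <= e).
  move=> e0; have [K hK] := Hm j; have [_ _ Qh] := Q_hyp j.
  have B0 : 0 < (4 * (`|B| + 1))^-1 by rewrite invr_gt0 mulr_gt0 // ltr_wpDl.
  have eK0 : 0 < e / (`|K| + 1) by rewrite divr_gt0 // ltr_wpDl.
  apply: ufW2 (small _ B0) (small _ eK0) => k sB seK z zB Qz.
  have w2 : cabs (w k) <= 1 / 2 by have [_] := hwd k.
  have z1 : cabs (w k + (s k)%:C%C * z) < 1.
    apply: le_lt_trans (cabsD _ _) _; rewrite cabsM sE.
    have : s k * cabs z <= (4 * (`|B| + 1))^-1 * (`|B| + 1).
      apply: ler_pM; rewrite ?(ltW (s0 k)) ?cabs_ge0 //.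
      by apply: le_trans zB _; have := ler_norm B; slim_lra.
    rewrite (_ : _^-1 * _ = 1 / 4); first by move: w2; slim_lra.
    by field; rewrite gt_eqF // ltr_wpDl.
  have [i gi hi] := hK (tau k) _ z1 Qz; exists i => // p pl.
  have [->|p0] := posnP p.
    by rewrite /= (peval_homog _ _ Qh) Qz mulr0 cabs0 ltW.
  pose f x := peval (Q j) ((H (tau k) x 0 i)^-1 *: H (tau k) x).
  have g4 : 0 < cabs (H (tau k) (w k + (s k)%:C%C * z) 0 i) / 2 by rewrite divr_gt0 // cabs_gt0.
  have [r r0 hr] := cdiff_cont (Hd (tau k) (w k + (s k)%:C%C * z) i) g4.
  have fh : hol f (w k + (s k)%:C%C * z) r.
    move=> x /hr hx; apply: peval_cdiff => t; under eq_fun do rewrite mxE mulrC.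
    apply: cdiff_div => //; rewrite -cabs_gt0; move: hx g4.
    have := le_cabsB (H (tau k) (w k + (s k)%:C%C * z) 0 i) (H (tau k) x 0 i).
    by rewrite cabsB; slim_lra.
  have := @iterD_affine R f (w k) _ r 1 (s k)%:C%C p z fh.
  rewrite subrr cabs0 => /(_ r0); under eq_fun do rewrite mul1r.
  rewrite mul1r => E; rewrite [iter p _ _ _]E cabsM cabsX sE.
  have h1 := hi p; rewrite p0 pl in h1; have {}h1 := h1 isT.
  (* A derivative of order p >= 1 gains the factor s^p <= s, which tends to 0: so bounded
     derivatives become small. *)
  have s2 : s k ^+ p <= s k by rewrite -[leRHS]expr1; apply: ler_wiXn2l; rewrite ?(ltW (s0 k)).
  apply: le_trans (_ : s k * (`|K| + 1) <= _); last by rewrite -ler_pdivlMr // ltr_wpDl.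
  apply: ler_pM => //; rewrite ?exprn_ge0 ?cabs_ge0 ?(ltW (s0 k)) //.
  by apply: le_trans h1 _; have := ler_norm K; slim_lra.
have g0 k x : g k x != 0 by exact: H0.
by have [k] := uf_ex (good_limit Q_hyp Q_gp l0 num_lt gd g_good g0 g_mult); exact: ng.
Qed.

End NormalFamily.

(** * Reduction to normal families of slices *)

Section Numerics.
Variables (R : realType) (n q : nat) (d : 'I_q -> nat) (l : 'I_q -> option nat).

(** Put Y = q - n - n (N0 + 1), which is at least 1 by the bound on q. For N0 > 0 the assumption
    reads N0 (N0 + 2) s < Y + N0 + 1, and Y + N0 + 1 <= Y (N0 + 2), so N0 s < Y. This strict
    inequality allows infinite l_j to be replaced by a large T; multiplied by the product of the
    multiplicities it is the condition of [curve_constant]. *)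
Lemma finite_multiplicities : (n * nS n d + 2 * n + 1 <= q)%N ->
  (forall j, le_mult 1 (l j)) ->
  \sum_(j < q) inv_mult R (l j) <
      (q%:R - n%:R - (n%:R - 1) * ((nS n d)%:R + 1))
        / ((nS n d)%:R * ((nS n d)%:R + 2)) ->
  exists l' : 'I_q -> nat, [/\ forall j, (0 < l' j)%N,
    forall j, l j <> None -> l j = Some (l' j) &
    let N := 'C(n + lS d, n) in let Lam := (\prod_(j < q) l' j)%N in
    (n * N * Lam + (N - 1) * \sum_(j < q) Lam %/ l' j < (q - n) * Lam)%N].
Proof.
move=> q_ge l_ge1; set N0 := nS n d in q_ge *; set s := \sum_(j < q) inv_mult R (l j) => l_sum.
have NE : 'C(n + lS d, n) = N0.+1 by rewrite /N0 /nS subn1 prednK // bin_gt0 leq_addr.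
clearbody N0; pose Y : R := q%:R - n%:R - n%:R * (N0%:R + 1).
have Y1 : 1 <= Y.
  have : (n * N0 + 2 * n + 1)%:R <= q%:R :> R by rewrite ler_nat.
  by rewrite /Y !natrD !natrM => h; slim_lra.
have N00 : 0 <= N0%:R :> R by [].
have sY : N0%:R * s < Y.
  have [N0z|N0p] := posnP N0; first by rewrite N0z mul0r; slim_lra.
  have Np : 0 < N0%:R :> R by rewrite ltr0n.
  have Np2 : 0 < N0%:R * (N0%:R + 2) :> R by rewrite mulr_gt0 // ltr_wpDl.
  move: l_sum; rewrite ltr_pdivlMr // (_ : q%:R - _ - _ = Y + N0%:R + 1); last by rewrite /Y; ring.
  move: (N0%:R : R) Np N00 Y Y1 {Np2} => N Np N00' Y' Y1' h.
  have h2 : N * s * (N + 2) < Y' + N + 1 by move: h; rewrite mulrA [s * N]mulrC.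
  have h3 : Y' + N + 1 <= Y' * (N + 2) by nra.
  by rewrite -(ltr_pM2r (_ : 0 < N + 2)) ?(lt_le_trans h2 h3) //; slim_lra.
have e0 : 0 < Y - N0%:R * s by rewrite subr_gt0.
(* Large enough that the at most q terms 1/T stay within the gap: N0 q / T < Y - N0 s. *)
pose T := (Num.bound (N0%:R * q%:R / (Y - N0%:R * s))).+1.
have hT : N0%:R * q%:R / (Y - N0%:R * s) < T%:R.
  apply: lt_le_trans (archi_boundP _) _; first by rewrite divr_ge0 ?mulr_ge0 ?ler0n // ltW.
  by rewrite ler_nat.
pose l' j := if l j is Some x then x else T.
have l'0 j : (0 < l' j)%N by rewrite /l'; have := l_ge1 j; case: (l j).
exists l'; split=> // [j|].
  by rewrite /l'; case: (l j).
cbv zeta; rewrite NE subn1 /=; set Lam := (\prod_(j < q) l' j)%N.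
have Lam0 : 0 < Lam%:R :> R by rewrite ltr0n prodn_gt0.
have T0 : 0 < T%:R :> R by rewrite ltr0n.
have s' : \sum_(j < q) (l' j)%:R^-1 <= s + q%:R / T%:R.
  rewrite (_ : q%:R / _ = \sum_(j < q) T%:R^-1); last by rewrite sumr_const card_ord -[RHS]mulr_natl.
  rewrite -big_split; apply: ler_sum => j _; rewrite /l'; case: (l j) => [x|] /=.
    by rewrite lerDl invr_ge0 ler0n.
  by rewrite add0r.
rewrite -(ltr_nat R) natrD !natrM natrB; last by move: q_ge; lia.
have -> : (\sum_(j < q) Lam %/ l' j)%:R = Lam%:R * \sum_(j < q) (l' j)%:R^-1 :> R.
  rewrite natr_sum mulr_sumr; apply: eq_bigr => j _; rewrite natf_div //.
  by rewrite /Lam (bigD1 j) //= dvdn_mulr.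
rewrite mulrCA mulrC -mulrDr mulrC ltr_pM2r // -natr1.
have h1 : N0%:R * (s + q%:R / T%:R) < Y.
  move: hT; rewrite ltr_pdivrMr // => hT.
  by rewrite mulrDr -ltrBrDl mulrA ltr_pdivrMr // [ltRHS]mulrC.
have := ler_wpM2l N00 s'; move: h1; rewrite /Y; slim_lra.
Qed.

End Numerics.

(** * Slow variation of the weight *)

Section Weight.
Variables (R : realType) (phi : R -> R).
Hypothesis phi_adm : admissible phi.

Lemma weight_slope : exists2 r1, 0 < r1 &
  forall a b, r1 <= a -> a < b -> `|phi a - phi b| <= (b - a) / 2.
Proof.
have [_ _ cv] := phi_adm.
have nb : nbhs (0%:E : \bar R) [set x | (x < (1 / 2)%:E)%E].
  by apply: open_ereal_lt'; rewrite lte_fin; lra.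
have [M [_ hM]] := cv _ nb.
exists (Num.max M 0 + 1); first by rewrite ltr_wpDl // le_max lexx orbT.
move=> a b ra ab; have Mr : M < Num.max M 0 + 1 by rewrite ltr_pwDr // le_max lexx.
have ba : 0 < b - a by rewrite subr_gt0.
have := hM _ Mr; rewrite /= => h.
have : (`|(phi a - phi b) / (a - b)|%:E <= (1 / 2)%:E)%E.
  apply: le_trans (ltW h); apply: ereal_sup_ubound; exists a, b; split=> //.
rewrite lee_fin normrM normfV (distrC a b) [`|b - a|]gtr0_norm // ler_pdivrMr //.
by rewrite mulrC mul1r.
Qed.

(** With slopes at most 1/2, phi s >= phi r - |r - s|/2 >= phi r / 2. The threshold r1 + 2 phi r1
    keeps s beyond r1: there phi r <= phi r1 + (r - r1)/2, so r - phi r >= r1. *)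
Lemma weight_ratio : exists r0 : R, forall r s, r0 < r -> `|r - s| <= phi r -> phi r <= 2 * phi s.
Proof.
have [r1 r10 slope] := weight_slope; have [pos _ _] := phi_adm.
have p1 := pos r1 (ltW r10).
exists (r1 + 2 * phi r1) => r s rr rs.
have h1 := slope r1 r (lexx _) ltac:(lra).
have {}h1 : phi r <= phi r1 + (r - r1) / 2 by move: h1; rewrite ler_distlC; lra.
have rs1 : r - s <= phi r by apply: le_trans (ler_norm _) rs.
have rs2 : s - r <= phi r by rewrite distrC in rs; apply: le_trans (ler_norm _) rs.
have s1 : r1 <= s by lra.
have pr : 0 < phi r by apply: pos; lra.
have [sr|sr|->] := ltrgtP s r; last by move: (pr); lra.
- by have := slope s r s1 sr; rewrite ler_distlC; lra.
- by have := slope r s ltac:(lra) sr; rewrite ler_distlC; lra.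
Qed.

End Weight.

Section Norms.
Variable R : realType.
Local Notation C := R[i].

Lemma dotmx_cabs k (x : 'rV[C]_k) : dotmx x x = ((\sum_t cabs (x 0 t) ^+ 2)%:C)%C.
Proof.
rewrite dotmxE mxE rmorph_sum; apply: eq_bigr => t _.
by rewrite !mxE -normCK normr_cabs rmorphXn.
Qed.

Lemma enormE k (x : 'rV[C]_k) : enorm x = Num.sqrt (\sum_t cabs (x 0 t) ^+ 2).
Proof. by rewrite /enorm dotmx_cabs. Qed.

Lemma cabs_le_enorm k (x : 'rV[C]_k) t : cabs (x 0 t) <= enorm x.
Proof.
rewrite enormE -[leLHS](ger0_norm (cabs_ge0 _)) -sqrtr_sqr ler_wsqrtr //.
by rewrite (bigD1 t) //= lerDl sumr_ge0 // => i _; rewrite exprn_ge0 ?cabs_ge0.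
Qed.

Lemma sqrt_shift (A a b : R) : 0 <= A -> 0 <= a -> 0 <= b ->
  Num.sqrt (A + b ^+ 2) <= Num.sqrt (A + a ^+ 2) + `|b - a|.
Proof.
move=> A0 a0 b0; set t := `|b - a|; have t0 : 0 <= t := normr_ge0 _.
have bt : b <= a + t by have := ler_norm (b - a); rewrite -/t; slim_lra.
have Aa : 0 <= A + a ^+ 2 by rewrite addr_ge0 // exprn_ge0.
have sa : a <= Num.sqrt (A + a ^+ 2).
  by rewrite -[leLHS](ger0_norm a0) -sqrtr_sqr ler_wsqrtr // lerDr.
have s2 := sqr_sqrtr Aa.
rewrite -[leRHS]ger0_norm; last by rewrite addr_ge0 ?sqrtr_ge0.
rewrite -sqrtr_sqr ler_wsqrtr // sqrrD s2.
move: sa t0 bt a0 b0; set s := Num.sqrt _; clearbody s t; nra.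
Qed.

Lemma enorm_shift k (x : 'rV[C]_k) (c : C) i :
  `|enorm x - enorm (x + c *: delta_mx 0 i)| <= cabs c.
Proof.
pose A := \sum_(t | t != i) cabs (x 0 t) ^+ 2.
have A0 : 0 <= A by rewrite sumr_ge0 // => t _; rewrite exprn_ge0 ?cabs_ge0.
have E1 : enorm x = Num.sqrt (A + cabs (x 0 i) ^+ 2).
  by rewrite enormE (bigD1 i) //= addrC.
have E2 : enorm (x + c *: delta_mx 0 i) = Num.sqrt (A + cabs (x 0 i + c) ^+ 2).
  rewrite enormE (bigD1 i) //= addrC !mxE !eqxx mulr1; congr (Num.sqrt (_ + _)).
  by apply: eq_bigr => t /negPf ti; rewrite !mxE eqxx ti /= mulr0 addr0.
have c1 : `|cabs (x 0 i + c) - cabs (x 0 i)| <= cabs c.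
  have k1 := cabsD (x 0 i) c; have k2 := cabsD (x 0 i + c) (- c).
  rewrite cabsN addrK in k2; rewrite ler_distl lerBlDr k2 /=; exact: k1.
have h1 := sqrt_shift A0 (cabs_ge0 (x 0 i)) (cabs_ge0 (x 0 i + c)).
have h2 := sqrt_shift A0 (cabs_ge0 (x 0 i + c)) (cabs_ge0 (x 0 i)).
rewrite (distrC (cabs (x 0 i))) in h2.
rewrite E1 E2 ler_distl lerBlDr (le_trans h1) ?lerD2l //=.
by apply: le_trans h2 _; rewrite lerD2l.
Qed.

(** Dropping the subtracted square bounds the length by |dx| / |x|, and |x| >= 1 because of the
    coordinate 1. *)
Lemma fs_length_le n (x dx : 'rV[C]_n.+1) (B : R) i : x 0 i = 1 ->
  (forall t, cabs (dx 0 t) <= B) -> fs_length x dx <= n.+1%:R * B.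
Proof.
move=> xi dxB; have B0 : 0 <= B := le_trans (cabs_ge0 _) (dxB ord0).
rewrite /fs_length !dotmx_cabs normr_cabs -!rmorphXn -!rmorphM -rmorphB -fmorphV -rmorphM /=.
set p := \sum_t _; set X := \sum_t _; set c := cabs _.
have X1 : 1 <= X.
  rewrite /X (bigD1 i) //= xi cabs1 expr1n lerDl sumr_ge0 // => t _.
  by rewrite exprn_ge0 ?cabs_ge0.
have pB : p <= (n.+1%:R * B) ^+ 2.
  apply: le_trans (_ : \sum_(t < n.+1) B ^+ 2 <= _).
    by apply: ler_sum => t _; rewrite lerXn2r ?nnegrE ?cabs_ge0.
  rewrite sumr_const card_ord -[leLHS]mulr_natl exprMn ler_wpM2r ?exprn_ge0 //.
  by rewrite expr2 ler_peMl // ler1n.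
rewrite -[leRHS]ger0_norm ?mulr_ge0 // -sqrtr_sqr ler_wsqrtr //.
have p0 : 0 <= p by rewrite sumr_ge0 // => t _; rewrite exprn_ge0 ?cabs_ge0.
apply: le_trans pB; rewrite ler_pdivrMr ?exprn_gt0 ?(lt_le_trans ltr01) //.
apply: le_trans (_ : p * X <= _); first by rewrite gerBl exprn_ge0 ?cabs_ge0.
by rewrite expr2 mulrA ler_peMr // mulr_ge0 // (le_trans ler01).
Qed.

End Norms.

(** * Restriction to complex lines and partial derivatives *)

Section Lines.
Variable R : realType.
Local Notation C := R[i].
Local Notation cvec k := ('rV[C]_k : normedModType C).

Lemma cder_shift (f : C -> C) w L : cder (fun x => f (w + x)) 0 L -> cder f w L.
Proof.
by move=> h e /h[s s0 hs]; exists s => // x /hs; rewrite add0r addr0.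
Qed.

Lemma shift_cder (f : C -> C) w L : cder f w L -> cder (fun x => f (w + x)) 0 L.
Proof.
by move=> h e /h[s s0 hs]; exists s => // x /hs; rewrite add0r addr0.
Qed.

Lemma eps_cabs (e : C) : 0 < e -> e = ((cabs e)%:C)%C /\ 0 < cabs e.
Proof.
by move=> e0; split; [rewrite -normr_cabs gtr0_norm|rewrite cabs_gt0 gt_eqF].
Qed.

(** Links [cder] with the directional derivatives in which the theorem is stated; [diff_cder] goes
    the other way. *)
Lemma line_derive m (g : cvec m -> C^o) (z v : cvec m) (L : C) :
  cder (fun w => g (z + w *: v)) 0 L -> 'D_v g z = L.
Proof.
move=> h; apply: cvg_lim => //; apply/cvgrPdist_le => eps eps0.
have [epsE e0] := eps_cabs eps0; have [s s0 hs] := h _ e0.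
have sC : 0 < (s%:C)%C :> C by rewrite ltcR.
near=> w.
have w0 : w != 0 by near: w; exact: nbhs_dnbhs_neq.
have ws : cabs w < s.
  have : `|w| < (s%:C)%C by near: w; exact: dnbhs0_lt.
  by rewrite normr_cabs ltcR.
have := hs w ws; rewrite add0r scale0r addr0 => hw.
rewrite normr_cabs epsE lecR /=.
rewrite (_ : L - _ = - (w^-1 * (g (z + w *: v) - g z - L * w))); last first.
  by rewrite /= [w *: v + z]addrC /GRing.scale /=; field.
rewrite cabsN cabsM cabsV mulrC ler_pdivrMr ?cabs_gt0 //.
Unshelve. all: by end_near.
Qed.

Lemma diff_cder m k (h : cvec m -> cvec k) (z v : cvec m) t : differentiable h z ->
  cder (fun w => h (z + w *: v) 0 t) 0 ('d h z v 0 t).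
Proof.
move=> hz; have /cvg_ex[L hL] := @diff_derivable _ _ _ h z v hz.
have E : 'd h z v = L.
  by rewrite -deriveE //; apply: cvg_lim hL.
rewrite E; have := cvg_comp _ _ hL (@coord_continuous C 1 k 0 t L).
move/cvgrPdist_le => hc e e0.
have eC : 0 < (e%:C)%C :> C by rewrite ltcR.
have := hc _ eC; rewrite near_withinE => /nbhs_ballP[s s0 hs].
have [sE s0'] := eps_cabs s0.
exists (cabs s) => // w ws; rewrite add0r scale0r addr0.
have [->|w0] := eqVneq w 0.
  by rewrite scale0r addr0 subrr mulr0 subr0 cabs0 mulr0.
have := hs w; rewrite -ball_normE /= sub0r normrN normr_cabs sE ltcR => /(_ ws w0).
rewrite normr_cabs lecR !mxE /= => hw.
rewrite (_ : _ - _ - _ = - (w * (L 0 t - w^-1 * (h (w *: v + z) 0 t - h z 0 t)))); last first.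
  by rewrite [w *: v + z]addrC; field.
by rewrite cabsN cabsM mulrC; apply: ler_wpM2r => //; exact: cabs_ge0.
Qed.

Lemma line_cdiff m k (h : cvec m -> cvec k) (z v : cvec m) t w : (forall x, differentiable h x) ->
  cdiff (fun w => h (z + w *: v) 0 t) w.
Proof.
move=> hd; exists ('d h (z + w *: v) v 0 t); apply: cder_shift.
under eq_fun do rewrite scalerDl addrA.
exact: diff_cder.
Qed.

Lemma iter_partial m (g : cvec m -> C^o) z (k : 'I_m) p r :
  hol (fun w => g (z + w *: delta_mx 0 k)) 0 r -> forall w, cabs w < r ->
  iter p (partial k) g (z + w *: delta_mx 0 k) =
  iter p (@D R) (fun w => g (z + w *: delta_mx 0 k)) w.
Proof.
set S := fun w => _; move=> Sh; elim: p => [//|p IH] w wr.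
rewrite iterS; apply: line_derive.
have wr' : cabs (w - 0) < r by rewrite subr0.
have rw : 0 < r - cabs w by rewrite subr_gt0.
apply: (@cder_local _ (fun x => iter p (@D R) S (w + x)) _ 0 _ _ rw).
  move=> x; rewrite subr0 => xr; rewrite -addrA -scalerDl IH //.
  by apply: le_lt_trans (cabsD _ _) _; move: xr; slim_lra.
by apply: shift_cder; apply: cderP; exact: (hol_iterD p Sh wr').
Qed.

Lemma mpartial_pure m (g : cvec m -> C^o) (k : 'I_m) p :
  mpartial (mnm_muln (mnm1 k) p) g = iter p (partial k) g.
Proof.
rewrite /mpartial.
have al i : mnm_muln (mnm1 k) p i = ((k == i) * p)%N by rewrite mulmnE mnm1E.
have key s : uniq s -> foldr (fun i h => iter (mnm_muln (mnm1 k) p i) (partial i) h) g s =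
    if k \in s then iter p (partial k) g else g.
  elim: s => [//|i s IH] /= /andP [i_s us]; rewrite IH // al in_cons.
  have [ki|ki] := eqVneq k i; last by rewrite mul0n.
  by rewrite -ki in i_s *; rewrite (negPf i_s) mul1n.
by rewrite key ?enum_uniq // mem_enum.
Qed.

End Lines.

Section Yosida.
Variable R : realType.
Local Notation C := R[i].
Local Notation cvec k := ('rV[C]_k : normedModType C).

(** The left side is the modulus of the derivative at 0 of H_t / H_i0. The ratios to the dominating
    coordinate i are bounded by 2, so Cauchy's estimate applies to them; passing from i to i0, the
    largest coordinate at 0, involves ratios of modulus at most 1, whence the factor 2. *)
Lemma good_velocity n (H : C -> 'rV[C]_n.+1) (s : R) (i0 t : 'I_n.+1) (dH : 'I_n.+1 -> C) : 0 < s ->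
  (forall x t, cdiff (fun z => H z 0 t) x) -> (forall x, H x != 0) -> good H 0 s ->
  (forall t, cabs (H 0 0 t) <= cabs (H 0 0 i0)) ->
  (forall t, cder (fun z => H z 0 t) 0 (dH t)) ->
  cabs (dH t / H 0 0 i0 - H 0 0 t * dH i0 / H 0 0 i0 ^+ 2) <= 2 * (8 * 2 / s).
Proof.
move=> s0 Hd H0 [i hi] i0P HdH.
have Hi x : cabs x < s -> H x 0 i != 0.
  move=> xs; apply/eqP => Hx; have /eqP := H0 x; apply; apply/rowP => u; rewrite mxE.
  apply/eqP; rewrite -cabs_eq0 eq_le cabs_ge0 andbT.
  by apply: le_trans (hi x _ u) _; rewrite ?subr0 // Hx cabs0 mulr0.
have H0i : H 0 0 i != 0 by apply: Hi; rewrite cabs0.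
have v0 : 0 < cabs (H 0 0 i) by rewrite cabs_gt0.
have b1 : 1 <= cabs (H 0 0 i0) / cabs (H 0 0 i) by rewrite ler_pdivlMr // mul1r.
have i00 : H 0 0 i0 != 0 by rewrite -cabs_gt0; exact: lt_le_trans (i0P i).
pose u k x := H x 0 k / H x 0 i.
have uh k : hol (u k) 0 s.
  by move=> x; rewrite subr0 => xs; apply: cdiff_div; [exact: Hi| |].
have ub k : bdd (u k) 0 s 2.
  move=> x xs; have Hx : H x 0 i != 0 by apply: Hi; rewrite subr0 in xs.
  by rewrite cabsM cabsV ler_pdivrMr ?cabs_gt0 //; exact: hi.
have uD k : cabs (D (u k) 0) <= 8 * 2 / s by exact: cauchy_D s0 (uh k) (ub k).
move: (8 * 2 / s) uD => b uD.
have zz : cabs (0 - 0 : C) < s by rewrite subr0 cabs0.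
have uc k : cder (u k) 0 (D (u k) 0) by apply: cderP; exact: uh.
have ui0 : u i0 0 != 0 by rewrite mulf_neq0 ?invr_eq0.
have e1 := cder_div i00 (HdH t) (HdH i0).
have e2 := cder_div ui0 (uc t) (uc i0).
have -> : dH t / H 0 0 i0 - H 0 0 t * dH i0 / H 0 0 i0 ^+ 2 =
    D (u t) 0 / u i0 0 - u t 0 * D (u i0) 0 / u i0 0 ^+ 2.
  apply: cder_uniq e1 (cder_local s0 _ e2) => x; rewrite subr0 => xs.
  by rewrite /u invfM invrK [_^-1 * _]mulrC mulrA divfK // Hi.
have c1 : cabs (u i0 0)^-1 <= 1.
  by rewrite cabsV invf_le1 ?cabs_gt0 // cabsM cabsV.
have c2 : cabs (u t 0 / u i0 0) <= 1.
  rewrite cabsM cabsV ler_pdivrMr ?cabs_gt0 // mul1r !cabsM.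
  by rewrite ler_wpM2r ?cabs_ge0.
rewrite (_ : u t 0 * _ / _ = (u t 0 / u i0 0) * (D (u i0) 0 / u i0 0)); last by field.
have p1 : cabs (D (u t) 0 / u i0 0) <= b.
  by rewrite cabsM -[leRHS]mulr1; apply: ler_pM; rewrite ?cabs_ge0.
have p2 : cabs (D (u i0) 0 / u i0 0) <= b.
  by rewrite cabsM -[leRHS]mulr1; apply: ler_pM; rewrite ?cabs_ge0.
have p3 : cabs (u t 0 / u i0 0 * (D (u i0) 0 / u i0 0)) <= 1 * b.
  by rewrite cabsM; apply: ler_pM; rewrite ?cabs_ge0.
apply: le_trans (cabsD _ _) _; rewrite cabsN.
rewrite (_ : 2 * b = b + 1 * b); last by ring.
exact: lerD.
Qed.

(** By the quotient rule the velocity in the chart has the form c dF + b F, the case covered by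
    [fs_length_lift]. *)
Lemma fs_speedE m n (f : cvec m -> Pn R n) (F : cvec m -> cvec n.+1) (z xi : cvec m) :
  holomorphic f -> reduced_representation f F ->
  fs_speed f z xi = fs_length (F z) ('d F z xi).
Proof.
move=> f_hol [Fe F0 Fh].
have ck0 : in_chart (a_chart (f z)) (f z).
  rewrite /a_chart; case: pickP => //= nk.
  have /eqP := F0 z; case; apply/rowP => k; rewrite mxE; apply/eqP.
  by have := nk k; rewrite (in_chartE k (Fh z)) => /negbFE.
rewrite /fs_speed; set k0 := a_chart (f z) in ck0 *.
have yk : F z 0 k0 != 0 by rewrite -(in_chartE k0 (Fh z)).
have [_ /(_ z ck0) cd] := f_hol k0.
pose y : 'rV[C]_n.+1 := F z; pose dy : 'rV[C]_n.+1 := 'd F z xi.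
pose dc : 'rV[C]_n.+1 := 'd (fun w => chart k0 (f w)) z xi.
have E : dc = (y 0 k0)^-1 *: dy + (- (dy 0 k0 / y 0 k0 ^+ 2)) *: y.
  apply/rowP => t.
  have h1 : cder (fun w => chart k0 (f (z + w *: xi)) 0 t) 0 (dc 0 t) by exact: (diff_cder xi t cd).
  have Fz : F (z + 0 *: xi) = y by rewrite scale0r addr0.
  have hF u : cder (fun w => F (z + w *: xi) 0 u) 0 (dy 0 u) by exact: (diff_cder xi u (Fe z)).
  have yk' : F (z + 0 *: xi) 0 k0 != 0 by rewrite Fz.
  have h2 := cder_div yk' (hF t) (hF k0).
  rewrite Fz in h2.
  have {}h2 : cder (fun w => chart k0 (f (z + w *: xi)) 0 t) 0
     (dy 0 t / y 0 k0 - y 0 t * dy 0 k0 / y 0 k0 ^+ 2).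
    apply: (cder_local ltr01 _ h2) => w _.
    by rewrite (chartE k0 (Fh _)) mxE mulrC.
  clear -h1 h2; clearbody dc dy y.
  have E0 := cder_uniq h1 h2; rewrite E0 !mxE.
  by rewrite mulrC mulNr; congr (_ - _); rewrite [in RHS]mulrC mulrA.
have -> : fs_length (F z) dy = fs_length (chart k0 (f z)) dc; last by [].
rewrite E (chartE k0 (Fh z)) fs_length_lift //; first by rewrite invr_eq0.
Qed.

Lemma real_sup_bound (S : set (\bar R)) : (ereal_sup S < +oo)%E ->
  exists K : R, forall x : R, S x%:E -> x <= K.
Proof.
case E : (ereal_sup S) => [r| |] // _.
  by exists r => x Sx; rewrite -lee_fin -E; exact: ereal_sup_ubound.
by exists 0 => x Sx; have := ereal_sup_ubound Sx; rewrite E.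
Qed.

End Yosida.

(** * Coordinate slices and the length of tangent vectors *)

Section Reduction.
Variable R : realType.
Local Notation C := R[i].
Local Notation cvec k := ('rV[C]_k : normedModType C).

Definition slice m n (F : cvec m -> cvec n.+1) (z : cvec m) (h : R) (k : 'I_m) (w : C) : 'rV[C]_n.+1 :=
  F (z + ((h%:C)%C * w) *: delta_mx 0 k).

Lemma slice_cder m n (F : cvec m -> cvec n.+1) (z : cvec m) h k t : entire F ->
  cder (fun w => slice F z h k w 0 t) 0 ((h%:C)%C * 'd F z (delta_mx 0 k) 0 t).
Proof.
move=> Fe; pose g w := F (z + w *: delta_mx 0 k) 0 t.
have h1 : cder g ((h%:C)%C * 0) ('d F z (delta_mx 0 k) 0 t).
  by rewrite mulr0; exact: diff_cder.
have h2 : cder (fun w => (h%:C)%C * w) 0 (0 * 0 + (h%:C)%C * 1).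
  by apply: cderM; [exact: cder_cst|exact: cder_id].
have := cder_comp h2 h1.
by rewrite mul0r add0r mulr1 mulrC.
Qed.

Lemma slice_cdiff m n (F : cvec m -> cvec n.+1) (z : cvec m) h k t w : entire F ->
  cdiff (fun w => slice F z h k w 0 t) w.
Proof.
move=> Fe; apply: (@cdiff_comp _ (fun w => F (z + w *: delta_mx 0 k) 0 t)).
  by apply: cdiffM; [exact: cdiff_cst|exact: cdiff_id].
exact: line_cdiff.
Qed.

(** The lift is normalised by its largest coordinate i, and the multiple of y is chosen so that the
    velocity has i-th coordinate 0. It is then a sum of m slice velocities with coefficients of
    modulus at most 1. *)
Lemma speed_le m n (F : cvec m -> cvec n.+1) (z xi : cvec m) (h s : R) : entire F ->
  (forall z, F z != 0) -> enorm xi = 1 -> 0 < h -> 0 < s ->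
  (forall k, good (slice F z h k) 0 s) ->
  h * fs_length (F z) ('d F z xi) <= n.+1%:R * (m%:R * (2 * (8 * 2 / s))).
Proof.
move=> Fe F0 xi1 h0 s0 gs; pose y : 'rV[C]_n.+1 := F z.
pose i := [arg max_(i > ord0) cabs (y 0 i)]%O.
have iP t : cabs (y 0 t) <= cabs (y 0 i) by rewrite /i; case: arg_maxP => //= j _ hj; exact: hj.
have yi : y 0 i != 0.
  apply/eqP => yi; have /eqP := F0 z; apply; apply/rowP => t; rewrite mxE.
  by apply/eqP; rewrite -cabs_eq0 eq_le cabs_ge0 andbT (le_trans (iP t)) // yi cabs0.
pose dy k : 'rV[C]_n.+1 := 'd F z (delta_mx 0 k).
pose dx : 'rV[C]_n.+1 := 'd F z xi.
have dyE : dx = \sum_k xi 0 k *: dy k.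
  rewrite /dx {1}(row_sum_delta xi) linear_sum; apply: eq_bigr => k _.
  by rewrite linearZ.
change (h * fs_length y dx <= n.+1%:R * (m%:R * (2 * (8 * 2 / s)))).
clearbody dx; have y0 : y != 0 by exact: F0.
have yi' : (y 0 i)^-1 != 0 by rewrite invr_eq0.
rewrite -(fs_length_lift dx (- (dx 0 i / y 0 i ^+ 2)) y0 yi') dyE.
have hC : cabs ((h%:C)%C : C) = h by rewrite cabsR gtr0_norm.
have b k t : cabs (dy k 0 t / y 0 i - y 0 t * dy k 0 i / y 0 i ^+ 2) <= 2 * (8 * 2 / s) / h.
  have S0 : slice F z h k 0 = y by rewrite /slice mulr0 scale0r addr0.
  have Sd x u : cdiff (fun w => slice F z h k w 0 u) x by exact: slice_cdiff.
  have Sn x : slice F z h k x != 0 by exact: F0.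
  have Si u : cabs (slice F z h k 0 0 u) <= cabs (slice F z h k 0 0 i) by rewrite S0.
  have := good_velocity t s0 Sd Sn (gs k) Si (fun u => slice_cder z h k u Fe).
  rewrite S0 ler_pdivlMr //; apply: le_trans; rewrite -{1}hC mulrC -cabsM.
  by rewrite -/(dy k) le_eqVlt; apply/orP; left; apply/eqP; congr cabs; ring.
rewrite -ler_pdivlMl //; apply: le_trans (@fs_length_le _ _ _ _ (m%:R * (2 * (8 * 2 / s) / h)) i _ _) _.
- by rewrite mxE mulVf.
- move=> t; rewrite !mxE !summxE.
  rewrite (_ : _ + _ = \sum_k xi 0 k * (dy k 0 t / y 0 i - y 0 t * dy k 0 i / y 0 i ^+ 2)).
    apply: le_trans (cabs_sum _ _ _) _.
    rewrite -[m in m%:R]card_ord mulr_natl -sumr_const; apply: ler_sum => k _.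
    rewrite cabsM -[leRHS]mul1r; apply: ler_pM; rewrite ?cabs_ge0 ?b //.
    by rewrite -xi1 cabs_le_enorm.
  rewrite mulr_sumr mulr_suml -sumrN mulr_suml -big_split /=; apply: eq_bigr => k _.
  by rewrite !mxE; ring.
rewrite le_eqVlt; apply/orP; left; apply/eqP.
by move: (8 * 2 / s) => c; ring.
Qed.

End Reduction.

Section Slices.
Variable R : realType.
Local Notation C := R[i].
Local Notation cvec k := ('rV[C]_k : normedModType C).

(* A slice only sees the multi-indices p e_k. *)
Lemma slice_iterD m n (Q : mpoly n.+1 C) (F : cvec m -> cvec n.+1) (z : cvec m) (h : R)
    (k : 'I_m) (i : 'I_n.+1) (w : C) p : entire F ->
  let z' := z + ((h%:C)%C * w) *: delta_mx 0 k in F z' 0 i != 0 ->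
  iter p (@D R) (fun x => peval Q ((slice F z h k x 0 i)^-1 *: slice F z h k x)) w =
  (h%:C)%C ^+ p * mpartial (mnm_muln (mnm1 k) p) (fun u => peval Q (dehomog F i u)) z'.
Proof.
move=> Fe z' Fi; pose g (u : cvec m) : C^o := peval Q (dehomog F i u).
pose S y := g (z' + y *: delta_mx 0 k).
have Fc y t : cdiff (fun y => F (z' + y *: delta_mx 0 k) 0 t) y by exact: line_cdiff.
have Fi2 : 0 < cabs (F z' 0 i) / 2 by rewrite divr_gt0 // cabs_gt0.
have [r r0 hr] := cdiff_cont (Fc 0 i) Fi2.
have Sh : hol S 0 r.
  move=> y /hr; rewrite scale0r addr0 => hy.
  apply: peval_cdiff => t; under eq_fun do rewrite mxE.
  apply: (@cdiff_div _ (fun y => F (z' + y *: delta_mx 0 k) 0 t)); [|exact: Fc|exact: Fc].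
  have := le_cabsB (F z' 0 i) (F (z' + y *: delta_mx 0 k) 0 i).
  rewrite -cabs_gt0 cabsB; move: hy Fi2; move: (cabs _) (cabs _) (cabs _) => u1 u2 u3; clear; slim_lra.
have SE x : peval Q ((slice F z h k x 0 i)^-1 *: slice F z h k x) =
    1 * S (- ((h%:C)%C * w) + (h%:C)%C * x).
  rewrite mul1r /S /g; congr peval; apply/rowP => t; rewrite !mxE mulrC /slice.
  have -> : z' + (- ((h%:C)%C * w) + (h%:C)%C * x) *: delta_mx 0 k =
      z + ((h%:C)%C * x) *: delta_mx 0 k.
    by rewrite scalerDl scaleNr addrA addrK.
  by [].
under eq_fun do rewrite SE.
have E0 : - ((h%:C)%C * w) + (h%:C)%C * w = 0 by rewrite addNr.
rewrite (iterD_affine 1 p Sh) E0 ?subrr ?cabs0 // mul1r mpartial_pure; congr (_ * _).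
have r0' : cabs (0 : C) < r by rewrite cabs0.
have := @iter_partial R m g z' k p r Sh 0 r0'.
by rewrite scale0r addr0.
Qed.

Lemma slice_iterD_le m n (Q : mpoly n.+1 C) (F : cvec m -> cvec n.+1) (z : cvec m) (h h' K : R)
    (k : 'I_m) (i : 'I_n.+1) (w : C) p N : entire F -> 0 < h -> h <= 2 * h' -> (p <= N)%N ->
  let z' := z + ((h%:C)%C * w) *: delta_mx 0 k in F z' 0 i != 0 ->
  h' ^+ p * cabs (mpartial (mnm_muln (mnm1 k) p) (fun u => peval Q (dehomog F i u)) z') <= K ->
  cabs (iter p (@D R) (fun x => peval Q ((slice F z h k x 0 i)^-1 *: slice F z h k x)) w)
    <= 2 ^+ N * `|K|.
Proof.
move=> Fe h0 hh' pN z' Fi; rewrite (slice_iterD Q p Fe Fi) cabsM cabsX cabsR gtr0_norm //.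
move: (cabs (mpartial _ _ _)) (cabs_ge0 (mpartial (mnm_muln (mnm1 k) p)
                    (fun w => peval Q (dehomog F i w)) z')) => c c0 hK.
have h'0 : 0 < h' by move: h0 hh'; clear; slim_lra.
apply: le_trans (_ : 2 ^+ p * (h' ^+ p * c) <= _).
  rewrite mulrA; apply: ler_wpM2r => //.
  rewrite -exprMn; apply: lerXn2r => //; rewrite nnegrE; first exact: ltW.
  by apply: mulr_ge0 => //; exact: ltW.
apply: ler_pM.
- exact: exprn_ge0.
- by apply: mulr_ge0 => //; apply: exprn_ge0; exact: ltW.
- by apply: ler_weXn2l; [rewrite ler1n|].
- by apply: le_trans hK _; exact: ler_norm.
Qed.

Lemma slice_shift m (z : cvec m) (k : 'I_m) (h : R) (w : C) : cabs w < 1 -> 0 < h ->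
  `|enorm z - enorm (z + ((h%:C)%C * w) *: delta_mx 0 k)| <= h.
Proof.
move=> w1 h0; apply: le_trans (enorm_shift _ _ _) _.
by rewrite cabsM cabsR gtr0_norm // ler_piMr // ltW.
Qed.

Lemma slices_good (m n q : nat) (phi : R -> R)
    (d : 'I_q -> nat) (Q : 'I_q -> mpoly n.+1 C)
    (l : 'I_q -> option nat) (F : cvec m -> cvec n.+1) (ind : cvec m -> 'I_n.+1)
    (phi_adm : admissible phi)
    (Q_hyp : forall j, hypersurface_eq (d j) (Q j))
    (q_ge : (n * nS n d + 2 * n + 1 <= q)%N)
    (Q_gp : general_position Q)
    (l_ge1 : forall j, le_mult 1 (l j))
    (l_sum : \sum_(j < q) inv_mult R (l j) <
      (q%:R - n%:R - (n%:R - 1) * ((nS n d)%:R + 1))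
        / ((nS n d)%:R * ((nS n d)%:R + 2)))
    (Fe : entire F) (F0 : forall z, F z != 0)
    (ind_ok : forall z, F z 0 (ind z) != 0)
    (Q_bound : forall j, le_mult 2 (l j) ->
      (ereal_sup [set y | exists (alpha : multinom m) (z : 'rV[R[i]]_m),
         [/\ (1 <= mdeg alpha)%N, le_mult (mdeg alpha) (omap predn (l j)),
             peval (Q j) (F z) = 0%R &
             y = ((phi (enorm z) ^+ mdeg alpha *
                  cabs (mpartial alpha
                    (fun w => peval (Q j) (dehomog F (ind z) w)) z))%R)%:E]]
       < +oo)%E) :
  exists r0 s : R, 0 < s /\
    forall (z : cvec m) k, r0 < enorm z -> good (slice F z (phi (enorm z)) k) 0 s.
Proof.
have [r0 ratio] := weight_ratio phi_adm; have [pos _ _] := phi_adm.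
have [l' [l'0 l'E num_lt]] := finite_multiplicities q_ge l_ge1 l_sum.
pose T := {zk : cvec m * 'I_m | r0 < enorm zk.1}.
pose H (u : T) := slice F (val u).1 (phi (enorm (val u).1)) (val u).2.
have e0 k (x : 'rV[C]_k) : 0 <= enorm x by exact: sqrtr_ge0.
have [|||s s0 hs] := @normal_family R n q d Q l' T H Q_hyp Q_gp l'0 num_lt.
- by move=> u x t; exact: slice_cdiff.
- by move=> u x; exact: F0.
(* If l_j = 1 there is no order p with 0 < p < l_j, and the bound 0 will do. *)
- move=> j; have [l2|l1] := boolP (le_mult 2 (l j)); last first.
    exists 0 => u w _ _; eexists; first exact: ind_ok.
    move=> p pl; have lj : l j = Some (l' j) by apply: l'E => lj; rewrite lj in l1.
    by move: l1; rewrite lj /= -ltnNge => l1; exfalso; move: pl l1; clear; lia.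
  have [K hK] := real_sup_bound (Q_bound j l2).
  exists (2 ^+ l' j * `|K|) => u w w1.
  set z := (val u).1; set k := (val u).2; set h := phi (enorm z).
  have zr : r0 < enorm z by exact: valP u.
  have h0 : 0 < h by exact: pos _ (e0 _ _).
  change (peval (Q j) (F (z + ((h%:C)%C * w) *: delta_mx 0 k)) = 0 ->
    exists2 i, F (z + ((h%:C)%C * w) *: delta_mx 0 k) 0 i != 0 &
    forall p, (0 < p < l' j)%N ->
      cabs (iter p (@D R) (fun x => peval (Q j) ((slice F z h k x 0 i)^-1 *: slice F z h k x)) w)
        <= 2 ^+ l' j * `|K|).
  have key h' i p N := @slice_iterD_le m n (Q j) F z h h' K k i w p N Fe h0.
  have sh := slice_shift z k w1 h0.
  move: (z + ((h%:C)%C * w) *: delta_mx 0 k) key sh => z' key sh Qw.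
  (* The slice is rescaled by the weight at z, while the hypothesis weighs the derivatives at z'.
     The norms of z and z' differ by at most the weight at z, so [weight_ratio] compares the two
     weights. *)
  have hh' : h <= 2 * phi (enorm z') by exact: ratio zr sh.
  have h'0 : 0 < phi (enorm z') by exact: pos _ (e0 _ _).
  exists (ind z'); first exact: ind_ok.
  move=> p /andP[p0 pl].
  have al : mdeg (mnm_muln (mnm1 k) p) = p by rewrite mdegMn mdeg1 mul1n.
  apply: (key (phi (enorm z')) _ _ _ hh' (ltnW pl) (ind_ok z')).
  apply: hK; exists (mnm_muln (mnm1 k) p), z'; rewrite al; split=> //.
  case lj : (l j) => [x|] //=; have := l'E j; rewrite lj => h1.
  have [->] : Some x = Some (l' j) by apply: h1.
  by rewrite -ltnS prednK.
by exists r0, s; split=> // z k zr; exact: (hs (exist _ (z, k) zr)).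
Qed.

End Slices.

Theorem theorem4p6 (R : realType) (m n q : nat) (phi : R -> R)
    (f : 'rV[R[i]]_m -> Pn R n) (d : 'I_q -> nat) (Q : 'I_q -> mpoly n.+1 R[i])
    (l : 'I_q -> option nat) (F : 'rV[R[i]]_m -> 'rV[R[i]]_n.+1)
    (ind : 'rV[R[i]]_m -> 'I_n.+1)
    (m_ge1 : (1 <= m)%N) (n_ge1 : (1 <= n)%N)
    (phi_adm : admissible phi)
    (f_hol : holomorphic f)
    (Q_hyp : forall j, hypersurface_eq (d j) (Q j))
    (q_ge : (n * nS n d + 2 * n + 1 <= q)%N)
    (Q_gp : general_position Q)
    (l_ge1 : forall j, le_mult 1 (l j))
    (l_sum : \sum_(j < q) inv_mult R (l j) <
      (q%:R - n%:R - (n%:R - 1) * ((nS n d)%:R + 1))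
        / ((nS n d)%:R * ((nS n d)%:R + 2)))
    (F_red : reduced_representation f F)
    (ind_ok : forall z, F z 0 (ind z) != 0)
    (Q_bound : forall j, le_mult 2 (l j) ->
      (ereal_sup [set y | exists (alpha : multinom m) (z : 'rV[R[i]]_m),
         [/\ (1 <= mdeg alpha)%N, le_mult (mdeg alpha) (omap predn (l j)),
             peval (Q j) (F z) = 0%R &
             y = ((phi (enorm z) ^+ mdeg alpha *
                  cabs (mpartial alpha
                    (fun w => peval (Q j) (dehomog F (ind z) w)) z))%R)%:E]]
       < +oo)%E) :
  yosida phi f.
Proof.
split=> //; have [Fe F0 _] := F_red; have [pos _ _] := phi_adm.
have [r0 [s [s0 gs]]] := slices_good phi_adm Q_hyp q_ge Q_gp l_ge1 l_sum Fe F0 ind_ok Q_bound.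
pose A := [set p : 'rV[R[i]]_m * 'rV[R[i]]_m | r0 < enorm p.1 /\ enorm p.2 = 1].
have hA : infty_unit A by exists r0.
apply: le_lt_trans (ltry (n.+1%:R * (m%:R * (2 * (8 * 2 / s))))).
(* The upper limit is an infimum of suprema over the filter, so one set of the filter with a finite
   bound suffices. *)
apply: le_trans (ereal_inf_lbound _) _; first by exists A; [exact: hA|].
apply: ge_ereal_sup => _ [[z xi] [/= zr xi1] <-].
rewrite lee_fin (fs_speedE z xi f_hol F_red).
apply: speed_le => //; last by move=> k; exact: gs.
by apply: pos; exact: sqrtr_ge0.
Qed.
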